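(* In the coupled fracture–porous media setting described in the context, let $W$ (equal to $W_p$ in $\Omega_p$ and $W_f$ in $\Omega_f$) be the solution of the original problem (I), and let $\bar W$ (equal to $\bar W_p$ in $\Omega_p$ and $\bar W_f$ in $\Omega_f$, with $\bar W_f$ independent of $\lambda$) be the solution of the reduced problem (II), where $\bar q=\langle k_p\nabla\bar W_p,\mathbf n_f\rangle$ on $\Gamma_f$. Assume that there is a constant $C_0$ such that $$\left|\frac{\bar q(u)}{h}\right|\le C_0\qquad\text{at all points of }\Gamma_f .$$ Then there is a constant $C$, depending on $C_0$ (and on the other fixed data) but not on $h$, such that $$\|\nabla (W-\bar W)\|_{L^2(\Omega_p)}^2\le C\,h^{8/3}.$$
   Context: Geometry. One considers half of a symmetric fracture–reservoir domain; nothing depends on $v$, so one works in the two-dimensional cross section. $\Omega=\Omega_p\cup\Omega_f$, where $\Omega_p$ is the porous medium (a bounded Euclidean domain) and $\Omega_f$ is the (half-)fracture of constant thickness $h>0$. $\Gamma_f$ is the top boundary of the fracture, i.e. the interface between $\Omega_f$ and $\Omega_p$; it is given (fixed), and so is $\Omega_p$, as $h$ varies. $\Gamma_w$ is the well boundary (it meets both $\partial\Omega_p$ and $\partial\Omega_f$), $\Gamma_{out}$ is the outer boundary of $\Omega$ (so $\partial\Omega_p$ consists of $\Gamma_f$, $\Gamma_{out}$ and part of $\Gamma_w$), and $\Gamma_{f_{out}}$ is the right extremum of the fracture. $\mathbf n_f$ is the unit normal on $\Gamma_f$ pointing out of $\Omega_f$ (into $\Omega_p$), and $\mathbf n$ is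 the outward unit normal on $\Gamma_{out}$ and on $\Gamma_{f_{out}}$. The fracture $\Omega_f$ is parametrized as $\mathbf R=\mathbf r+\lambda\,\mathbf n_f$, $0\le\lambda\le h$, where the profile $\mathbf r$ is determined by $\mathbf r+h\mathbf n_f=$ the given parametrization of $\Gamma_f$; so in coordinates $\Omega_f=\{(u,\lambda):0<u<L,\ 0<\lambda<h\}$ with $\Gamma_f=\{\lambda=h\}$, well part $\{u=0\}$ and $\Gamma_{f_{out}}=\{u=L\}$. It is endowed with the $\lambda$-independent Riemannian metric $g=\mathrm{diag}(1+f_u^2,1)$ in the coordinates $(u,\lambda)$, with $f$ a smooth function of $u$ describing the cylindrical profile and $f_u=f'(u)$. Thus $\nabla_g\phi=\langle\frac{1}{1+f_u^2}\partial_u\phi,\partial_\lambda\phi\rangle$, $\langle X,Y\rangle_g=(1+f_u^2)X^1Y^1+X^2Y^2$, $\|X\|_g=\sqrt{\langle X,X\rangle_g}$, $\nabla_g\cdot X=\frac{1}{\sqrt{|g|}}\sum_i\partial_i(\sqrt{|g|}X^i)$, $|g|=1+f_u^2$. Convention of the model: the Euclidean volume and area elements $d\Omega$, $dS$ of the fracture (in particular arclength on $\Gamma_f$) coincide with the manifold ones, $d\Omega=d\mu=\sqrt{1+f_u^2}\,du\,d\lambda$ and $dS=d\tilde\mu=\sqrt{1+f_u^2}\,du$ on $\Gamma_f$. On $\Omega_p$, $\nabla$ and $\langle\cdot,\cdot\rangle$ are Euclidean. Constants: $k_p>0$ (permeability of the porous medium), $Q>0$, $\alpha>0$, $\beta\ge0$;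 $|\Omega|$ is the volume of $\Omega$; $f_\beta(s)=\dfrac{2}{\alpha+\sqrt{\alpha^2+4\beta s}}$. (I) Original problem: $-\nabla\cdot(k_p\nabla W_p)=\frac{Q}{|\Omega|}$ in $\Omega_p$; $-\nabla_g\cdot\big(f_\beta(\|\nabla_gW_f\|_g)\nabla_gW_f\big)=\frac{Q}{|\Omega|}$ in $\Omega_f$; $W_p=W_f$ and $\langle k_p\nabla W_p,\mathbf n_f\rangle=\langle f_\beta(\|\nabla_gW_f\|_g)\nabla_gW_f,\mathbf n_f\rangle_g$ on $\Gamma_f$; $W_p=W_f=0$ on $\Gamma_w$; $\langle k_p\nabla W_p,\mathbf n\rangle=0$ on $\Gamma_{out}$; $\langle f_\beta(\|\nabla_gW_f\|_g)\nabla_gW_f,\mathbf n\rangle_g=0$ on $\Gamma_{f_{out}}$; and zero normal flux on the symmetry boundary $\{\lambda=0\}$ of $\Omega_f$. (II) Reduced problem: $-\nabla\cdot(k_p\nabla\bar W_p)=\frac{Q}{|\Omega|}$ in $\Omega_p$; $-\nabla_g\cdot\big(f_\beta(\|\nabla_g\bar W_f\|_g)\nabla_g\bar W_f\big)=\frac{Q}{|\Omega|}+\frac{\bar q}{h}$ in $\Omega_f$; $\bar W_p=\bar W_f$ on $\Gamma_f$; $\bar W_p=\bar W_f=0$ on $\Gamma_w$; $\langle k_p\nabla\bar W_p,\mathbf n_f\rangle=\bar q$ on $\Gamma_f$ ($\bar q=\bar q(u)$ is the flux entering the fracture from the reservoir); $\langle k_p\nabla\bar W_p,\mathbf n\rangle=0$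 on $\Gamma_{out}$; $\langle f_\beta(\|\nabla_g\bar W_f\|_g)\nabla_g\bar W_f,\mathbf n\rangle_g=0$ on $\Gamma_{f_{out}}$. The function $\bar W_f$ does not depend on $\lambda$. Solutions are understood to be classical: in each subdomain they and their gradients are $C^2$ up to the boundary. *)

(* Defs.v *)
From HB Require Import structures.
From mathcomp Require Import all_boot all_order all_algebra.
From mathcomp Require Import all_classical all_reals all_analysis.

Set Implicit Arguments.
Unset Strict Implicit.
Unset Printing Implicit Defensive.

Import Order.TTheory GRing.Theory Num.Theory.
Import numFieldNormedType.Exports.

Local Open Scope classical_set_scope.
Local Open Scope ring_scope.

Notation leb2 R := (@lebesgue_measure R \x @lebesgue_measure R)%E.

Section Plane.
Variable R : realType.
Implicit Types (A : set (R * R)) (u : R * R -> R) (D X : R * R -> R * R).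

(* The norm that the library puts on R * R is the max norm, so the Euclidean
   inner product is spelled out. *)
Definition dotp (v w : R * R) : R := v.1 * w.1 + v.2 * w.2.

Definition e1 : R * R := (1, 0).
Definition e2 : R * R := (0, 1).

Definition grad u (z : R * R) : R * R := ('D_e1 u z, 'D_e2 u z).

Definition div X (z : R * R) : R :=
  'D_e1 (fun w => (X w).1) z + 'D_e2 (fun w => (X w).2) z.

(* D is the gradient of u on the open set A together with its continuous
   extension to the closure of A; values outside the closure are irrelevant. *)
Definition gradient_upto A u D : Prop :=
  (forall z, A z -> differentiable u z /\ grad u z = D z) /\
  {within closure A, continuous D}.

(* u is of class C^k on the open set A, up to the boundary. *)
Fixpoint Ck_upto (k : nat) A u : Prop :=
  {within closure A, continuous u} /\
  if k is k'.+1 then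
    exists D, [/\ gradient_upto A u D, Ck_upto k' A (fun z => (D z).1)
                & Ck_upto k' A (fun z => (D z).2)]
  else True.

(* The function u, with gradient D, and this gradient are C^2 up to the
   boundary of A. *)
Definition classical_upto A u D : Prop :=
  [/\ gradient_upto A u D, Ck_upto 2%N A u,
      Ck_upto 2%N A (fun z => (D z).1) & Ck_upto 2%N A (fun z => (D z).2)].

Definition velocity (c : R -> R * R) (t : R) : R * R :=
  (derive1 (fun s => (c s).1) t, derive1 (fun s => (c s).2) t).

(* Curves are total functions, of which only the restriction to a compact
   interval is used; a C^1 curve on [0, T] always extends to a C^1 curve. *)
Definition C1_curve (c : R -> R * R) : Prop :=
  [/\ forall t, derivable (fun s => (c s).1) t 1,
      forall t, derivable (fun s => (c s).2) t 1
    & continuous (velocity c)].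

Definition points_into A (x n : R * R) : Prop :=
  exists2 e : R, 0 < e & forall s, 0 < s < e -> A (x + s *: n).

Definition outward_unit_normal A (c : R -> R * R) (t : R) (n : R * R) : Prop :=
  [/\ dotp n n = 1, dotp n (velocity c t) = 0,
      points_into A (c t) (- n) & points_into (~` closure A) (c t) n].

(* A is a bounded domain with piecewise C^1 boundary: the boundary is the union
   of the simple regular arcs c i on [0, T i], which meet at end points only,
   and nu i t is the outward unit normal at the point c i t. *)
Record piecewise_C1_domain A (I : finType) (T : I -> R) (c : I -> R -> R * R)
    (nu : I -> R -> R * R) : Prop := {
  pcd_open : open A;
  pcd_connected : connected A;
  pcd_bounded : bounded_set A;
  pcd_boundary : closure A `\` A = \bigcup_(i : I) (c i @` `[0, T i]);
  pcd_len : forall i, 0 < T i;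
  pcd_C1 : forall i, C1_curve (c i);
  pcd_regular : forall i t, 0 <= t <= T i -> velocity (c i) t != 0;
  pcd_simple : forall i s t,
    0 <= s <= T i -> 0 <= t <= T i -> c i s = c i t -> s = t;
  pcd_meet : forall i j s t, i != j ->
    0 <= s <= T i -> 0 <= t <= T j -> c i s = c j t ->
    (s = 0 \/ s = T i) /\ (t = 0 \/ t = T j);
  pcd_normal : forall i t, 0 < t < T i -> outward_unit_normal A (c i) t (nu i t)
}.

End Plane.

(* The boundary arc of index None is Gamma_f, parametrized by u in [0, L];
   the other arcs make up Gamma_out and the part of Gamma_w lying on the
   boundary of Omega_p. *)
Record geometry (R : realType) := Geometry {
  Omp : set (R * R);
  narcs : nat;
  arc_len : option 'I_narcs -> R;
  arc : option 'I_narcs -> R -> R * R;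
  nu : option 'I_narcs -> R -> R * R;
  is_well : pred 'I_narcs;
  Omp_domain : piecewise_C1_domain Omp arc_len arc nu;
  well_meets : exists i, is_well i;
  profile : R -> R;
  profile_smooth : forall n x, derivable (derive1n n profile) x 1;
  (* arclength on Gamma_f is sqrt (1 + f_u^2) du *)
  arclength_f : forall u, 0 <= u <= arc_len None ->
    dotp (velocity (arc None) u) (velocity (arc None) u)
    = 1 + (derive1 profile u) ^+ 2
}.

Arguments arc_len {R} g _.
Arguments arc {R} g _ _.
Arguments nu {R} g _ _.
Arguments is_well {R} g.

Section Model.
Variables (R : realType) (G : geometry R).
Implicit Types (D X Y : R * R -> R * R) (z : R * R).

Definition L : R := arc_len G None.
Definition gam (u : R) : R * R := arc G None u.
(* The normal to Gamma_f points into Omega_p. *)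
Definition nf (u : R) : R * R := - nu G None u.

(* The fracture, in the coordinates z = (u, lambda). *)
Definition Omf (h : R) : set (R * R) := `]0, L[ `*` `]0, h[.

(* Determinant of the metric diag (1 + f_u^2, 1). *)
Definition detg z : R := 1 + (derive1 (profile G) z.1) ^+ 2.

Definition ipg z (v w : R * R) : R := detg z * v.1 * w.1 + v.2 * w.2.
Definition normg z (v : R * R) : R := Num.sqrt (ipg z v v).

(* Riemannian gradient, from the coordinate partial derivatives D. *)
Definition gradg D z : R * R := ((D z).1 / detg z, (D z).2).

Definition divg X z : R :=
  div (fun w => Num.sqrt (detg w) *: X w) z / Num.sqrt (detg z).

Definition vol (h : R) : R :=
  fine (leb2 R (Omp G)) + \int[leb2 R]_(z in Omf h) Num.sqrt (detg z).

(* g-unit normals of the sides of the fracture: Gamma_f (lambda = h), pointing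
   into Omega_p; Gamma_{f_out} (u = L) and the symmetry boundary (lambda = 0),
   pointing outwards. *)
Definition nf_top : R * R := (0, 1).
Definition n_fout : R * R := ((Num.sqrt (detg (L, 0)))^-1, 0).
Definition n_sym : R * R := (0, -1).

Variables (kp Q alpha beta : R).

Definition fbeta (s : R) : R :=
  2 / (alpha + Num.sqrt (alpha ^+ 2 + 4 * beta * s)).

Definition fluxg D z : R * R := fbeta (normg z (gradg D z)) *: gradg D z.

Definition fluxp D z : R * R := kp *: D z.

(* DWp and DWf are the gradients (in the coordinates (u, lambda) for DWf),
   extended by continuity to the boundary. Conditions involving a
   normal are imposed at the interior points of the smooth boundary arcs. *)
Record original_problem (h : R) (Wp : R * R -> R) (DWp : R * R -> R * R)
    (Wf : R * R -> R) (DWf : R * R -> R * R) : Prop := {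
  op_Wp : classical_upto (Omp G) Wp DWp;
  op_Wf : classical_upto (Omf h) Wf DWf;
  op_eqp : forall z, Omp G z -> - div (fluxp DWp) z = Q / vol h;
  op_eqf : forall z, Omf h z -> - divg (fluxg DWf) z = Q / vol h;
  op_match : forall u, 0 <= u <= L -> Wp (gam u) = Wf (u, h);
  op_flux : forall u, 0 < u < L ->
    dotp (fluxp DWp (gam u)) (nf u) = ipg (u, h) (fluxg DWf (u, h)) nf_top;
  op_wellp : forall i t, is_well G i -> 0 <= t <= arc_len G (Some i) ->
    Wp (arc G (Some i) t) = 0;
  op_wellf : forall l, 0 <= l <= h -> Wf (0, l) = 0;
  op_out : forall i t, ~~ is_well G i -> 0 < t < arc_len G (Some i) ->
    dotp (fluxp DWp (arc G (Some i) t)) (nu G (Some i) t) = 0;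
  op_fout : forall l, 0 < l < h -> ipg (L, l) (fluxg DWf (L, l)) n_fout = 0;
  op_sym : forall u, 0 < u < L -> ipg (u, 0) (fluxg DWf (u, 0)) n_sym = 0
}.

(* Flux entering the fracture from the reservoir. *)
Definition influx (DWp : R * R -> R * R) (u : R) : R :=
  dotp (fluxp DWp (gam u)) (nf u).

Record reduced_problem (h : R) (Wp : R * R -> R) (DWp : R * R -> R * R)
    (Wf : R * R -> R) (DWf : R * R -> R * R) (q : R -> R) : Prop := {
  rp_Wp : classical_upto (Omp G) Wp DWp;
  rp_Wf : classical_upto (Omf h) Wf DWf;
  rp_indep : forall u l l', 0 <= u <= L -> 0 <= l <= h -> 0 <= l' <= h ->
    Wf (u, l) = Wf (u, l');
  rp_eqp : forall z, Omp G z -> - div (fluxp DWp) z = Q / vol h;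
  rp_eqf : forall z, Omf h z ->
    - divg (fluxg DWf) z = Q / vol h + q z.1 / h;
  rp_match : forall u, 0 <= u <= L -> Wp (gam u) = Wf (u, h);
  rp_flux : forall u, 0 < u < L -> influx DWp u = q u;
  rp_wellp : forall i t, is_well G i -> 0 <= t <= arc_len G (Some i) ->
    Wp (arc G (Some i) t) = 0;
  rp_wellf : forall l, 0 <= l <= h -> Wf (0, l) = 0;
  rp_out : forall i t, ~~ is_well G i -> 0 < t < arc_len G (Some i) ->
    dotp (fluxp DWp (arc G (Some i) t)) (nu G (Some i) t) = 0;
  rp_fout : forall l, 0 < l < h -> ipg (L, l) (fluxg DWf (L, l)) n_fout = 0
}.

Definition sqnorm_grad (v : R * R -> R) : \bar R :=
  (\int[leb2 R]_(z in Omp G) (dotp (grad v z) (grad v z))%:E)%E.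

End Model.

(* Main.v *)
Require Import Defs.
From mathcomp Require Import all_boot all_order all_algebra.
From mathcomp Require Import all_classical all_reals all_analysis.
From HB Require Import structures.
From mathcomp Require Import measurable_realfun ring lra.

Set Implicit Arguments.
Unset Strict Implicit.
Unset Printing Implicit Defensive.

Import Order.TTheory GRing.Theory Num.Theory.
Import numFieldNormedType.Exports.
Local Open Scope classical_set_scope.
Local Open Scope ring_scope.

(* Let w = W - Wbar in the fracture, v = W - Wbar in the porous medium, and let
   E >= 0 be the integral over the fracture of the product of the difference of
   the two nonlinear fluxes with grad w.  Testing both problems with the
   difference of the solutions gives
     kp |grad v|^2 + E = int_{Gamma_f} q w - int_{Omega_f} (q / h) w
                       = int_{Omega_f} (q / h) lambda w_lambda,
   and by strong monotonicity of the flux (whose inverse is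
   V |-> (alpha + beta |V|) V) Young's inequality bounds the right-hand side by
   E + C h^3 when h <= 1.
   When h >= 1 the trace of w is instead tested against the data of one fixed
   reduced solution (h1, Wbar1, q1), chosen classically: with
   r = |Omega(h1)| / |Omega(h)|, the function Wbar - r Wbar1 is harmonic in
   Omega_p and has energy O(h), which gives the bound C h.  Both h^3 for h <= 1
   and h for h >= 1 are at most h^(8/3).
   The divergence theorem on Omega_p is obtained by straightening the boundary
   near each of its smooth points, cutting a field into pieces with bump
   functions, and shrinking cut-offs at the corners. *)

(** * Integration in the plane *)

(** Nothing bounds the gradient of [Wf] uniformly in h, so the estimate is one-sided: only the
    reduced flux is bounded, by integrating an ODE in u from the closed end u = L. The gradient
    difference is expressed through the difference d of the two fluxes, and the monotone product
    controls d^2 and, with weight beta, d^3. Young's inequality against a factor t then costs t^2 +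
    t^3 per unit area, on a coordinate rectangle of area L h. With t = h this is h^3 + h^4, which is
    good enough only for h <= 1. For h >= 1 the factor t = 1 is wanted, at cost O(h), so the flux q
    = O(h) on Gamma_f has to be traded for one that does not depend on h: this is the purpose of the
    reference solution, whose flux q1 is fixed and whose bounded trace on Gamma_f keeps the energy
    of the harmonic difference at O(h). If no h admits a reduced solution with the assumed bound,
    the statement is vacuous. The normal is given only at interior points of the arcs and is not
    assumed continuous, so each boundary chart must also find out on which side of its arc the
    domain lies. *)

Section PlaneMeasure.
Variable R : realType.
Local Notation mu := (@lebesgue_measure R).
Implicit Types (A K : set (R * R)) (f : R * R -> R).

(** The sigma-algebra of the product is generated by measurable rectangles, so openness has to be
    turned into a countable union: the squares with rational centre and radius 1/(k+1) that lie in
    A, the others being replaced by the empty set. *)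
Lemma open_measurable2 A : open A -> measurable A.
Proof.
move=> oA.
pose F (i : rat * rat * nat) : set (R * R) :=
  let B := ball (ratr i.1.1 : R) (i.2.+1%:R^-1) `*` ball (ratr i.1.2 : R) (i.2.+1%:R^-1) in
  if `[< B `<=` A >] then B else set0.
have -> : A = \bigcup_i F i.
  apply/seteqP; split; last first.
    move=> z [i _]; rewrite /F; case: asboolP => [+ ? | _ []//]; exact.
  move=> z Az; have /nbhs_ballP[e /= e0 zeA] : nbhs z A by exact: open_nbhs_nbhs.
  have [k ke] : exists k : nat, k.+1%:R^-1 < e / 2.
    have := @near_infty_natSinv_lt R (PosNum (divr_gt0 e0 (ltr0n R 2))).
    by case=> N _ /(_ N (leqnn N)) /=; exists N.
  have k0 : 0 < k.+1%:R^-1 :> R by [].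
  have [p pz] : exists p : rat, ball (ratr p : R) (k.+1%:R^-1) z.1.
    have /rat_in_itvoo[p] : z.1 - k.+1%:R^-1 < z.1 + k.+1%:R^-1.
      by rewrite ltrBlDr -addrA ltrDl addr_gt0.
    by rewrite in_itv/= => pz; exists p; rewrite /ball/= ltr_distl.
  have [q qz] : exists q : rat, ball (ratr q : R) (k.+1%:R^-1) z.2.
    have /rat_in_itvoo[q] : z.2 - k.+1%:R^-1 < z.2 + k.+1%:R^-1.
      by rewrite ltrBlDr -addrA ltrDl addr_gt0.
    by rewrite in_itv/= => qz; exists q; rewrite /ball/= ltr_distl.
  exists (p, q, k) => //; rewrite /F/=; have H : ball (ratr p : R) k.+1%:R^-1 `*` ball (ratr q : R) k.+1%:R^-1 `<=` A; last by rewrite asboolT.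
  move: pz qz ke => + + + w [/= + +]; rewrite /ball/=; move: (_^-1) => d pz qz de w1 w2.
  apply: zeA; split => /=; move: w1 w2 pz qz;
    rewrite /ball/= !ltr_distl => /andP[? ?] /andP[? ?] /andP[? ?] /andP[? ?]; apply/andP; split; lra.
apply: countable_bigcupT_measurable => [|i]; first exact: countableP.
rewrite /F; case: asboolP => _ //.
by apply: measurableX; exact: measurable_realfun.measurable_ball.
Qed.

Lemma continuous_measurable2 A f : open A -> {in A, continuous f} ->
  measurable_fun A f.
Proof.
move=> oA cf; apply: (measurability _ (measurable_realfun.RGenOInfty.measurableE R)).
move=> _ [_ [y ->] <-]; apply: open_measurable2; rewrite openE.
move=> z [Az /= fz]; apply: (@filterI _ (nbhs z)); first exact: open_nbhs_nbhs.
have := cf z; rewrite inE => /(_ Az).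
by apply; apply: open_nbhs_nbhs; split => //; exact: interval_open.
Qed.

Lemma within_in_continuous A K f : open A -> A `<=` K ->
  {within K, continuous f} -> {in A, continuous f}.
Proof.
move=> oA AK cf; rewrite -continuous_open_subspace//.
exact: continuous_subspaceW cf.
Qed.

Lemma within_bounded K f : compact K -> {within K, continuous f} ->
  exists2 M : R, 0 <= M & forall z, K z -> `|f z| <= M.
Proof.
move=> cK cf; have [->|K0] := eqVneq K set0; first by exists 0.
have cnf : {within K, continuous (fun z => `|f z|)}.
  by move=> z; apply: continuous_comp; [exact: cf|exact: norm_continuous].
have [c _ Hc] := compact_EVT_max (proj1 (set0P _) K0) cK cnf.
by exists `|f c| => // z Kz; apply: Hc; rewrite inE.
Qed.

Lemma bounded_box A : bounded_set A ->
  exists2 M : R, 0 < M & A `<=` `]-M, M[ `*` `]-M, M[.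
Proof.
move=> [M [Mr HM]]; exists (Num.max M 0 + 2).
  by rewrite ltr_wpDl// le_max lexx orbT.
have M1 : M < Num.max M 0 + 1 by rewrite ltr_pwDr// le_max lexx.
move=> z /(HM _ M1) /=; rewrite prod_normE ge_max => /andP[z1 z2].
by split; rewrite /= in_itv/= -ltr_norml; apply: le_lt_trans; [exact: z1| |exact: z2|]; lra.
Qed.

Lemma bounded_measure2 A : measurable A -> bounded_set A -> (leb2 R A < +oo)%E.
Proof.
move=> mA /bounded_box[M M0 AM].
apply: (@le_lt_trans _ _ (leb2 R (`]-M, M[ `*` `]-M, M[))).
  by apply: le_measure => //; rewrite inE//; exact: measurableX.
rewrite product_measure1E//; have := @lebesgue_measure_itv R `]-M, M[.
rewrite /= lte_fin ifT; last by lra.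
by move=> ->; rewrite -EFinD -EFinM ltry.
Qed.

Lemma bounded_integrable2 A f M : measurable A -> bounded_set A ->
  measurable_fun A f -> (forall z, A z -> `|f z| <= M) ->
  (leb2 R).-integrable A (EFin \o f).
Proof.
move=> mA bA mf fM; apply: measurable_bounded_integrable => //.
  exact: bounded_measure2.
exists M; split; first exact: num_real.
by move=> N MN z Az /=; apply: le_trans (ltW MN); exact: fM.
Qed.

(** The real-valued inner integral equals the extended one only at those y whose slice is
    integrable; these are almost all y, which is enough for the outer integral. *)
Lemma Fubini_yx A f : measurable A -> (leb2 R).-integrable A (EFin \o f) ->
  \int[leb2 R]_(z in A) f z = \int[mu]_y \int[mu]_(x in [set x | A (x, y)]) f (x, y).
Proof.
move=> mA If.
have If' : (leb2 R).-integrable setT (EFin \o (f \_ A)).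
  by rewrite -restrict_EFin; apply/integrable_restrict => //; rewrite setTI.
rewrite Rintegral_mkcond {1}/Rintegral -integral21_prod_meas1//.
rewrite {1}/Rintegral; congr fine.
have mG := measurable_fubini_G If'.
have mG' : measurable_fun [set: measurableTypeR R]
    (fun y => \int[mu]_(x in [set x | A (x, y)]) f (x, y)).
  have -> : (fun y => \int[mu]_(x in [set x | A (x, y)]) f (x, y)) =
      fine \o fubini_G mu (EFin \o (f \_ A)).
    apply/funext => y /=; rewrite /fubini_G Rintegral_mkcond /Rintegral; congr fine.
  by apply: measurableT_comp; [exact: fine_measurable|exact: mG].
apply: ae_eq_integral => //; first exact/measurable_EFinP.
have := ae_integrable2 If'; apply: filterS => y /= Iy _.
rewrite [in RHS]Rintegral_mkcond /fubini_G /Rintegral fineK; last first.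
  have -> : (fun x => ((fun x0 => f (x0, y)) \_ [set x | A (x, y)] x)%:E) =
      (fun x => (EFin \o f \_ A) (x, y)).
    by apply/funext => x; rewrite /patch/=.
  exact: integrable_fin_num Iy.
by apply: eq_integral => x _; rewrite /patch/=.
Qed.

Lemma Fubini_xy A f : measurable A -> (leb2 R).-integrable A (EFin \o f) ->
  \int[leb2 R]_(z in A) f z = \int[mu]_x \int[mu]_(y in [set y | A (x, y)]) f (x, y).
Proof.
move=> mA If.
have If' : (leb2 R).-integrable setT (EFin \o (f \_ A)).
  by rewrite -restrict_EFin; apply/integrable_restrict => //; rewrite setTI.
rewrite Rintegral_mkcond {1}/Rintegral -integral12_prod_meas1//.
rewrite {1}/Rintegral; congr fine.
have mG := measurable_fubini_F If'.
have mG' : measurable_fun [set: measurableTypeR R]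
    (fun x => \int[mu]_(y in [set y | A (x, y)]) f (x, y)).
  have -> : (fun x => \int[mu]_(y in [set y | A (x, y)]) f (x, y)) =
      fine \o fubini_F mu (EFin \o (f \_ A)).
    apply/funext => y /=; rewrite /fubini_F Rintegral_mkcond /Rintegral; congr fine.
  by apply: measurableT_comp; [exact: fine_measurable|exact: mG].
apply: ae_eq_integral => //; first exact/measurable_EFinP.
have := ae_integrable1 If'; apply: filterS => y /= Iy _.
rewrite [in RHS]Rintegral_mkcond /fubini_F /Rintegral fineK; last first.
  have -> : (fun x => ((fun x0 => f (y, x0)) \_ [set x | A (y, x)] x)%:E) =
      (fun x => (EFin \o f \_ A) (y, x)).
    by apply/funext => x; rewrite /patch/=.
  exact: integrable_fin_num Iy.
by apply: eq_integral => x _; rewrite /patch/=.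
Qed.

Lemma continuous_integrable2 A K f : open A -> A `<=` K -> compact K ->
  {within K, continuous f} -> (leb2 R).-integrable A (EFin \o f).
Proof.
move=> oA AK cK cf; have [M _ fM] := within_bounded cK cf.
apply: (@bounded_integrable2 _ _ M).
- exact: open_measurable2.
- have [N [Nr HN]] := compact_bounded cK.
  by exists N; split => // x /HN + z /AK Kz; exact.
- apply: continuous_measurable2 => //; exact: within_in_continuous cf.
- by move=> z /AK; exact: fM.
Qed.

End PlaneMeasure.

Lemma within_continuous_comp (T U V : topologicalType) (I : set T) (K : set U)
    (phi : T -> U) (f : U -> V) : {within I, continuous phi} ->
  {within K, continuous f} -> (forall t, I t -> K (phi t)) ->
  {within I, continuous (f \o phi)}.
Proof.
move=> /subspace_continuousP cphi /subspace_continuousP cf IK.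
apply/subspace_continuousP => t It; apply: cvg_trans (cf _ (IK _ It)).
rewrite (_ : (f \o phi) @ _ = f @ (phi @ within I (nbhs t)))//.
apply: cvg_app => B KB; have := cphi _ It _ KB.
by apply: (@filterS _ (nbhs t)) => s /= H Is; exact: H Is (IK _ Is).
Qed.

(** * Fubini and the divergence theorem on rectangles *)

Section Rectangle.
Variable R : realType.
Local Notation mu := (@lebesgue_measure R).

Lemma FTC_oo (a b : R) (F f : R -> R) : a < b ->
  {within `[a, b], continuous F} -> {within `[a, b], continuous f} ->
  (forall x, a < x < b -> is_derive x 1 F (f x)) ->
  \int[mu]_(x in `]a, b[) f x = F b - F a.
Proof.
move=> ab cF cf dF.
have If : mu.-integrable `[a, b] (EFin \o f).
  by apply: continuous_compact_integrable => //; exact: segment_compact.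
rewrite Rintegral_itv_obnd_cbnd; last first.
  by apply: integrableS If => //; exact: subset_itv_oo_cc.
rewrite Rintegral_itv_bndo_bndc; last first.
  by apply: integrableS If => //; exact: subset_itv_co_cc.
rewrite /Rintegral (@continuous_FTC2 _ f F a b)//.
  have [_ Fa Fb] := (continuous_within_itvP _ ab).1 cF.
  split => // x; rewrite in_itv/= => /dF H; exact: ex_derive.
by move=> x; rewrite in_itv/= => /dF H; rewrite derive1E derive_val.
Qed.

Definition orect (a b c d : R) : set (R * R) := `]a, b[ `*` `]c, d[.
Definition crect (a b c d : R) : set (R * R) := `[a, b] `*` `[c, d].

Lemma orect_open a b c d : open (orect a b c d).
Proof. rewrite openE => -[x y] [/= xab ycd].
exists (`]a, b[%classic, `]c, d[%classic) => //.
by split; apply: open_nbhs_nbhs; split => //; exact: interval_open. Qed.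

Lemma orect_crect a b c d : orect a b c d `<=` crect a b c d.
Proof. by move=> z [? ?]; split; apply: subset_itv_oo_cc. Qed.

Lemma crect_compact a b c d : compact (crect a b c d).
Proof. by apply: compact_setX; exact: segment_compact. Qed.

Lemma rect_integrable a b c d (f : R * R -> R) :
  {within crect a b c d, continuous f} ->
  (leb2 R).-integrable (orect a b c d) (EFin \o f).
Proof.
move=> cf; apply: continuous_integrable2 cf; [exact: orect_open| exact: orect_crect|exact: crect_compact].
Qed.

Lemma orect_measurable a b c d : measurable (orect a b c d).
Proof. by apply: open_measurable2; exact: orect_open. Qed.

Lemma slice1_continuous (a b c d y : R) (f : R * R -> R) : c <= y <= d ->
  {within crect a b c d, continuous f} ->
  {within `[a, b], continuous (fun x => f (x, y))}.
Proof.
move=> cyd cf; apply: (within_continuous_comp _ cf).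
  apply: continuous_subspaceT => x.
  by apply: (@cvg_pair _ _ _ (nbhs x) (nbhs x) (nbhs y)); [exact: cvg_id|exact: cvg_cst].
by move=> x /= xab; split.
Qed.

Lemma slice2_continuous (a b c d x : R) (f : R * R -> R) : a <= x <= b ->
  {within crect a b c d, continuous f} ->
  {within `[c, d], continuous (fun y => f (x, y))}.
Proof.
move=> cyd cf; apply: (within_continuous_comp _ cf).
  apply: continuous_subspaceT => y.
  by apply: (@cvg_pair _ _ _ (nbhs y) (nbhs x) (nbhs y)); [exact: cvg_cst|exact: cvg_id].
by move=> y /= xab; split.
Qed.

Lemma Fubini_rect_yx a b c d (f : R * R -> R) :
  {within crect a b c d, continuous f} ->
  \int[leb2 R]_(z in orect a b c d) f z =
  \int[mu]_(y in `]c, d[) \int[mu]_(x in `]a, b[) f (x, y).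
Proof.
move=> cf; rewrite Fubini_yx; [|exact: orect_measurable|exact: rect_integrable].
rewrite [in RHS]Rintegral_mkcond; apply: eq_Rintegral => y _.
rewrite /patch; case: ifPn => ycd.
  congr Rintegral; apply/seteqP; split => x /=; first by case.
  by move=> xab; split => //; rewrite inE in ycd.
rewrite (_ : [set x | _] = set0) ?Rintegral_set0//.
apply/seteqP; split => // x [_ /= ?]; move/negP: ycd; apply; by rewrite inE.
Qed.

Lemma Fubini_rect_xy a b c d (f : R * R -> R) :
  {within crect a b c d, continuous f} ->
  \int[leb2 R]_(z in orect a b c d) f z =
  \int[mu]_(x in `]a, b[) \int[mu]_(y in `]c, d[) f (x, y).
Proof.
move=> cf; rewrite Fubini_xy; [|exact: orect_measurable|exact: rect_integrable].
rewrite [in RHS]Rintegral_mkcond; apply: eq_Rintegral => y _.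
rewrite /patch; case: ifPn => ycd.
  congr Rintegral; apply/seteqP; split => x /=; first by case.
  by move=> xab; split => //; rewrite inE in ycd.
rewrite (_ : [set x | _] = set0) ?Rintegral_set0//.
apply/seteqP; split => // x [/= ? _]; move/negP: ycd; apply; by rewrite inE.
Qed.

(** Each partial derivative is integrated first in its own variable. The two components and their
    derivatives are separate functions, so that sheared fields and weighted fluxes can be fed in
    directly. *)
Lemma rect_divergence a b c d (m ms n ny : R * R -> R) : a < b -> c < d ->
  {within crect a b c d, continuous m} -> {within crect a b c d, continuous ms} ->
  {within crect a b c d, continuous n} -> {within crect a b c d, continuous ny} ->
  (forall x y, a < x < b -> c < y < d ->
    is_derive x 1 (fun s => m (s, y)) (ms (x, y))) ->
  (forall x y, a < x < b -> c < y < d ->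
    is_derive y 1 (fun s => n (x, s)) (ny (x, y))) ->
  \int[leb2 R]_(z in orect a b c d) (ms z + ny z) =
  \int[mu]_(y in `]c, d[) (m (b, y) - m (a, y)) +
  \int[mu]_(x in `]a, b[) (n (x, d) - n (x, c)).
Proof.
move=> ab cd cm cms cn cny dm dn.
rewrite RintegralD; [|exact: orect_measurable|exact: rect_integrable|exact: rect_integrable].
rewrite Fubini_rect_yx// Fubini_rect_xy//; congr (_ + _).
  apply: eq_Rintegral => y; rewrite inE/= in_itv/= => ycd.
  have ycd' : c <= y <= d by case/andP: ycd => /ltW -> /ltW ->.
  apply: (@FTC_oo _ _ (fun x => m (x, y))) => //.
  - exact: (@slice1_continuous a b c d).
  - exact: (@slice1_continuous a b c d).
  - by move=> x xab; exact: dm.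
apply: eq_Rintegral => x; rewrite inE/= in_itv/= => xab.
have xab' : a <= x <= b by case/andP: xab => /ltW -> /ltW ->.
apply: (@FTC_oo _ _ (fun y => n (x, y))) => //.
- exact: (@slice2_continuous a b c d).
- exact: (@slice2_continuous a b c d).
- by move=> y ycd; exact: dn.
Qed.

End Rectangle.

(** * Functions of class C^1 up to the boundary *)

Section Smooth.
Variable R : realType.
Implicit Types (A K : set (R * R)) (u v P Q : R * R -> R) (D E X : R * R -> R * R).

(** The gradient is a parameter because [grad] says nothing useful at boundary points, where only
    its continuous extension D is meant. *)
Definition C1_upto A u D : Prop :=
  gradient_upto A u D /\ {within closure A, continuous u}.

Lemma diff_grad u (z w : R * R) : differentiable u z ->
  'd u z w = dotp (grad u z) w.
Proof.
move=> du; have -> : w = w.1 *: e1 R + w.2 *: e2 R.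
  case: w => a b; rewrite /e1 /e2; congr pair; rewrite /= /GRing.scale/=; ring.
rewrite linearD !linearZ/= -!deriveE// /dotp /grad /= /GRing.scale/=; ring.
Qed.

Lemma diff_comp_pair (V : normedModType R) (Psi : R * R -> R) (f g : V -> R) (x w : V) :
  differentiable f x -> differentiable g x -> differentiable Psi (f x, g x) ->
  'd (Psi \o (fun y => (f y, g y))) x w = dotp (grad Psi (f x, g x)) ('d f x w, 'd g x w).
Proof.
move=> df dg dPsi.
have dp : differentiable (fun y => (f y, g y)) x by exact: differentiable_pair.
rewrite (diff_comp dp dPsi) -diff_grad//.
transitivity ('d Psi (f x, g x) ('d (fun y => (f y, g y)) x w)); first by [].
by rewrite (diff_pair df dg).
Qed.

Lemma chain_rule u (g1 g2 : R -> R) (t a b : R) :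
  differentiable u (g1 t, g2 t) -> is_derive t 1 g1 a -> is_derive t 1 g2 b ->
  is_derive t 1 (fun s => u (g1 s, g2 s)) (dotp (grad u (g1 t, g2 t)) (a, b)).
Proof.
move=> du [d1 e1] [d2 e2].
have dg1 := (derivable1_diffP _ _).1 d1; have dg2 := (derivable1_diffP _ _).1 d2.
have dp : differentiable (fun s => (g1 s, g2 s)) t by exact: differentiable_pair.
have dc : differentiable (u \o (fun s => (g1 s, g2 s))) t.
  exact: differentiable_comp.
split; first exact/derivable1_diffP.
have -> : 'D_1 (fun s => u (g1 s, g2 s)) t =
    'd (u \o (fun s => (g1 s, g2 s))) t 1 by rewrite deriveE.
by rewrite (diff_comp_pair _ dg1 dg2 du) -!deriveE// e1 e2.
Qed.

Lemma continuous_fst_within K D : {within K, continuous D} ->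
  {within K, continuous (fun z => (D z).1)}.
Proof. by move=> cD z; apply: (cvg_comp _ _ (cD z)); exact: cvg_fst. Qed.

Lemma continuous_snd_within K D : {within K, continuous D} ->
  {within K, continuous (fun z => (D z).2)}.
Proof. by move=> cD z; apply: (cvg_comp _ _ (cD z)); exact: cvg_snd. Qed.

Lemma continuous_pair_within (T : topologicalType) (K : set T) (u v : T -> R) : {within K, continuous u} ->
  {within K, continuous v} -> {within K, continuous (fun z => (u z, v z))}.
Proof.
move=> cu cv z.
by apply: (@cvg_pair _ _ _ (nbhs (z : subspace K)) (nbhs (u z)) (nbhs (v z))); [exact: cu|exact: cv].
Qed.

Lemma continuousM_within (T : topologicalType) (K : set T) (u v : T -> R) : {within K, continuous u} ->
  {within K, continuous v} -> {within K, continuous (fun z => u z * v z)}.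
Proof. by move=> cu cv z; apply: cvgM; [exact: cu|exact: cv]. Qed.

Lemma continuousD_within (T : topologicalType) (K : set T) (u v : T -> R) : {within K, continuous u} ->
  {within K, continuous v} -> {within K, continuous (fun z => u z + v z)}.
Proof. by move=> cu cv z; apply: cvgD; [exact: cu|exact: cv]. Qed.

Lemma continuousB_within (T : topologicalType) (K : set T) (u v : T -> R) : {within K, continuous u} ->
  {within K, continuous v} -> {within K, continuous (fun z => u z - v z)}.
Proof. by move=> cu cv z; apply: cvgB; [exact: cu|exact: cv]. Qed.

Lemma continuous_cst_within (T : topologicalType) (K : set T) (a : R) : {within K, continuous (fun=> a)}.
Proof. by move=> z; exact: cvg_cst. Qed.

Lemma C1_upto_comp A u v Du Dv (Psi : R * R -> R) (DPsi : R * R -> R * R) :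
  C1_upto A u Du -> C1_upto A v Dv ->
  (forall z, differentiable Psi z /\ grad Psi z = DPsi z) -> continuous DPsi ->
  C1_upto A (fun z => Psi (u z, v z))
    (fun z => ((DPsi (u z, v z)).1 * (Du z).1 + (DPsi (u z, v z)).2 * (Dv z).1,
               (DPsi (u z, v z)).1 * (Du z).2 + (DPsi (u z, v z)).2 * (Dv z).2)).
Proof.
move=> [[du cDu] cu] [[dv cDv] cv] dPsi cDPsi.
have cP : continuous Psi by move=> z; exact: differentiable_continuous (dPsi z).1.
have cc (f : R * R -> R) : continuous f -> {within closure A, continuous (fun z => f (u z, v z))}.
  move=> cf; apply: (within_continuous_comp (K := setT) (continuous_pair_within cu cv)) => //.
  exact: continuous_subspaceT.
split; last exact: cc.
split; last first.
  have c1 : {within closure A, continuous (fun z => (DPsi (u z, v z)).1)}.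
    by apply: (cc (fun w => (DPsi w).1)) => w; apply: (cvg_comp _ _ (cDPsi w)); exact: cvg_fst.
  have c2 : {within closure A, continuous (fun z => (DPsi (u z, v z)).2)}.
    by apply: (cc (fun w => (DPsi w).2)) => w; apply: (cvg_comp _ _ (cDPsi w)); exact: cvg_snd.
  apply: continuous_pair_within; apply: continuousD_within; apply: continuousM_within => //;
    by [exact: continuous_fst_within|exact: continuous_snd_within].
move=> z Az; have [duz gu] := du z Az; have [dvz gv] := dv z Az.
have [dP gP] := dPsi (u z, v z).
have dp : differentiable (fun z => (u z, v z)) z by exact: differentiable_pair.
have dc : differentiable (Psi \o (fun z => (u z, v z))) z by exact: differentiable_comp.
have E w : 'D_w (fun z => Psi (u z, v z)) z = dotp (DPsi (u z, v z)) ('d u z w, 'd v z w).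
  rewrite -gP; transitivity ('d (Psi \o (fun z => (u z, v z))) z w); first by rewrite deriveE.
  exact: diff_comp_pair w duz dvz dP.
have u1 : 'd u z (e1 R) = (Du z).1 by rewrite -deriveE// -gu.
have u2 : 'd u z (e2 R) = (Du z).2 by rewrite -deriveE// -gu.
have v1 : 'd v z (e1 R) = (Dv z).1 by rewrite -deriveE// -gv.
have v2 : 'd v z (e2 R) = (Dv z).2 by rewrite -deriveE// -gv.
split; first exact: dc.
by congr pair; [rewrite (E (e1 R)) u1 v1|rewrite (E (e2 R)) u2 v2].
Qed.

Lemma C1_upto_mul A u v Du Dv : C1_upto A u Du -> C1_upto A v Dv ->
  C1_upto A (fun z => u z * v z)
    (fun z => (u z * (Dv z).1 + v z * (Du z).1, u z * (Dv z).2 + v z * (Du z).2)).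
Proof.
move=> [[du cDu] cu] [[dv cDv] cv]; split; last exact: continuousM_within.
split; last first.
  apply: continuous_pair_within; apply: continuousD_within; apply: continuousM_within => //;
    by [exact: continuous_fst_within|exact: continuous_snd_within].
move=> z Az; have [duz gu] := du z Az; have [dvz gv] := dv z Az.
split; first exact: differentiableM.
rewrite /grad !deriveM; try exact: diff_derivable.
by move: gu gv; rewrite /grad => <- <-.
Qed.

Lemma C1_upto_add A u v Du Dv : C1_upto A u Du -> C1_upto A v Dv ->
  C1_upto A (fun z => u z + v z) (fun z => Du z + Dv z).
Proof.
move=> [[du cDu] cu] [[dv cDv] cv]; split; last exact: continuousD_within.
split; last by move=> z; apply: cvgD; [exact: cDu|exact: cDv].
move=> z Az; have [duz gu] := du z Az; have [dvz gv] := dv z Az.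
split; first exact: differentiableD.
rewrite /grad !deriveD; try exact: diff_derivable.
by rewrite -gu -gv.
Qed.

Lemma C1_upto_cst A (c : R) : C1_upto A (fun=> c) (fun=> 0).
Proof.
split; last exact: continuous_cst_within.
split; last by move=> z; exact: cvg_cst.
by move=> z _; split; [exact: differentiable_cst|rewrite /grad !derive_cst].
Qed.

Lemma C1_upto_scale A (c : R) u Du : C1_upto A u Du ->
  C1_upto A (fun z => c * u z) (fun z => c *: Du z).
Proof.
move=> Cu; have := C1_upto_mul (C1_upto_cst A c) Cu.
congr C1_upto; apply/funext => z.
by rewrite /= !mulr0 !addr0.
Qed.

Lemma C1_upto_sub A u v Du Dv : C1_upto A u Du -> C1_upto A v Dv ->
  C1_upto A (fun z => u z - v z) (fun z => Du z - Dv z).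
Proof.
move=> Cu Cv; have := C1_upto_add Cu (C1_upto_scale (-1) Cv).
by congr C1_upto; apply/funext => z; rewrite ?mulN1r ?scaleN1r.
Qed.

Lemma C1_upto_global A u D : (forall z, differentiable u z /\ grad u z = D z) ->
  continuous D -> C1_upto A u D.
Proof.
move=> du cD; split; last first.
  by apply: continuous_subspaceT => z; exact: differentiable_continuous (du z).1.
by split => [z _ //|]; exact: continuous_subspaceT.
Qed.

Lemma classical_C1 A u D : classical_upto A u D -> C1_upto A u D.
Proof. by case=> ? [? _] _ _; split. Qed.

Lemma classical_C1_1 A u D : classical_upto A u D ->
  exists E, C1_upto A (fun z => (D z).1) E.
Proof. by case=> ? _ /= [? [E [? _ _]]] _; exists E; split. Qed.

Lemma classical_C1_2 A u D : classical_upto A u D ->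
  exists E, C1_upto A (fun z => (D z).2) E.
Proof. by case=> ? _ _ /= [? [E [? _ _]]]; exists E; split. Qed.

End Smooth.

(** * Bump functions *)

Section Bump.
Variable R : realType.

Definition sqpos (s : R) : R := (Num.max 0 s) ^+ 2.

Lemma sqpos_derive (s : R) : is_derive s 1 sqpos (2 * Num.max 0 s).
Proof.
have [s0|s0|->] := ltgtP s 0.
- rewrite mulr0.
  apply: (@near_eq_is_derive _ _ _ (cst 0)) => //.
  by near=> t; rewrite /sqpos max_l ?expr0n//; apply: ltW; near: t; exact: lt_nbhsl.
-   apply: (@near_eq_is_derive _ _ _ (fun t : R => t ^+ 2 : R)) => //.
    by near=> t; rewrite /sqpos max_r//; apply: ltW; near: t; exact: lt_nbhsr.
  by apply: is_derive_eq; rewrite /GRing.scale/=; ring.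
- rewrite mulr0; apply/is_derive1_caratheodory.
  exists (fun z => Num.max 0 z); split; last by rewrite maxxx.
    by move=> z; rewrite /sqpos maxxx expr0n/= !subr0 expr2; case: (leP 0 z) => // z0; rewrite !mul0r.
  by apply: continuous_max; [exact: cst_continuous|exact: cvg_id].
Unshelve. all: by end_near.
Qed.

Lemma sqpos_ge0 s : 0 <= sqpos s. Proof. exact: sqr_ge0. Qed.

Lemma continuous_max0 : continuous (fun s : R => Num.max 0 s).
Proof. by move=> s; apply: continuous_max; [exact: cst_continuous|exact: cvg_id]. Qed.

(** [sqpos] is a C^1 substitute for the positive part. The inner one vanishes for |x| <= 1/2 and is
    at least 1 for |x| >= 1, which produces the plateau and the compact support; C^1 regularity is
    all that cut-offs have to offer here. *)
Definition bump1 (x : R) : R := sqpos (1 - sqpos (4 * x ^+ 2 - 1)).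

Definition dbump1 (x : R) : R :=
  2 * Num.max 0 (1 - sqpos (4 * x ^+ 2 - 1)) *
  (- (2 * Num.max 0 (4 * x ^+ 2 - 1) * (8 * x))).

Lemma bump1_derive (x : R) : is_derive x 1 bump1 (dbump1 x).
Proof.
have d1 : is_derive x 1 (fun x : R => 4 * x ^+ 2 - 1) (8 * x).
  apply: is_derive_eq; rewrite /GRing.scale/=; ring.
have d2 : is_derive x 1 (fun x => 1 - sqpos (4 * x ^+ 2 - 1))
    (- (2 * Num.max 0 (4 * x ^+ 2 - 1) * (8 * x))).
  have := sqpos_derive (4 * x ^+ 2 - 1) => d.
  have := @is_derive1_comp _ sqpos (fun x : R => 4 * x ^+ 2 - 1) x _ _ d d1 => dd.
  apply: is_derive_eq; rewrite /GRing.scale/=; ring.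
have := sqpos_derive (1 - sqpos (4 * x ^+ 2 - 1)) => d.
have := @is_derive1_comp _ sqpos (fun x : R => 1 - sqpos (4 * x ^+ 2 - 1)) x _ _ d d2 => dd.
exact: dd.
Qed.

Lemma bump1_eq1 x : `|x| <= 2^-1 -> bump1 x = 1 /\ dbump1 x = 0.
Proof.
move=> x1; have x2 : 4 * x ^+ 2 - 1 <= 0.
  have := normr_ge0 x; rewrite -(real_normK (num_real x)); nra.
split; last by rewrite /dbump1 [Num.max 0 (4 * _ - 1)]max_l// mulr0 mul0r oppr0 mulr0.
by rewrite /bump1 [sqpos (_ - 1)]/sqpos max_l// expr0n subr0 /sqpos max_r// expr1n.
Qed.

Lemma bump1_eq0 x : 1 <= `|x| -> bump1 x = 0 /\ dbump1 x = 0.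
Proof.
move=> x1; have x2 : 1 <= 4 * x ^+ 2 - 1.
  rewrite -(real_normK (num_real x)); nra.
have h : Num.max 0 (1 - sqpos (4 * x ^+ 2 - 1)) = 0.
  rewrite max_l// /sqpos max_r; last by rewrite (le_trans _ x2).
  rewrite subr_le0; nra.
by rewrite /bump1 /dbump1 h mulr0 mul0r {1}/sqpos h expr0n.
Qed.

Lemma bump1_ge0 x : 0 <= bump1 x. Proof. exact: sqpos_ge0. Qed.

Lemma bump1_le1 x : bump1 x <= 1.
Proof.
rewrite /bump1 {1}/sqpos; have := sqpos_ge0 (4 * x ^+ 2 - 1).
case: (leP 0 (1 - sqpos (4 * x ^+ 2 - 1))) => h; [nra|by rewrite expr0n].
Qed.

(** The constant is 2 * 2 * 8: the remaining product of two positive parts is at most 1, since the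
    outer one vanishes as soon as the inner one exceeds 1, and only |x| < 1 matters. *)
Lemma dbump1_le x : `|dbump1 x| <= 32.
Proof.
have [/bump1_eq0[_ ->]|x1] := leP 1 `|x|; first by rewrite normr0.
rewrite /dbump1 !normrM normrN !normrM (ger0_norm (ler0n _ 2)) (ger0_norm (ler0n _ 8)).
set a := 4 * x ^+ 2 - 1.
have a0 : 0 <= Num.max 0 a by rewrite le_max lexx.
have b0 : 0 <= Num.max 0 (1 - sqpos a) by rewrite le_max lexx.
rewrite (ger0_norm a0) (ger0_norm b0).
have b1 : Num.max 0 (1 - sqpos a) <= 1.
  by rewrite ge_max ler01/= gerDl oppr_le0 sqpos_ge0.
have a1 : Num.max 0 (1 - sqpos a) * Num.max 0 a <= 1.
  have [a1|a1] := leP (Num.max 0 a) 1; first by rewrite mulr_ile1.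
  rewrite [X in X * _]max_l ?mul0r// subr_le0 /sqpos; nra.
have x0 := normr_ge0 x.
have : Num.max 0 (1 - sqpos a) * Num.max 0 a * `|x| <= 1.
  by rewrite mulr_ile1// ?mulr_ge0// ltW.
lra.
Qed.

Lemma continuous_compR (f g : R -> R) : continuous f -> continuous g ->
  continuous (fun x => g (f x)).
Proof. by move=> cf cg x; apply: (@cvg_comp _ _ _ f g); [exact: cf|exact: cg]. Qed.

Lemma dbump1_continuous : continuous dbump1.
Proof.
have c1 : continuous (fun x : R => 4 * x ^+ 2 - 1).
  move=> x; apply: cvgB; last exact: cvg_cst.
  by apply: cvgM; [exact: cvg_cst|exact: exprn_continuous].
have cs : continuous sqpos.
  by move=> s; apply: (@cvg_comp _ _ _ (fun s : R => Num.max 0 s) (fun t => t ^+ 2)); [exact: continuous_max0|exact: exprn_continuous].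
have cm (f : R -> R) : continuous f -> continuous (fun x => Num.max 0 (f x)).
  by move=> cf; apply: continuous_compR => //; exact: continuous_max0.
have cms (f g : R -> R) : continuous f -> continuous g -> continuous (fun x => f x * g x).
  by move=> cf cg x; apply: cvgM; [exact: cf|exact: cg].
have cc (a : R) : continuous (fun _ : R => a) by move=> x; exact: cvg_cst.
apply: (cms _ _).
  apply: (cms _ _) => //; apply: (cm _) => x; apply: cvgB; first exact: cvg_cst.
  exact: (continuous_compR c1 cs).
move=> x; apply: cvgN; move: x.
apply: (cms _ _); apply: (cms _ _) => //; [exact: cm|by move=> x; exact: cvg_id].
Qed.

Lemma tensor_C1 (A : set (R * R)) (f g f' g' : R -> R) :
  (forall x : R, is_derive x 1 f (f' x)) -> (forall x : R, is_derive x 1 g (g' x)) ->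
  continuous f' -> continuous g' ->
  C1_upto A (fun z => f z.1 * g z.2) (fun z => (f' z.1 * g z.2, f z.1 * g' z.2)).
Proof.
move=> df dg cf' cg'.
have cf : continuous f.
  move=> x; apply/differentiable_continuous/derivable1_diffP.
  by have H := df x; exact: ex_derive.
have cg : continuous g.
  move=> x; apply/differentiable_continuous/derivable1_diffP.
  by have H := dg x; exact: ex_derive.
have c1 (h : R -> R) : continuous h -> continuous (fun z : R * R => h z.1).
  by move=> ch z; apply: (@cvg_comp _ _ _ fst h); [exact: cvg_fst|exact: ch].
have c2 (h : R -> R) : continuous h -> continuous (fun z : R * R => h z.2).
  by move=> ch z; apply: (@cvg_comp _ _ _ snd h); [exact: cvg_snd|exact: ch].
apply: C1_upto_global; last first.
  move=> z; apply: (@cvg_pair _ _ _ (nbhs z) (nbhs (f' z.1 * g z.2)) (nbhs (f z.1 * g' z.2))).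
    by apply: cvgM; [exact: c1|exact: c2].
  by apply: cvgM; [exact: c1|exact: c2].
move=> z.
have D1 : differentiable f z.1 by apply/derivable1_diffP; have H := df z.1; exact: ex_derive.
have D2 : differentiable g z.2 by apply/derivable1_diffP; have H := dg z.2; exact: ex_derive.
have L1 : differentiable (fst : R * R -> R) z by apply: linear_differentiable => y; exact: cvg_fst.
have L2 : differentiable (snd : R * R -> R) z by apply: linear_differentiable => y; exact: cvg_snd.
have F1 : differentiable (f \o fst) z by exact: (differentiable_comp L1 D1).
have F2 : differentiable (g \o snd) z by exact: (differentiable_comp L2 D2).
have E1 w : 'D_w (f \o fst) z = f' z.1 * w.1.
  rewrite (deriveE _ F1) (diff_comp L1 D1).
  transitivity ('d f (z.1) ('d (fst : R * R -> R) z w)); first by [].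
  rewrite diff_lin; last by move=> y; exact: cvg_fst.
  have [_ <-] := df z.1; rewrite deriveE// mulrC.
  rewrite -[RHS]/(w.1 *: 'd f (z.1) 1) -linearZ; congr ('d f (z.1) _).
  by rewrite -[RHS]/(w.1 * 1) mulr1.
have E2 w : 'D_w (g \o snd) z = g' z.2 * w.2.
  rewrite (deriveE _ F2) (diff_comp L2 D2).
  transitivity ('d g (z.2) ('d (snd : R * R -> R) z w)); first by [].
  rewrite diff_lin; last by move=> y; exact: cvg_snd.
  have [_ <-] := dg z.2; rewrite deriveE// mulrC.
  rewrite -[RHS]/(w.2 *: 'd g (z.2) 1) -linearZ; congr ('d g (z.2) _).
  by rewrite -[RHS]/(w.2 * 1) mulr1.
split; first exact: (differentiableM F1 F2).
rewrite /grad.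
have M w : 'D_w (fun z : R * R => f z.1 * g z.2) z = f z.1 * (g' z.2 * w.2) + g z.2 * (f' z.1 * w.1).
  rewrite -E1 -E2 -[LHS]/('D_w ((f \o fst) * (g \o snd)) z) deriveM//; exact: diff_derivable.
by rewrite !M /e1 /e2 /= !mulr1 !mulr0 addr0 add0r; congr pair; rewrite mulrC.
Qed.

(** A product of one-variable bumps fits the balls of R * R, which are squares for the max norm. *)
Definition bump (p : R * R) (r : R) (z : R * R) : R :=
  bump1 ((z.1 - p.1) / r) * bump1 ((z.2 - p.2) / r).

Definition dbump (p : R * R) (r : R) (z : R * R) : R * R :=
  (dbump1 ((z.1 - p.1) / r) / r * bump1 ((z.2 - p.2) / r),
   bump1 ((z.1 - p.1) / r) * (dbump1 ((z.2 - p.2) / r) / r)).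

Lemma bump_C1 A p r : C1_upto A (bump p r) (dbump p r).
Proof.
have ca (q : R) : continuous (fun x : R => (x - q) / r).
  by move=> x; apply: cvgM; [apply: cvgB; [exact: cvg_id|exact: cvg_cst]|exact: cvg_cst].
have da (q x : R) : is_derive x 1 (fun x : R => bump1 ((x - q) / r)) (dbump1 ((x - q) / r) / r).
  have d1 : is_derive x 1 (fun x : R => (x - q) / r) r^-1.
    by apply: is_derive_eq; rewrite /GRing.scale/= !mulr0 oppr0; ring.
  exact: (@is_derive1_comp _ bump1 (fun x : R => (x - q) / r) x _ _ (bump1_derive ((x - q) / r)) d1).
have cd (q : R) : continuous (fun x => dbump1 ((x - q) / r) / r).
  move=> x; apply: cvgM; last exact: cvg_cst.
  exact: (continuous_compR (ca q) dbump1_continuous).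
exact: (tensor_C1 A (da p.1) (da p.2)).
Qed.

Lemma bump_eq1 p r z : 0 < r -> ball p (r / 2) z -> bump p r z = 1 /\ dbump p r z = 0.
Proof.
move=> r0 [/=]; rewrite /ball/= distrC => z1; rewrite distrC => z2.
have h x : `|x| < r / 2 -> bump1 (x / r) = 1 /\ dbump1 (x / r) = 0.
  by move=> xr; apply: bump1_eq1; rewrite normrM normfV (gtr0_norm r0) ler_pdivrMr// mulrC ltW.
have [a1 a2] := h _ z1; have [b1 b2] := h _ z2.
by rewrite /bump /dbump a1 a2 b1 b2 !mul0r mulr0 mulr1.
Qed.

Lemma bump_eq0 p r z : 0 < r -> ~ ball p r z -> bump p r z = 0 /\ dbump p r z = 0.
Proof.
move=> r0 pz; have [z1|z1] := leP r `|z.1 - p.1|.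
  have /bump1_eq0[h1 h2] : 1 <= `|(z.1 - p.1) / r|.
    by rewrite normrM normfV (gtr0_norm r0) ler_pdivlMr// mul1r.
  by rewrite /bump /dbump h1 h2 !mul0r.
have [z2|z2] := leP r `|z.2 - p.2|.
  have /bump1_eq0[h1 h2] : 1 <= `|(z.2 - p.2) / r|.
    by rewrite normrM normfV (gtr0_norm r0) ler_pdivlMr// mul1r.
  by rewrite /bump /dbump h1 h2 !mul0r !mulr0.
by exfalso; apply: pz; split; rewrite /ball/= distrC.
Qed.

Lemma bump_ge0 p r z : 0 <= bump p r z.
Proof. by rewrite mulr_ge0// bump1_ge0. Qed.

Lemma bump_le1 p r z : bump p r z <= 1.
Proof. by rewrite mulr_ile1// ?bump1_ge0// bump1_le1. Qed.

Lemma dbump_le p r z : 0 < r -> `|(dbump p r z).1| <= 32 / r /\ `|(dbump p r z).2| <= 32 / r.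
Proof.
move=> r0; have H x y : `|dbump1 x / r * bump1 y| <= 32 / r.
  rewrite normrM normrM normfV (gtr0_norm r0) [`|bump1 y|]ger0_norm ?bump1_ge0//.
  rewrite -[leRHS]mulr1 ler_pM ?bump1_ge0 ?bump1_le1//; first by rewrite mulr_ge0// invr_ge0 ltW.
  by rewrite ler_pM2r ?invr_gt0// dbump1_le.
by split; [exact: H|rewrite /dbump [(_, _).2]/= mulrC; exact: H].
Qed.

End Bump.

(** * The divergence theorem near a smooth boundary point *)

Section Substitution.
Variable R : realType.
Local Notation mu := (@lebesgue_measure R).

Lemma Rintegral_oo_cc (a b : R) (f : R -> R) : {within `[a, b], continuous f} ->
  \int[mu]_(x in `]a, b[) f x = \int[mu]_(x in `[a, b]) f x.
Proof.
move=> cf.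
have If : mu.-integrable `[a, b] (EFin \o f).
  by apply: continuous_compact_integrable => //; exact: segment_compact.
rewrite Rintegral_itv_obnd_cbnd; last by apply: integrableS If => //; exact: subset_itv_oo_cc.
by rewrite Rintegral_itv_bndo_bndc//; apply: integrableS If => //; exact: subset_itv_co_cc.
Qed.

Lemma is_derive_continuous (F F' : R -> R) : (forall t : R, is_derive t 1 F (F' t)) ->
  continuous F.
Proof.
move=> dF x; apply/differentiable_continuous/derivable1_diffP.
by have H := dF x; exact: ex_derive.
Qed.

Lemma substitution_increasing (F F' G : R -> R) (a b : R) : a < b ->
  (forall t : R, is_derive t 1 F (F' t)) -> continuous F' ->
  (forall t, a <= t <= b -> 0 < F' t) -> {within `[F a, F b], continuous G} ->
  \int[mu]_(y in `]F a, F b[) G y = \int[mu]_(t in `]a, b[) (G (F t) * F' t).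
Proof.
move=> ab dF cF' F'0 cG.
have cF := is_derive_continuous dF.
have FE : derive1 F = F'.
  by apply/funext => t; rewrite derive1E; have H := dF t; rewrite derive_val.
have incF : {in `[a, b] &, {homo F : x y / (x < y)%R}}.
  move=> x y; rewrite !in_itv/= => /andP[ax xb] /andP[ay yb] xy.
  have [|z] := MVT xy (fun z _ => dF z); first exact: continuous_subspaceT.
  rewrite in_itv/= => /andP[xz zy] FE'.
  rewrite -subr_gt0 FE' mulr_gt0 ?subr_gt0// F'0//.
  by rewrite (le_trans ax (ltW xz)) (le_trans (ltW zy) yb).
have leF x y : a <= x -> x <= y -> y <= b -> F x <= F y.
  move=> ax; rewrite le_eqVlt => /predU1P[->//|xy yb]; apply: ltW; apply: incF => //.
    by rewrite in_itv/= ax (le_trans (ltW xy)).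
  by rewrite in_itv/= yb (le_trans ax (ltW xy)).
have Fab t : `[a, b]%classic t -> `[F a, F b]%classic (F t).
  by rewrite /= !in_itv/= => /andP[? ?]; rewrite !leF.
rewrite !Rintegral_oo_cc//; last first.
  apply: continuousM_within; last exact: continuous_subspaceT.
  by apply: (within_continuous_comp (K := `[F a, F b])) => //; exact: continuous_subspaceT.
rewrite /Rintegral (@integration_by_substitution_increasing _ F G a b) ?(ltW ab)//.
- by congr fine; apply: eq_integral => t _; rewrite FE.
- by rewrite FE => t _; exact: cF'.
- by rewrite FE; apply/cvg_ex; exists (F' a); exact/cvg_at_right_filter/cF'.
- by rewrite FE; apply/cvg_ex; exists (F' b); exact/cvg_at_left_filter/cF'.
- split; [|exact/cvg_at_right_filter/cF|exact/cvg_at_left_filter/cF].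
  by move=> t _; have H := dF t; exact: ex_derive.
Qed.

Lemma translation_integral (G : R -> R) (a b c : R) : a < b ->
  {within `[a + c, b + c], continuous G} ->
  \int[mu]_(y in `]a + c, b + c[) G y = \int[mu]_(t in `]a, b[) G (t + c).
Proof.
move=> ab cG.
have d1 (t : R) : is_derive t 1 (fun t : R => t + c) 1.
  by apply: is_derive_eq; rewrite addr0.
rewrite (@substitution_increasing (fun t => t + c) (fun=> 1))//.
  by apply: eq_Rintegral => t _; rewrite mulr1.
by move=> t; exact: cvg_cst.
Qed.

Lemma reflection_integral (G : R -> R) (a b : R) : a < b ->
  {within `[a, b], continuous G} ->
  \int[mu]_(y in `]a, b[) G y = \int[mu]_(t in `]- b, - a[) G (- t).
Proof.
move=> ab cG; rewrite !Rintegral_oo_cc//; last first.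
  apply: (within_continuous_comp (K := `[a, b])) => //.
    by apply: continuous_subspaceT => x; exact: oppr_continuous.
  by move=> t /=; rewrite !in_itv/= lerNr lerNl andbC.
rewrite /Rintegral; congr fine.
have := @integration_by_substitution_oppr R G (- b) (- a).
by rewrite !opprK lerN2 (ltW ab); apply.
Qed.

(** Serves to rewrite a parametrized arc as a graph over one coordinate F. The last clause supplies
    the change of variables on any window of values around F t0, with the weight |F'| so that the
    same form survives a reversal of orientation. *)
Lemma inverse_C1_increasing (F F' : R -> R) (t1 t0 t2 : R) :
  (forall t : R, is_derive t 1 F (F' t)) -> continuous F' ->
  t1 < t0 < t2 -> (forall t, t1 <= t <= t2 -> 0 < F' t) ->
  exists tau Y1 Y2, [/\ Y1 < F t0 < Y2,
   (forall y, Y1 < y < Y2 ->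
     [/\ t1 < tau y < t2, F (tau y) = y & is_derive y 1 tau (F' (tau y))^-1]),
   (forall t, t1 <= t <= t2 -> tau (F t) = t) &
   (forall y1 y2, Y1 < y1 < F t0 -> F t0 < y2 < Y2 ->
     exists a b, [/\ t1 < a < t0, t0 < b < t2,
       (forall t, a < t < b -> y1 < F t < y2) &
       forall G, {within `[y1, y2], continuous G} ->
       \int[mu]_(y in `]y1, y2[) G y = \int[mu]_(t in `]a, b[) (G (F t) * `|F' t|)])].
Proof.
move=> dF cF' /andP[t10 t02] F'0.
have cF := is_derive_continuous dF.
have t12 : t1 < t2 by exact: lt_trans t02.
have incF x y : t1 <= x -> x < y -> y <= t2 -> F x < F y.
  move=> ax xy yb; have [|z] := MVT xy (fun z _ => dF z); first exact: continuous_subspaceT.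
  rewrite in_itv/= => /andP[xz zy] FE'.
  rewrite -subr_gt0 FE' mulr_gt0 ?subr_gt0// F'0//.
  by rewrite (le_trans ax (ltW xz)) (le_trans (ltW zy) yb).
have injF x y : t1 <= x <= t2 -> t1 <= y <= t2 -> F x = F y -> x = y.
  move=> /andP[x1 x2] /andP[y1 y2] Fxy; have [xy|xy|//] := ltgtP x y.
    by have := incF _ _ x1 xy y2; rewrite Fxy ltxx.
  by have := incF _ _ y1 xy x2; rewrite Fxy ltxx.
pose tau y := xget t1 [set t | t1 <= t <= t2 /\ F t = y].
have tauF t : t1 <= t <= t2 -> tau (F t) = t.
  move=> tt; rewrite /tau; case: xgetP => [s _ [ss Fs]|/(_ t)]; first exact: injF.
  by move=> H; exfalso; apply: H.
have Ftau y : F t1 < y < F t2 -> t1 < tau y < t2 /\ F (tau y) = y.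
  move=> /andP[y1 y2].
  have [||t] := @IVT R F t1 t2 y (ltW t12); first exact: continuous_subspaceT.
    by rewrite ge_min le_max (ltW y1) (ltW y2) orbT.
  rewrite in_itv/= => /andP[tt1 tt2] Fty.
  rewrite -Fty tauF ?tt1//; split => //.
  rewrite !lt_neqAle tt1 tt2 !andbT; apply/andP; split; apply/eqP => E.
    by move: y1; rewrite -Fty E ltxx.
  by move: y2; rewrite -Fty E ltxx.
exists tau, (F t1), (F t2); split => //.
- by apply/andP; split; apply: incF => //; exact: ltW.
- move=> y /Ftau[ty Fty]; split => //.
  have /andP[ty1 ty2] := ty.
  have dt := dF (tau y).
  rewrite -{1}Fty; apply: is_derive_inverse => //.
  + near=> t; apply: tauF; apply/andP; split; apply: ltW; near: t; [exact: lt_nbhsr|exact: lt_nbhsl].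
  + by near=> t; exact: cF.
  + by rewrite gt_eqF// F'0// !ltW.
- move=> y1 y2 /andP[y11 y12] /andP[y21 y22].
  have [/andP[a1 a2] Fa] : t1 < tau y1 < t2 /\ F (tau y1) = y1.
    by apply: Ftau; rewrite y11/= (lt_trans y12)// incF// ltW.
  have [/andP[b1 b2] Fb] : t1 < tau y2 < t2 /\ F (tau y2) = y2.
    by apply: Ftau; rewrite y22/= andbT (lt_trans _ y21)// incF// ltW.
  have a0 : tau y1 < t0.
    rewrite ltNge; apply/negP => h; have : F t0 <= F (tau y1).
      by move: h; rewrite le_eqVlt => /predU1P[->//|h]; apply: ltW; apply: incF; rewrite ?ltW.
    by rewrite Fa leNgt y12.
  have b0 : t0 < tau y2.
    rewrite ltNge; apply/negP => h; have : F (tau y2) <= F t0.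
      by move: h; rewrite le_eqVlt => /predU1P[->//|h]; apply: ltW; apply: incF; rewrite ?ltW.
    by rewrite Fb leNgt y21.
  exists (tau y1), (tau y2); split; rewrite ?a1 ?a0 ?b0 ?b2//.
    move=> t /andP[at_ tb]; rewrite -Fa -Fb; apply/andP; split; apply: incF => //; apply: ltW => //.
      exact: lt_trans tb b2.
    exact: lt_trans a1 at_.
  move=> G cG; rewrite -{1}Fa -{1}Fb.
  rewrite (substitution_increasing (lt_trans a0 b0) dF cF'); first last.
  + by rewrite Fa Fb.
  + by move=> t /andP[h1 h2]; apply: F'0; rewrite (le_trans (ltW a1) h1) (le_trans h2 (ltW b2)).
  apply: eq_Rintegral => t; rewrite inE/= in_itv/= => /andP[h1 h2].
  by rewrite gtr0_norm// F'0// (le_trans (ltW a1) (ltW h1)) (le_trans (ltW h2) (ltW b2)).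
Unshelve. all: by end_near.
Qed.

(** A continuous derivative without zeros keeps its sign by the intermediate value theorem; the
    decreasing case is the increasing one for - F, followed by a reflection of the integral. *)
Lemma inverse_C1 (F F' : R -> R) (t1 t0 t2 : R) :
  (forall t : R, is_derive t 1 F (F' t)) -> continuous F' ->
  t1 < t0 < t2 -> (forall t, t1 <= t <= t2 -> F' t != 0) ->
  exists tau Y1 Y2, [/\ Y1 < F t0 < Y2,
   (forall y, Y1 < y < Y2 ->
     [/\ t1 < tau y < t2, F (tau y) = y & is_derive y 1 tau (F' (tau y))^-1]),
   (forall t, t1 <= t <= t2 -> tau (F t) = t /\ Num.sg (F' t) = Num.sg (F' t0)) &
   (forall y1 y2, Y1 < y1 < F t0 -> F t0 < y2 < Y2 ->
     exists a b, [/\ t1 < a < t0, t0 < b < t2,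
       (forall t, a < t < b -> y1 < F t < y2) &
       forall G, {within `[y1, y2], continuous G} ->
       \int[mu]_(y in `]y1, y2[) G y = \int[mu]_(t in `]a, b[) (G (F t) * `|F' t|)])].
Proof.
move=> dF cF' t102 F'0.
have /andP[t10 t02] := t102; have t12 := lt_trans t10 t02.
have sgn : (forall t, t1 <= t <= t2 -> 0 < F' t) \/ (forall t, t1 <= t <= t2 -> 0 < - F' t).
  have [p0|n0] := ltP 0 (F' t0); [left|right] => t tt; rewrite ?oppr_gt0 ltNge; apply/negP => h.
    have [z zz Fz] : exists2 z, t1 <= z <= t2 & F' z = 0.
      have /andP[h1 h2] := tt; have [tt0|tt0] := leP t t0.
        have [||z] := @IVT R F' t t0 0 tt0; first exact: continuous_subspaceT.
          by rewrite ge_min le_max h (ltW p0) orbT.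
        by rewrite in_itv/= => /andP[? ?]; exists z => //; apply/andP; split; lra.
      have [||z] := @IVT R F' t0 t 0 (ltW tt0); first exact: continuous_subspaceT.
        by rewrite ge_min le_max h (ltW p0) orbT.
      by rewrite in_itv/= => /andP[? ?]; exists z => //; apply/andP; split; lra.
    by move/eqP: (F'0 z zz).
  have [z zz Fz] : exists2 z, t1 <= z <= t2 & F' z = 0.
    have /andP[h1 h2] := tt; have [tt0|tt0] := leP t t0.
      have [||z] := @IVT R F' t t0 0 tt0; first exact: continuous_subspaceT.
        by rewrite ge_min le_max h n0 orbT.
      by rewrite in_itv/= => /andP[? ?]; exists z => //; apply/andP; split; lra.
    have [||z] := @IVT R F' t0 t 0 (ltW tt0); first exact: continuous_subspaceT.
      by rewrite ge_min le_max h n0 orbT.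
    by rewrite in_itv/= => /andP[? ?]; exists z => //; apply/andP; split; lra.
  by move/eqP: (F'0 z zz).
have t0t : t1 <= t0 <= t2 by rewrite !ltW.
case: sgn => [pF|nF].
  have [tau [Y1 [Y2 [Y12 H1 H2 H3]]]] := inverse_C1_increasing dF cF' t102 pF.
  exists tau, Y1, Y2; split => // t tt; split; first exact: H2.
  by rewrite !gtr0_sg// pF.
have dN (t : R) : is_derive t 1 (fun t => - F t) (- F' t).
  by have H := dF t; apply: is_deriveN.
have cN : continuous (fun t => - F' t) by move=> t; apply: cvgN; exact: cF'.
have [tau [Y1 [Y2 [Y12 H1 H2 H3]]]] := inverse_C1_increasing dN cN t102 nF.
exists (fun y => tau (- y)), (- Y2), (- Y1); split.
- by case/andP: Y12 => ? ?; apply/andP; split; lra.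
- move=> y yY; have /H1[h1 h2 h3] : Y1 < - y < Y2 by case/andP: yY => ? ?; apply/andP; split; lra.
  split => //; first by rewrite -[LHS]opprK h2 opprK.
  have d1 : is_derive y 1 (fun y : R => - y) (-1) by exact: is_deriveN.
  have := @is_derive1_comp _ tau (fun y : R => - y) y _ _ h3 d1.
  by rewrite mulrN1 invrN opprK.
- move=> t tt; split; first exact: H2.
  by apply: oppr_inj; rewrite -!sgrN !gtr0_sg// nF.
- move=> y1 y2 yy1 yy2.
  have [||a [b [ha hb Hab HG]]] := H3 (- y2) (- y1).
  + by case/andP: yy2 => ? ?; apply/andP; split; lra.
  + by case/andP: yy1 => ? ?; apply/andP; split; lra.
  exists a, b; split => //.
    by move=> t /Hab /andP[? ?]; apply/andP; split; lra.
  move=> G cG; rewrite reflection_integral//; last first.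
    by case/andP: yy1 => ? ?; case/andP: yy2 => ? ?; lra.
  rewrite HG; last first.
    apply: (within_continuous_comp (K := `[y1, y2])) => //.
      by apply: continuous_subspaceT => x; exact: oppr_continuous.
    by move=> t /=; rewrite !in_itv/= lerNr lerNl andbC.
  by apply: eq_Rintegral => t _; rewrite opprK normrN.
Qed.

End Substitution.

(** * The divergence theorem beside a graph *)

Section GraphDivergence.
Variable R : realType.
Local Notation mu := (@lebesgue_measure R).

Lemma Rintegral_eq0 d (T : measurableType d) (m : {measure set T -> \bar R})
    (D : set T) (f : T -> R) : (forall x, D x -> f x = 0) -> \int[m]_(x in D) f x = 0.
Proof. by move=> f0; rewrite /Rintegral integral0_eq// => x /f0 ->. Qed.

(* The shear (s, y) |-> (g y + s, y) straightens the boundary arc s = 0. *)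
Lemma graph_divergence (A K : set (R * R)) (P Q : R * R -> R) (DP DQ : R * R -> R * R)
    (g g' : R -> R) (a b y1 y2 : R) : open A -> bounded_set A -> K = closure A ->
  a < b -> y1 < y2 ->
  compact K -> C1_upto A P DP -> C1_upto A Q DQ ->
  (forall y : R, y1 <= y <= y2 -> is_derive y 1 g (g' y)) ->
  {within `[y1, y2], continuous g'} ->
  (forall s y, a <= s <= b -> y1 <= y <= y2 -> K (g y + s, y)) ->
  (forall s y, a < s < b -> y1 < y < y2 -> A (g y + s, y)) ->
  (forall z, A z -> ~ (y1 < z.2 < y2 /\ g z.2 + a < z.1 < g z.2 + b) ->
    (DP z).1 + (DQ z).2 = 0) ->
  (forall s, a < s < b -> Q (g y1 + s, y1) = 0 /\ Q (g y2 + s, y2) = 0) ->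
  \int[leb2 R]_(z in A) ((DP z).1 + (DQ z).2) =
  \int[mu]_(y in `]y1, y2[)
    ((P (g y + b, y) - g' y * Q (g y + b, y)) -
     (P (g y + a, y) - g' y * Q (g y + a, y))).
Proof.
move=> oA bA KE ab y12 cK [[dP cDP] cP] [[dQ cDQ] cQ] dg cg' HK HA Hd HQ.
rewrite -KE in cDP cP cDQ cQ.
pose f z := (DP z).1 + (DQ z).2.
have cf : {within K, continuous f}.
  by apply: continuousD_within; [exact: continuous_fst_within|exact: continuous_snd_within].
have cg : {within `[y1, y2], continuous g}.
  apply: derivable_within_continuous => y; rewrite in_itv/= => /dg H; exact: ex_derive.
pose Phi (z : R * R) : R * R := (g z.2 + z.1, z.2).
have cg2 (h : R -> R) : {within `[y1, y2], continuous h} ->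
    {within crect a b y1 y2, continuous (fun z : R * R => h z.2)}.
  move=> ch; apply: (within_continuous_comp (K := `[y1, y2])) => //.
    by apply: continuous_subspaceT => z; exact: cvg_snd.
  by move=> z [].
have c1 : {within crect a b y1 y2, continuous (fst : R * R -> R)}.
  by apply: continuous_subspaceT => z; exact: cvg_fst.
have c2 : {within crect a b y1 y2, continuous (snd : R * R -> R)}.
  by apply: continuous_subspaceT => z; exact: cvg_snd.
have cPhi : {within crect a b y1 y2, continuous Phi}.
  by apply: continuous_pair_within => //; apply: continuousD_within => //; exact: cg2.
have PhiK z : crect a b y1 y2 z -> K (Phi z).
  by case=> /=; rewrite !in_itv/=; exact: HK.
have cc (h : R * R -> R) : {within K, continuous h} ->
    {within crect a b y1 y2, continuous (h \o Phi)}.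
  by move=> ch; apply: (within_continuous_comp (K := K)).
have AK : A `<=` K by rewrite KE; exact: subset_closure.
rewrite -[LHS]/(\int[leb2 R]_(z in A) f z).
rewrite Fubini_yx; [|exact: open_measurable2|exact: continuous_integrable2 cf].
(* Outside the sheared strip the divergence vanishes; inside it, each horizontal slice is a
   translate of ]a, b[. *)
transitivity (\int[mu]_(y in `]y1, y2[) \int[mu]_(s in `]a, b[) (f \o Phi) (s, y)).
  rewrite [RHS]Rintegral_mkcond; apply: eq_Rintegral => y _.
  rewrite patchE; case: ifPn => yy; last first.
    apply: Rintegral_eq0 => x Axy; apply: Hd => // -[/= H _].
    by move/negP: yy; apply; rewrite inE/= in_itv.
  move: yy; rewrite inE/= in_itv/= => yy.
  have yy' : y1 <= y <= y2 by case/andP: yy => /ltW -> /ltW ->.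
  transitivity (\int[mu]_(x in `]a + g y, b + g y[) f (x, y)).
    rewrite [LHS]Rintegral_mkcond [RHS]Rintegral_mkcond; apply: eq_Rintegral => x _.
    rewrite !patchE; case: ifPn => Ax; case: ifPn => xab //.
      apply: Hd; first by rewrite inE in Ax.
      case=> /= _ H; move/negP: xab; apply; rewrite inE/= in_itv/=.
      by rewrite ![_ + g y]addrC.
    exfalso; move/negP: Ax; apply; rewrite inE/=.
    move: xab; rewrite inE/= in_itv/= => /andP[h1 h2].
    rewrite (_ : x = g y + (x - g y)); last by ring.
    by apply: HA => //; apply/andP; split; lra.
  rewrite (@translation_integral _ (fun x => f (x, y)))//.
    by apply: eq_Rintegral => s _; rewrite /= /Phi/= addrC.
  apply: (within_continuous_comp (K := K)) cf _.
    apply: continuous_subspaceT => x.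
    by apply: (@cvg_pair _ _ _ (nbhs x) (nbhs x) (nbhs y)); [exact: cvg_id|exact: cvg_cst].
  move=> x /=; rewrite in_itv/= => /andP[h1 h2].
  rewrite (_ : x = g y + (x - g y)); last by ring.
  by apply: HK => //; apply/andP; split; lra.
(* In the coordinates (s, y) the divergence is the s-derivative of P - g' Q plus the y-derivative of
   Q: the latter contributes an extra g' times the x-derivative of Q, which the former removes. *)
transitivity (\int[leb2 R]_(z in orect a b y1 y2)
    ((DP (Phi z)).1 - g' z.2 * (DQ (Phi z)).1 +
     (dotp (DQ (Phi z)) (g' z.2, 1)))).
  rewrite -(Fubini_rect_yx (cc _ cf)); apply: eq_Rintegral => z _.
  by rewrite /f /dotp /=; ring.
have Hds s y : a < s < b -> y1 < y < y2 -> forall u Du,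
    (forall z, A z -> differentiable u z /\ grad u z = Du z) ->
    is_derive s 1 (fun t => u (g y + t, y)) (Du (g y + s, y)).1.
  move=> sab yy u Du du; have [duz guz] := du _ (HA _ _ sab yy).
  have d1 : is_derive s 1 (fun t : R => g y + t) 1.
    rewrite -[X in is_derive _ _ _ X]add0r.
    exact: (is_deriveD (is_derive_cst (g y) s 1) (is_derive_id s 1)).
  have d2 : is_derive s 1 (fun _ : R => y) 0 by exact: is_derive_cst.
  have := @chain_rule R u (fun t : R => g y + t) (fun=> y) s 1 0 duz d1 d2.
  by rewrite guz /dotp/= mulr1 mulr0 addr0.
transitivity (\int[mu]_(y in `]y1, y2[)
    ((fun z => P (Phi z) - g' z.2 * Q (Phi z)) (b, y) -
     (fun z => P (Phi z) - g' z.2 * Q (Phi z)) (a, y)) +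
   \int[mu]_(x in `]a, b[) ((Q \o Phi) (x, y2) - (Q \o Phi) (x, y1))); last first.
  rewrite [X in _ + X](_ : _ = 0) ?addr0//.
  by apply: Rintegral_eq0 => s /=; rewrite in_itv/= => /HQ[h1 h2]; rewrite /Phi/= h1 h2 subrr.
apply: (@rect_divergence _ _ _ _ _ (fun z => P (Phi z) - g' z.2 * Q (Phi z))
  (fun z => (DP (Phi z)).1 - g' z.2 * (DQ (Phi z)).1)
  (Q \o Phi) (fun z => dotp (DQ (Phi z)) (g' z.2, 1))) => //.
- apply: continuousB_within; first exact: cc.
  by apply: continuousM_within; [exact: cg2|exact: cc].
- apply: continuousB_within.
    by apply: (cc (fun z => (DP z).1)); exact: continuous_fst_within.
  apply: continuousM_within; first exact: cg2.
  by apply: (cc (fun z => (DQ z).1)); exact: continuous_fst_within.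
- exact: cc.
- apply: continuousD_within; apply: continuousM_within.
  + by apply: (cc (fun z => (DQ z).1)); exact: continuous_fst_within.
  + exact: (cg2 g').
  + by apply: (cc (fun z => (DQ z).2)); exact: continuous_snd_within.
  + by apply: continuous_subspaceT => z; exact: cvg_cst.
- move=> s y sab yy /=; have h1 := Hds s y sab yy P DP dP; have h2 := Hds s y sab yy Q DQ dQ.
  have h3 : is_derive s 1 (fun t : R => g' y * Q (g y + t, y)) (g' y * (DQ (g y + s, y)).1).
    by have := @is_deriveZ _ _ _ (fun t => Q (g y + t, y)) (g' y) s 1 _ h2.
  exact: (is_deriveB h1 h3).
- move=> s y sab yy /=; have [duz guz] := dQ _ (HA _ _ sab yy).
  have yy' : y1 <= y <= y2 by case/andP: yy => /ltW -> /ltW ->.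
  have d0 := dg y yy'.
  have d1 : is_derive y 1 (fun t : R => g t + s) (g' y) by apply: is_derive_eq; rewrite addr0.
  have := @chain_rule R Q (fun t : R => g t + s) id y (g' y) 1 duz d1 (is_derive_id _ _).
  by rewrite guz.
Qed.

End GraphDivergence.

(** * The two sides of a boundary arc and its normal *)

Section LocalSides.
Variable R : realType.
Local Notation mu := (@lebesgue_measure R).

(** The path avoids the boundary, so its connected image is covered by A and the complement of the
    closure of A, which are separated. *)
Lemma path_side (A : set (R * R)) (gamma : R -> R * R) : open A ->
  {within `[0, 1], continuous gamma} ->
  (forall t, 0 <= t <= 1 -> closure A (gamma t) -> A (gamma t)) ->
  A (gamma 0) -> A (gamma 1).
Proof.
move=> oA cg HA A0.
have sep : separated A (~` closure A).
  split; first by rewrite setICr.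
  apply/seteqP; split => // z [Az /(_ A (open_nbhs_nbhs (conj oA Az)))[w [nw Aw]]].
  by exfalso; apply: nw; exact: subset_closure.
have con : connected (gamma @` `[0, 1]).
  by apply: connected_continuous_connected => //; exact: segment_connected.
have [|h|h] := connected_subset sep _ con.
- move=> _ [t tt <-]; have [K|K] := pselect (closure A (gamma t)); [left|by right].
  by apply: HA => //; move: tt; rewrite /= in_itv.
- by apply: h; exists 1 => //=; rewrite in_itv/= ler01 lexx.
- exfalso; have /h : (gamma @` `[0, 1]) (gamma 0) by exists 0 => //=; rewrite in_itv/= ler01 lexx.
  by apply; exact: subset_closure.
Qed.

Lemma near_dist (f : R -> R) (x e : R) : {for x, continuous f} -> 0 < e ->
  \forall y \near x, `|f x - f y| < e.
Proof. by move=> /cvgrPdist_lt H e0; exact: H. Qed.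

Lemma near_between (f : R -> R) (x a b : R) : {for x, continuous f} -> a < f x < b ->
  \forall y \near x, a < f y < b.
Proof.
move=> cf /andP[h1 h2].
have e1 : 0 < f x - a by rewrite subr_gt0.
have e2 : 0 < b - f x by rewrite subr_gt0.
have := near_dist cf e2; have := near_dist cf e1; apply: filterS2 => y.
by rewrite !ltr_distl => /andP[? ?] /andP[? ?]; apply/andP; split; lra.
Qed.

Lemma continuous_at_comp (f g : R -> R) x : {for x, continuous f} ->
  {for f x, continuous g} -> {for x, continuous (fun y => g (f y))}.
Proof. by move=> cf cg; exact: (@continuous_comp _ _ _ f g). Qed.

Lemma convex_between (a b y y' x : R) : a <= y <= b -> a <= y' <= b -> 0 <= x <= 1 ->
  a <= y + x * (y' - y) <= b.
Proof. by move=> /andP[? ?] /andP[? ?] /andP[? ?]; apply/andP; split; nra. Qed.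

Lemma convex_neq0 (s s' x : R) : 0 < s * s' -> 0 <= x <= 1 -> s + x * (s' - s) != 0.
Proof.
move=> ss /andP[? ?]; apply/eqP => E.
have [s0|s0] := ltP 0 s.
  have : 0 < s' by rewrite -(pmulr_rgt0 _ s0).
  nra.
have s0' : s < 0.
  by rewrite lt_neqAle s0 andbT; apply/eqP => s00; move: ss; rewrite s00 mul0r ltxx.
have : s' < 0 by rewrite -(nmulr_rgt0 _ s0').
nra.
Qed.

Lemma sg_lt0 (n s : R) : n != 0 -> (s * Num.sg n < 0) = (s * n < 0).
Proof. by move=> n0; rewrite [in RHS](numEsg n) mulrA [RHS]pmulr_llt0// normr_gt0. Qed.

Lemma sg_gt0 (n s : R) : n != 0 -> (0 < s * Num.sg n) = (0 < s * n).
Proof. by move=> n0; rewrite [in RHS](numEsg n) mulrA [RHS]pmulr_lgt0// normr_gt0. Qed.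

Lemma mul_gt0_trans (n s t : R) : 0 < s * n -> 0 < t * n -> 0 < s * t.
Proof. by move=> sn tn; rewrite -(@pmulr_lgt0 _ (n * n)); nra. Qed.

Lemma mul_lt0_trans (n s t : R) : s * n < 0 -> t * n < 0 -> 0 < s * t.
Proof. by move=> sn tn; apply: (@mul_gt0_trans (- n)); rewrite mulrN oppr_gt0. Qed.

Lemma affine_derive (x y t : R) : is_derive t 1 (fun s : R => x + s * y) y.
Proof.
rewrite (_ : (fun s : R => _) = (fun s : R => s * y + x)); last by apply/funext => s; rewrite addrC.
by apply: is_derive_eq; rewrite /GRing.scale/= mulr0 add0r mulr1 addr0.
Qed.

Lemma pos_cancel (x y z : R) : 0 < y -> 0 < x * y * z -> 0 < x * z.
Proof. by move=> y0; rewrite mulrAC pmulr_lgt0. Qed.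

Lemma neg_cancel (x y z : R) : 0 < y -> 0 < x * - y * z -> x * z < 0.
Proof. by move=> y0; rewrite mulrAC mulrN oppr_gt0 pmulr_llt0. Qed.

Lemma half_lt (e : R) : 0 < e -> `|e / 2| < e.
Proof. by move=> e0; rewrite gtr0_norm; lra. Qed.

(** The left-hand side is the derivative, along the normal (n1, n2), of the horizontal distance to a
    graph of slope v1 / v2; the right-hand side shows that it has the sign of n1. *)
Lemma transversal_slope (n1 n2 v1 v2 : R) : v2 != 0 -> n1 * v1 + n2 * v2 = 0 ->
  n1 - v1 / v2 * n2 = n1 * (1 + (v1 / v2) ^+ 2).
Proof.
move=> v20 nv; have -> : n2 = - (n1 * v1 / v2) by apply: (mulIf v20); rewrite mulNr divfK//; lra.
by field.
Qed.

Lemma shift_lt (p q s d r : R) : `|p - q| < d / 2 -> `|p - (q + s)| < r -> r < d / 2 ->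
  `|s| < d.
Proof.
move=> h1 h2 rd; have : `|(p - q) - (p - (q + s))| <= `|p - q| + `|p - (q + s)| by exact: ler_normB.
by rewrite (_ : (p - q) - (p - (q + s)) = s); [lra|ring].
Qed.

Lemma shift_ball (p q s r : R) : `|p - q| < r / 2 -> `|s| <= r / 2 -> `|p - (q + s)| < r.
Proof.
move=> h1 h2; have : `|(p - q) - s| <= `|p - q| + `|s| by exact: ler_normB.
by rewrite (_ : p - q - s = p - (q + s)); [lra|ring].
Qed.

Lemma dist_between (p z r e : R) : `|p - z| < r -> r < e -> p - e < z < p + e.
Proof. by rewrite ltr_distl => /andP[? ?] ?; apply/andP; split; lra. Qed.

Lemma dist_lt (p y s r : R) : p - s <= y <= p + s -> s < r -> `|p - y| < r.
Proof. by rewrite ltr_distl => /andP[? ?] ?; apply/andP; split; lra. Qed.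

Lemma flux_identity (e p q v1 v2 : R) : v2 != 0 ->
  e * (p - v1 / v2 * q) * `|v2| = e * Num.sg v2 * (p * v2 - q * v1).
Proof. by move=> v20; rewrite normrEsg; field. Qed.

(** Caratheodory's form f s = H s * s, with H continuous and H 0 = D, shows that near 0 the quotient
    f s / s has the sign of D. *)
Lemma derive_sign (f : R -> R) (D : R) : is_derive (0 : R) 1 f D -> f 0 = 0 -> D != 0 ->
  \forall s \near (0 : R), s != 0 -> 0 < f s * s * D.
Proof.
move=> df f0 D0; have /is_derive1_caratheodory[h [fE hc h0]] := df.
have : \forall s \near (0:R), `|h 0 - h s| < `|D| by apply: (near_dist hc); rewrite normr_gt0.
apply: filterS => s; rewrite h0 => hs s0.
have -> : f s = h s * s by have := fE s; rewrite f0 !subr0.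
have : 0 < h s * D.
  move: hs; have [Dp|Dn] := ltP 0 D.
    rewrite (gtr0_norm Dp) ltr_distl => /andP[? ?]; nra.
  have Dn' : D < 0 by rewrite lt_neqAle D0.
  rewrite (ltr0_norm Dn') ltr_distl => /andP[? ?]; nra.
have : 0 < s ^+ 2 by rewrite exprn_even_gt0.
nra.
Qed.

Definition speed (c : R -> R * R) (t : R) : R :=
  Num.sqrt (dotp (velocity c t) (velocity c t)).

Lemma C1_curve_derive (c : R -> R * R) : C1_curve c ->
  [/\ forall t : R, is_derive t 1 (fun s => (c s).1) (velocity c t).1,
      forall t : R, is_derive t 1 (fun s => (c s).2) (velocity c t).2,
      continuous (fun t => (velocity c t).1) & continuous (fun t => (velocity c t).2)].
Proof.
move=> [d1 d2 cv]; split.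
- by move=> t; rewrite /velocity/= derive1E; exact: derivableP.
- by move=> t; rewrite /velocity/= derive1E; exact: derivableP.
- by move=> t; apply: (@cvg_comp _ _ _ (velocity c) fst); [exact: cv|exact: cvg_fst].
- by move=> t; apply: (@cvg_comp _ _ _ (velocity c) snd); [exact: cv|exact: cvg_snd].
Qed.

(** In the plane a unit normal is determined by the velocity up to sign: n = k (v.2, - v.1) with k =
    n.1 / v.2 and |k| |v| = 1, so only the sign of k remains. *)
Lemma normal_velocity (v n : R * R) : dotp n n = 1 -> dotp n v = 0 -> v.2 != 0 ->
  n.1 != 0 /\
  Num.sqrt (dotp v v) *: n = (Num.sg n.1 * Num.sg v.2) *: (v.2, - v.1).
Proof.
case: v n => [v1 v2] [n1 n2]; rewrite /dotp/= => n11 nv v20.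
pose k := n1 / v2.
have n1E : n1 = k * v2 by rewrite /k divfK.
have n2E : n2 = - (k * v1).
  apply: (mulIf v20); rewrite mulNr mulrAC -n1E; lra.
have kk : k ^+ 2 * (v1 * v1 + v2 * v2) = 1.
  by move: n11; rewrite n1E n2E => <-; ring.
have k0 : k != 0.
  by apply/eqP => k0; move: kk; rewrite k0 expr0n/= mul0r => /eqP; rewrite eq_sym oner_eq0.
split; first by rewrite n1E mulf_neq0.
have s0 : 0 <= v1 * v1 + v2 * v2 by nra.
have ks : `|k| * Num.sqrt (v1 * v1 + v2 * v2) = 1.
  rewrite -sqrtr_sqr -sqrtrM ?sqr_ge0// kk sqrtr1//.
have sgE : Num.sg n1 * Num.sg v2 = Num.sg k.
  by rewrite n1E sgrM -mulrA -sgrM -expr2 -[v2 ^+ 2]ger0_norm ?sqr_ge0// sgr_norm expf_neq0//= mulr1.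
have kE : Num.sqrt (v1 * v1 + v2 * v2) * k = Num.sg k.
  by rewrite {1}[k]numEsg mulrCA [_ * `|k|]mulrC ks mulr1.
by rewrite sgE; congr pair; rewrite /= /GRing.scale/= ?n1E ?n2E -kE; ring.
Qed.

End LocalSides.

(** * Charts at boundary points with non-horizontal tangent *)

Section LocalDivergence.
Variable R : realType.
Local Notation mu := (@lebesgue_measure R).
Variables (A : set (R * R)) (c nu : R -> R * R) (a t0 b : R).
Hypothesis oA : open A.
Hypothesis bA : bounded_set A.
Hypothesis cK : compact (closure A).
Hypothesis cC1 : C1_curve c.
Hypothesis abt0 : a < t0 < b.
Hypothesis bd_local : forall a' b', a' < t0 < b' ->
  exists2 r, 0 < r & forall z, closure A z -> ~ A z -> ball (c t0) r z ->
    exists2 t, a' < t < b' & z = c t.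
Hypothesis bd_arc : forall t, a < t < b -> closure A (c t) /\ ~ A (c t).
Hypothesis normal : forall t, a < t < b -> outward_unit_normal A c t (nu t).

(** Near c t0 the boundary is a graph x = g y. A small box around it, cut along the graph, has two
    halves free of boundary points; each lies wholly inside or wholly outside A, and the outward
    normal tells which. A therefore fills exactly one half, [graph_divergence] applies, and the
    substitution y = (c t).2 turns the edge integral into one over the arc. *)
Lemma local_divergence2 : (velocity c t0).2 != 0 ->
  exists a' b' r sigma, [/\ a < a' < t0, t0 < b' < b, 0 < r,
    (forall t, a' < t < b' ->
      speed c t *: nu t = sigma *: ((velocity c t).2, - (velocity c t).1)) &
    forall P Q DP DQ, C1_upto A P DP -> C1_upto A Q DQ ->
      (forall z, closure A z -> ~ ball (c t0) r z ->
        [/\ P z = 0, Q z = 0, DP z = 0 & DQ z = 0]) ->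
      \int[leb2 R]_(z in A) ((DP z).1 + (DQ z).2) =
      \int[mu]_(t in `]a', b'[)
        (sigma * (P (c t) * (velocity c t).2 - Q (c t) * (velocity c t).1))].
Proof.
move=> v20.
have [dc1 dc2 cv1 cv2] := C1_curve_derive cC1.
set v1 := (fun t => (velocity c t).1) in cv1 dc1 *.
set v2 := (fun t => (velocity c t).2) in cv2 dc2 *.
have ct t : c t = ((c t).1, (c t).2) by case: (c t).
have [t1 [t2 [ht1 ht2 hv2]]] : exists t1 t2, [/\ a < t1 < t0, t0 < t2 < b &
    forall t, t1 <= t <= t2 -> v2 t != 0].
  have nv2 : \forall t \near t0, v2 t != 0 by apply: (@cvgr_neq0 _ _ _ _ _ v2 _ (cv2 t0)).
  have : \forall t \near t0, v2 t != 0 /\ a < t < b.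
    case/andP: abt0 => h1 h2; near=> t; split; first by near: t.
    by apply/andP; split; near: t; [exact: lt_nbhsr|exact: lt_nbhsl].
  case/nbhs_ballP => e /= e0 He.
  exists (t0 - e / 2), (t0 + e / 2).
  have B t : t0 - e / 2 <= t <= t0 + e / 2 -> v2 t != 0 /\ a < t < b.
    move=> /andP[? ?]; apply: He; rewrite /ball/= distrC ltr_distl; apply/andP; split; lra.
  have [|_ /andP[h1 h2]] := B (t0 - e / 2); first by apply/andP; split; lra.
  have [|_ /andP[h3 h4]] := B (t0 + e / 2); first by apply/andP; split; lra.
  split; [by apply/andP; split; lra|by apply/andP; split; lra|].
  by move=> t /B[].
have /andP[at1 t10] := ht1; have /andP[t02 t2b] := ht2.
have t102 : t1 < t0 < t2 by rewrite t10 t02.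
have [tau [Y1 [Y2 [HY Htau tauK Hsub]]]] := inverse_C1 dc2 cv2 t102 hv2.
pose g y := (c (tau y)).1.
pose g' y := v1 (tau y) / v2 (tau y).
have ctau y : Y1 < y < Y2 -> c (tau y) = (g y, y).
  by move=> /Htau[_ h _]; rewrite ct h.
have tt12 t : t1 < t < t2 -> t1 <= t <= t2 by case/andP => /ltW -> /ltW ->.
have dg y : Y1 < y < Y2 -> is_derive y 1 g (g' y).
  move=> /Htau[h1 h2 h3].
  exact: (@is_derive1_comp _ (fun t => (c t).1) tau y _ _ (dc1 _) h3).
have cg' y : Y1 < y < Y2 -> {for y, continuous g'}.
  move=> /Htau[h1 h2 h3].
  have ctau' : {for y, continuous tau}.
    by apply/differentiable_continuous/derivable1_diffP; exact: ex_derive.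
  apply: cvgM; first exact: (continuous_at_comp ctau' (cv1 _)).
  apply: cvgV; first exact/hv2/tt12.
  exact: (continuous_at_comp ctau' (cv2 _)).
have cg y : Y1 < y < Y2 -> {for y, continuous g}.
  by move=> /dg H; apply/differentiable_continuous/derivable1_diffP; exact: ex_derive.
have tau0 : tau (c t0).2 = t0 by have [] := tauK t0 (tt12 _ t102).
have g0 : g (c t0).2 = (c t0).1 by rewrite /g tau0.
set p := c t0 in g0 tau0 HY.
have [r0 r00 Hr0] := bd_local t102.
(* Half of r0 is spent on the variation of g and half on the offset s, so that the box |s| <= d
   stays in the ball where the arc is the only piece of boundary. *)
pose d := r0 / 2.
have d0 : 0 < d by rewrite divr_gt0.
have [rho [rho0 rhor Hrho]] : exists rho, [/\ 0 < rho, rho < r0 & forall y, p.2 - rho <= y <= p.2 + rho ->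
    Y1 < y < Y2 /\ `|p.1 - g y| < d].
  have : \forall y \near p.2, (Y1 < y < Y2) /\ `|g p.2 - g y| < d.
    case/andP: (HY) => hY1 hY2; near=> y; split.
      by apply/andP; split; near: y; [exact: lt_nbhsr|exact: lt_nbhsl].
    by near: y; apply: (near_dist (cg _ HY)).
  case/nbhs_ballP => e /= e0 He.
  exists (Num.min (e / 2) d); split; first by rewrite lt_min d0 divr_gt0.
    by rewrite gt_min /d; apply/orP; right; lra.
  move=> y /andP[y1 y2]; have me : Num.min (e / 2) d <= e / 2 by rewrite ge_min lexx.
  have me' : Num.min (e / 2) d < e by apply: le_lt_trans me _; lra.
  by rewrite -g0; apply: He; rewrite /ball/=; apply: dist_lt me'; rewrite y1 y2.
(* A field supported in the ball of radius r then vanishes on the far edge |s| = d and on the two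
   ends of the box. *)
have [r [rr0 rrho rd Hr]] : exists r, [/\ 0 < r, r < rho, r < d / 2 & forall y, `|p.2 - y| < r -> `|p.1 - g y| < d / 2].
  have : \forall y \near p.2, `|g p.2 - g y| < d / 2.
    by apply: (near_dist (cg _ HY)); rewrite divr_gt0.
  case/nbhs_ballP => e /= e0 He.
  exists (Num.min e (Num.min (rho / 2) (d / 3))).
  rewrite !lt_min e0 !divr_gt0//; split => //.
  - by rewrite !gt_min; apply/orP; right; apply/orP; left; lra.
  - by rewrite !gt_min; apply/orP; right; apply/orP; right; lra.
  by move=> y; rewrite lt_min => /andP[ye _]; rewrite -g0; apply: He.
pose y1 := p.2 - rho; pose y2 := p.2 + rho.
have yy0 : y1 < p.2 < y2 by rewrite /y1 /y2 ltrBlDr !ltrDl rho0.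
have yY y : y1 <= y <= y2 -> Y1 < y < Y2 by move=> /Hrho[].
(* A boundary point in the box would be some c t with t in ]t1, t2[, and would then lie on the
   graph, that is, have s = 0. *)
have off y s : y1 <= y <= y2 -> `|s| <= d -> s != 0 -> closure A (g y + s, y) -> A (g y + s, y).
  move=> yy sd s0 Kz; apply: contrapT => nA.
  have [yY' gy] := Hrho y yy.
  have B : ball p r0 (g y + s, y).
    split; rewrite /ball/=.
      exact: shift_ball.
    exact: dist_lt yy rhor.
  have [t tt zt] := Hr0 _ Kz nA B.
  have [tE _] := tauK t (tt12 _ tt).
  have yE : (c t).2 = y by rewrite -zt.
  have : (c t).1 = g y + s by rewrite -zt.
  rewrite /g -yE tE => /eqP; rewrite -subr_eq0 opprD addrA subrr sub0r oppr_eq0.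
  exact/negP.
have on y : y1 <= y <= y2 -> closure A (g y, y) /\ ~ A (g y, y).
  move=> /yY yy; rewrite -ctau//; have [/andP[h1 h2] _ _] := Htau y yy.
  by apply: bd_arc; rewrite (lt_trans at1 h1) (lt_trans h2 t2b).
(* The segment from (s, y) to (s', y') in the straightened coordinates never crosses s = 0. *)
have side y s y' s' : y1 <= y <= y2 -> y1 <= y' <= y2 -> `|s| <= d -> `|s'| <= d ->
    0 < s * s' -> A (g y + s, y) -> A (g y' + s', y').
  move=> yy yy' sd sd' ss Az.
  pose Y x := y + x * (y' - y); pose S x := s + x * (s' - s).
  have cY : continuous Y.
    move=> x; apply: cvgD; first exact: cvg_cst.
    by apply: cvgM; [exact: cvg_id|exact: cvg_cst].
  have cS : continuous S.
    move=> x; apply: cvgD; first exact: cvg_cst.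
    by apply: cvgM; [exact: cvg_id|exact: cvg_cst].
  have HYx x : 0 <= x <= 1 -> y1 <= Y x <= y2.
    exact: convex_between.
  have HSx x : 0 <= x <= 1 -> `|S x| <= d /\ S x != 0.
    move=> x01; split; last exact: convex_neq0.
    by move: sd sd'; rewrite !ler_norml => sd sd'; exact: convex_between.
  have := @path_side R A (fun x => (g (Y x) + S x, Y x)) oA.
  have -> : (g (Y 0) + S 0, Y 0) = (g y + s, y) by rewrite /Y /S !mul0r !addr0.
  have -> : (g (Y 1) + S 1, Y 1) = (g y' + s', y') by rewrite /Y /S !mul1r !subrKC.
  apply => //.
    apply: continuous_pair_within; last exact: continuous_subspaceT.
    apply: continuousD_within; last exact: continuous_subspaceT.
    apply: continuous_in_subspaceT => x; rewrite inE/= in_itv/= => /HYx/yY Yx.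
    exact: (continuous_at_comp (cY x) (cg _ Yx)).
  by move=> x x01; have [h1 h2] := HSx x x01; apply: off => //; exact: HYx.
have /andP[yp1 yp2] := yy0.
have y12 : y1 < y2 by exact: lt_trans yp2.
have [||a' [b' [ha' hb' Hab' HG]]] := Hsub y1 y2.
- by rewrite yp1 andbT; have /yY/andP[] : y1 <= y1 <= y2 by rewrite lexx ltW.
- by rewrite yp2; have /yY/andP[] : y1 <= y2 <= y2 by rewrite lexx ltW.
have tin t : a' < t < b' -> t1 < t < t2 /\ a < t < b.
  case/andP: ha' => h1 h2; case/andP: hb' => h3 h4 /andP[h5 h6].
  have s1 : t1 < t by exact: lt_trans h5.
  have s2 : t < t2 by exact: lt_trans h4.
  by rewrite s1 s2 (lt_trans at1 s1) (lt_trans s2 t2b).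
have ab't0 : a' < t0 < b' by case/andP: ha' => _ ->; case/andP: hb' => ->.
(* Moving along the normal by a small amount either way yields one probe outside A and one inside A,
   and the offset of each from the graph has a known sign relative to that of (nu t).1. *)
have cross t : a' < t < b' -> [/\ (nu t).1 != 0,
    speed c t *: nu t = (Num.sg (nu t).1 * Num.sg (v2 t0)) *: (v2 t, - v1 t),
    exists y s, [/\ y1 <= y <= y2, `|s| <= d, 0 < s * (nu t).1 & ~ A (g y + s, y)] &
    exists y s, [/\ y1 <= y <= y2, `|s| <= d, s * (nu t).1 < 0 & A (g y + s, y)]].
  move=> tt; have [tt' /normal[n1 n2 [e e0 nin] [e' e0' nout]]] := tin t tt.
  have v2t : v2 t != 0 by exact/hv2/tt12.
  have [n10 nE] := normal_velocity n1 n2 v2t.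
  have [tauE sgE] := tauK t (tt12 _ tt').
  have yt := Hab' t tt.
  have yt' : Y1 < (c t).2 < Y2 by apply: yY; case/andP: yt => /ltW -> /ltW ->.
  pose n := nu t.
  pose phi s := (c t).1 + s * n.1 - g ((c t).2 + s * n.2).
  have dphi : is_derive (0 : R) 1 phi (n.1 - g' (c t).2 * n.2).
    have l (x y : R) := affine_derive x y 0.
    have dg0 : is_derive ((c t).2 + 0 * n.2) 1 g (g' (c t).2) by rewrite mul0r addr0; exact: dg.
    exact: (is_deriveB (l (c t).1 n.1) (@is_derive1_comp _ g (fun s => (c t).2 + s * n.2) 0 _ _ dg0 (l (c t).2 n.2))).
  have phi0 : phi 0 = 0 by rewrite /phi !mul0r !addr0 /g tauE subrr.
  have DE : n.1 - g' (c t).2 * n.2 = n.1 * (1 + (g' (c t).2) ^+ 2).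
    by rewrite /g' tauE; exact: transversal_slope.
  have D0 : n.1 - g' (c t).2 * n.2 != 0.
    by rewrite DE mulf_neq0// gt_eqF// ltr_pwDl// sqr_ge0.
  have near0 : \forall s \near (0 : R), [/\ s != 0 -> 0 < phi s * s * n.1, `|phi s| <= d,
      y1 <= (c t).2 + s * n.2 <= y2, `|s| < e & `|s| < e'].
    have H1 := derive_sign dphi phi0 D0.
    have cphi : {for 0, continuous phi}.
      by apply/differentiable_continuous/derivable1_diffP; exact: ex_derive.
    have cl : {for (0 : R), continuous (fun s : R => (c t).2 + s * n.2)}.
      apply: cvgD; first exact: cvg_cst.
      by apply: cvgM; [exact: cvg_id|exact: cvg_cst].
    have Hl : \forall s \near (0 : R), y1 < (c t).2 + s * n.2 < y2.
      by apply: near_between => //; rewrite mul0r addr0.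
    near=> s; split.
    - move=> s0; have : 0 < phi s * s * (n.1 - g' (c t).2 * n.2) by move: s0; near: s.
      by rewrite DE mulrA pmulr_lgt0// ltr_pwDl// sqr_ge0.
    - rewrite -[phi s]subr0 -phi0 distrC; apply: ltW; near: s; exact: (near_dist cphi).
    - have /andP[l1 l2] : y1 < (c t).2 + s * n.2 < y2 by near: s.
      by rewrite !ltW.
    - rewrite -[s]subr0 distrC; near: s; exact: nbhsx_ballx.
    - rewrite -[s]subr0 distrC; near: s; exact: nbhsx_ballx.
  case/nbhs_ballP: near0 => eps /= eps0 Heps.
  have B (s : R) : `|s| < eps -> ball (0 : R) eps s by rewrite /ball/= sub0r normrN.
  have pt s : (g ((c t).2 + s * n.2) + phi s, (c t).2 + s * n.2) = c t + s *: n.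
    by rewrite /phi subrKC [RHS](_ : _ = ((c t).1 + s * n.1, (c t).2 + s * n.2))//; case: (c t); case: n.
  have eps2 : 0 < eps / 2 by rewrite divr_gt0.
  have s1 := half_lt eps0.
  have [h1 h2 h3 h4 h5] := Heps _ (B _ s1).
  have [k1 k2 k3 k4 k5] := Heps _ (B (- (eps / 2)) ltac:(by rewrite normrN)).
  split.
  - exact: n10.
  - by rewrite nE sgE.
  - exists ((c t).2 + eps / 2 * n.2), (phi (eps / 2)); split => //.
      exact: pos_cancel eps2 (h1 (lt0r_neq0 eps2)).
    rewrite pt => Az; apply: (nout (eps / 2)); last exact: subset_closure.
    by rewrite eps2/=; move: h5; rewrite gtr0_norm.
  - exists ((c t).2 + - (eps / 2) * n.2), (phi (- (eps / 2))); split => //.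
      have nz : - (eps / 2) != 0 by rewrite oppr_eq0 lt0r_neq0.
      exact: neg_cancel eps2 (k1 nz).
    rewrite pt scaleNr -scalerN; apply: nin.
    by rewrite eps2/=; move: h4; rewrite gtr0_norm.
have [n0 _ [yo [so [hyo hso hso' nAo]]] [yi [si [hyi hsi hsi' Ai]]]] := cross t0 ab't0.
pose eps := Num.sg (nu t0).1.
have sgn_in y s : y1 <= y <= y2 -> `|s| <= d -> s * eps < 0 -> A (g y + s, y).
  move=> yy sd; rewrite /eps sg_lt0// => sn.
  by apply: (side yi si) => //; exact: mul_lt0_trans hsi' sn.
have sgn_out y s : y1 <= y <= y2 -> `|s| <= d -> 0 < s * eps -> ~ A (g y + s, y).
  move=> yy sd; rewrite /eps sg_gt0// => sn Az; apply: nAo.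
  by apply: (side y s) => //; exact: mul_gt0_trans sn hso'.
(* If the sign changed along the arc, the outer probe at t would fall into the half already known to
   lie in A. *)
have sgn_nu t : a' < t < b' -> Num.sg (nu t).1 = eps.
  move=> tt; have [nt0 _ [y [s [hy hs hs' nAy]]] _] := cross t tt.
  have : ~ (s * eps < 0) by move=> h; apply: nAy; exact: sgn_in.
  rewrite /eps; move: nt0 n0 hs'; rewrite !neq_lt => /orP[a1|a1] /orP[a2|a2] hs' hh;
    rewrite ?(ltr0_sg a1) ?(gtr0_sg a1) ?(ltr0_sg a2) ?(gtr0_sg a2)//; exfalso; apply: hh;
    rewrite ?(ltr0_sg a1) ?(gtr0_sg a1) ?(ltr0_sg a2) ?(gtr0_sg a2)//; move: hs'.
    by rewrite mulr1 nmulr_lgt0.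
  by rewrite mulrN1 oppr_lt0 pmulr_lgt0.
exists a', b', r, (eps * Num.sg (v2 t0)); split.
- by case/andP: ha' => h1 ->; rewrite andbT (lt_trans at1 h1).
- by case/andP: hb' => -> h1; rewrite (lt_trans h1 t2b).
- exact: rr0.
- by move=> t tt; have [_ -> _ _] := cross t tt; rewrite sgn_nu.
move=> P Q DP DQ CP CQ V.
have AK : A `<=` closure A by exact: subset_closure.
have far y s : closure A (g y + s, y) -> `|s| = d -> [/\ P (g y + s, y) = 0 & Q (g y + s, y) = 0].
  move=> Kz sd; have [|-> -> _ _ //] := V _ Kz.
  case=> /=; rewrite /ball/= -/p => b1 b2; have b3 := Hr _ b2.
  by have := shift_lt b3 b1 rd; rewrite sd ltxx.
have ends y s : closure A (g y + s, y) -> (y = y1 \/ y = y2) -> Q (g y + s, y) = 0.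
  move=> Kz yy; have [|_ -> _ _ //] := V _ Kz.
  case=> _ /=; rewrite /ball/= -/p => b2.
  have : `|p.2 - y| = rho.
    by case: yy => ->; rewrite /y1 /y2; [rewrite subKr|rewrite opprD addrA subrr sub0r normrN]; rewrite gtr0_norm.
  by move=> h; move: (lt_trans b2 rrho); rewrite h ltxx.
(* The interval ]al, be[ is ]- d, 0[ or ]0, d[, whichever half is filled by A; both orientations are
   treated at once. *)
have main al be : al < be -> (forall s, al <= s <= be -> `|s| <= d /\ (s = 0 \/ s * eps < 0)) ->
    (forall s, al < s < be -> s * eps < 0) -> (forall s, `|s| < d -> s * eps < 0 -> al < s < be) ->
    \int[leb2 R]_(z in A) ((DP z).1 + (DQ z).2) =
    \int[mu]_(y in `]y1, y2[)
      ((P (g y + be, y) - g' y * Q (g y + be, y)) - (P (g y + al, y) - g' y * Q (g y + al, y))).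
  move=> alb H1 H2 H3.
  have HK s y : al <= s <= be -> y1 <= y <= y2 -> closure A (g y + s, y).
    move=> /H1[sd [->|sn]] yy; first by rewrite addr0; exact: (on y yy).1.
    by apply: AK; exact: sgn_in.
  have oo (x y z : R) : x < y < z -> x <= y <= z by case/andP => /ltW -> /ltW ->.
  apply: (@graph_divergence R A (closure A)) => //.
  - by move=> y /yY; exact: dg.
  - by apply: continuous_in_subspaceT => y; rewrite inE/= in_itv/= => /yY; exact: cg'.
  - by move=> s y sab yy; apply: sgn_in; [exact: oo|exact: (H1 _ (oo _ _ _ sab)).1|exact: H2].
  - move=> z Az nz; have [|_ _ -> ->] := V z (AK _ Az); last by rewrite addr0.
    case; rewrite /ball/= -/p => b1 b2; have b3 := Hr _ b2.
    have yy : y1 < z.2 < y2 by exact: dist_between b2 rrho.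
    have yy' := oo _ _ _ yy.
    pose s := z.1 - g z.2.
    have zs : z.1 = g z.2 + s by rewrite /s subrKC.
    have zE : z = (g z.2 + s, z.2) by rewrite -zs; case: (z).
    have sd : `|s| < d.
      by apply: (shift_lt b3 _ rd); rewrite /s subrKC.
    have [s0|s0|s0] := ltgtP (s * eps) 0.
    + apply: nz; split => //; have /andP[h1 h2] := H3 _ sd s0.
      by rewrite zs !ltrD2l; apply/andP.
    + by apply: (sgn_out z.2 s yy' (ltW sd) s0); rewrite -zE.
    + have s00 : s = 0 by apply/eqP; move/eqP: s0; rewrite mulf_eq0 sgr_eq0 (negbTE n0) orbF.
      by move: Az; rewrite zE s00 addr0; exact: (on _ yy').2.
  - move=> s /oo sab; split; apply: ends; try (by [left|right]); apply: HK => //;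
      by rewrite lexx ltW.
pose G y := eps * (P (g y, y) - g' y * Q (g y, y)).
have cG : {within `[y1, y2], continuous G}.
  have cgy : {within `[y1, y2], continuous (fun y => (g y, y))}.
    apply: continuous_pair_within; last by apply: continuous_subspaceT => y; exact: cvg_id.
    by apply: continuous_in_subspaceT => y; rewrite inE/= in_itv/= => /yY; exact: cg.
  have KP (F : R * R -> R) : {within closure A, continuous F} ->
      {within `[y1, y2], continuous (fun y => F (g y, y))}.
    move=> cF; apply: (within_continuous_comp cgy cF) => y /=.
    by rewrite in_itv/= => yy; exact: (on y yy).1.
  apply: continuousM_within; first by apply: continuous_subspaceT => y; exact: cvg_cst.
  apply: continuousB_within; first exact: (KP P CP.2).
  apply: continuousM_within; last exact: (KP Q CQ.2).
  by apply: continuous_in_subspaceT => y; rewrite inE/= in_itv/= => /yY; exact: cg'.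
have E : \int[leb2 R]_(z in A) ((DP z).1 + (DQ z).2) = \int[mu]_(y in `]y1, y2[) G y.
  have KK y s : y1 < y < y2 -> `|s| <= d -> s * eps < 0 -> closure A (g y + s, y).
    by case/andP => /ltW h1 /ltW h2 sd sn; apply: AK; apply: sgn_in; rewrite ?h1.
  have [e1|e1] : eps = 1 \/ eps = -1.
    by rewrite /eps; move: n0; rewrite neq_lt => /orP[n0|n0]; rewrite ?(ltr0_sg n0) ?(gtr0_sg n0); [right|left].
  - rewrite (main (- d) 0); first last.
    + by move=> s; rewrite e1 mulr1 ltr_norml => /andP[-> _] ->.
    + by move=> s; rewrite e1 mulr1 => /andP[].
    + move=> s /andP[s1 s2]; rewrite e1 mulr1 ler_norml s1 (le_trans s2 (ltW d0)); split => //.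
      by move: s2; rewrite le_eqVlt => /predU1P[->|]; [left|right].
    + by rewrite oppr_lt0.
    apply: eq_Rintegral => y; rewrite inE/= in_itv/= => yy.
    have nd : `|- d| = d by rewrite normrN gtr0_norm.
    have K1 : closure A (g y + - d, y) by apply: KK; rewrite ?nd ?e1 ?mulr1 ?oppr_lt0.
    have [-> ->] := far _ _ K1 nd.
    by rewrite /G e1 mul1r mulr0 subr0 !addr0 subr0.
  - rewrite (main 0 d); first last.
    + by move=> s; rewrite e1 mulrN1 oppr_lt0 ltr_norml => /andP[_ ->] ->.
    + by move=> s; rewrite e1 mulrN1 oppr_lt0 => /andP[].
    + move=> s /andP[s1 s2]; rewrite e1 mulrN1 oppr_lt0 ler_norml s2 andbT (le_trans _ s1); last by rewrite oppr_le0 ltW.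
      by split => //; move: s1; rewrite le_eqVlt => /predU1P[<-|]; [left|right].
    + by [].
    apply: eq_Rintegral => y; rewrite inE/= in_itv/= => yy.
    have nd : `|d| = d by rewrite gtr0_norm.
    have K1 : closure A (g y + d, y) by apply: KK; rewrite ?nd ?e1 ?mulrN1 ?oppr_lt0.
    have [-> ->] := far _ _ K1 nd.
    by rewrite /G e1 !addr0 mulr0 subrr sub0r mulN1r.
rewrite E (HG G cG); apply: eq_Rintegral => t; rewrite inE/= in_itv/= => tt.
have [tt' _] := tin t tt; have [tE sE] := tauK t (tt12 _ tt').
have v2t := hv2 t (tt12 _ tt').
by rewrite /G /g /g' tE -ct -sE; exact: flux_identity.
Unshelve. all: by end_near.
Qed.

End LocalDivergence.

(** * Exchange of the coordinates *)

Section Swap.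
Variable R : realType.
Local Notation mu := (@lebesgue_measure R).

Definition swap (z : R * R) : R * R := (z.2, z.1).

Lemma swapK z : swap (swap z) = z. Proof. by case: z. Qed.

Lemma swap_continuous : continuous swap.
Proof.
by move=> z; apply: (@cvg_pair _ _ _ (nbhs z) (nbhs z.2) (nbhs z.1)); [exact: cvg_snd|exact: cvg_fst].
Qed.

Lemma ball_swap (p z : R * R) r : ball (swap p) r (swap z) <-> ball p r z.
Proof. by split=> -[/= ? ?]; split. Qed.

Lemma open_swap (A : set (R * R)) : open A -> open (swap @^-1` A).
Proof. by move=> oA; apply: open_comp => // z _; exact: swap_continuous. Qed.

Lemma closure_swap_sub (A : set (R * R)) : closure (swap @^-1` A) `<=` swap @^-1` closure A.
Proof.
move=> z cz B nB; have [w [Aw Bw]] : (swap @^-1` A) `&` (swap @^-1` B) !=set0.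
  by apply: cz; exact: swap_continuous.
by exists (swap w).
Qed.

Lemma closure_swap (A : set (R * R)) : closure (swap @^-1` A) = swap @^-1` closure A.
Proof.
apply/seteqP; split; first exact: closure_swap_sub.
move=> z cz; rewrite -[z]swapK; apply: (@closure_swap_sub (swap @^-1` A) (swap z)).
by rewrite (_ : swap @^-1` (swap @^-1` A) = A)//; apply/seteqP; split => w; rewrite /= swapK.
Qed.

Lemma bounded_swap (A : set (R * R)) : bounded_set A -> bounded_set (swap @^-1` A).
Proof.
move=> [M [Mr HM]]; exists M; split => // x /HM H z /= /H.
by rewrite /= !prod_normE maxC.
Qed.

Lemma within_swap (K : set (R * R)) (f : R * R -> R) : {within K, continuous f} ->
  {within swap @^-1` K, continuous (f \o swap)}.
Proof.
move=> cf; apply: (within_continuous_comp (K := K)) => //.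
by apply: continuous_subspaceT; exact: swap_continuous.
Qed.

Lemma C1_upto_swap A P DP : C1_upto A P DP ->
  C1_upto (swap @^-1` A) (P \o swap) (swap \o (DP \o swap)).
Proof.
move=> [[dP cDP] cP]; split; last by rewrite closure_swap; exact: within_swap.
split; last first.
  rewrite closure_swap; apply: (@continuous_pair_within _ _ _ (fun z => (DP (swap z)).2) (fun z => (DP (swap z)).1)).
    by apply: (@within_swap _ (fun z => (DP z).2)); exact: continuous_snd_within.
  by apply: (@within_swap _ (fun z => (DP z).1)); exact: continuous_fst_within.
move=> z /= Az; have [dz gz] := dP _ Az.
have L1 : differentiable (fst : R * R -> R) z by apply: linear_differentiable => y; exact: cvg_fst.
have L2 : differentiable (snd : R * R -> R) z by apply: linear_differentiable => y; exact: cvg_snd.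
have ds : differentiable (fun z : R * R => (z.2, z.1)) z by exact: differentiable_pair.
have dc : differentiable (P \o swap) z by exact: differentiable_comp.
have E w : 'D_w (P \o swap) z = dotp (DP (swap z)) ('d (snd : R * R -> R) z w, 'd (fst : R * R -> R) z w).
  rewrite -gz; transitivity ('d (P \o (fun z => (z.2, z.1))) z w); first by rewrite deriveE.
  exact: diff_comp_pair w L2 L1 dz.
have F w : 'd (fst : R * R -> R) z w = w.1 by rewrite diff_lin// => y; exact: cvg_fst.
have S w : 'd (snd : R * R -> R) z w = w.2 by rewrite diff_lin// => y; exact: cvg_snd.
split; first exact: dc.
by congr pair; [rewrite (E (e1 R))|rewrite (E (e2 R))];
  rewrite F S /dotp /= mulr0 mulr1 ?addr0 ?add0r.
Qed.

(** Both sides are the same iterated integral, reached by Fubini in opposite orders. *)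
Lemma integral_swap (A K : set (R * R)) (f : R * R -> R) : open A -> A `<=` K -> compact K ->
  {within K, continuous f} ->
  \int[leb2 R]_(z in swap @^-1` A) f (swap z) = \int[leb2 R]_(z in A) f z.
Proof.
move=> oA AK cK cf.
have cK' : compact (swap @^-1` K).
  rewrite (_ : swap @^-1` K = swap @` K).
    by apply: continuous_compact => //; apply: continuous_subspaceT; exact: swap_continuous.
  by apply/seteqP; split => [z Kz|_ [z Kz <-]]; [exists (swap z) => //; rewrite swapK|rewrite /= swapK].
rewrite Fubini_yx; last 2 first.
- by apply: open_measurable2; exact: open_swap.
- apply: (@continuous_integrable2 _ _ (swap @^-1` K)) => //; first exact: open_swap.
    by move=> z /AK.
  exact: (@within_swap K f).
rewrite [RHS]Fubini_xy//; first exact: open_measurable2.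
exact: continuous_integrable2 cf.
Qed.

End Swap.

(** * Charts at all boundary and interior points *)

Section Local.
Variable R : realType.
Local Notation mu := (@lebesgue_measure R).
Variables (A : set (R * R)) (c nu : R -> R * R) (a t0 b : R).
Hypothesis oA : open A.
Hypothesis bA : bounded_set A.
Hypothesis cK : compact (closure A).
Hypothesis cC1 : C1_curve c.
Hypothesis abt0 : a < t0 < b.
Hypothesis bd_local : forall a' b', a' < t0 < b' ->
  exists2 r, 0 < r & forall z, closure A z -> ~ A z -> ball (c t0) r z ->
    exists2 t, a' < t < b' & z = c t.
Hypothesis bd_arc : forall t, a < t < b -> closure A (c t) /\ ~ A (c t).
Hypothesis normal : forall t, a < t < b -> outward_unit_normal A c t (nu t).

(** A regular point has a nonzero velocity component; if it is only the first one, the coordinates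
    are exchanged. *)
Lemma local_divergence : velocity c t0 != 0 ->
  exists a' b' r sigma, [/\ a < a' < t0, t0 < b' < b, 0 < r,
    (forall t, a' < t < b' ->
      speed c t *: nu t = sigma *: ((velocity c t).2, - (velocity c t).1)) &
    forall P Q DP DQ, C1_upto A P DP -> C1_upto A Q DQ ->
      (forall z, closure A z -> ~ ball (c t0) r z ->
        [/\ P z = 0, Q z = 0, DP z = 0 & DQ z = 0]) ->
      \int[leb2 R]_(z in A) ((DP z).1 + (DQ z).2) =
      \int[mu]_(t in `]a', b'[)
        (sigma * (P (c t) * (velocity c t).2 - Q (c t) * (velocity c t).1))].
Proof.
move=> v0; have [v2|v2] := eqVneq (velocity c t0).2 0; last exact: local_divergence2.
have v1 : (velocity c t0).1 != 0.
  by apply: contra v0 => /eqP v1; apply/eqP; move: v1 v2; case: (velocity c t0) => x y /= -> ->.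
pose c' := @swap R \o c; pose nu' := @swap R \o nu; pose A' := @swap R @^-1` A.
have vE t : velocity c' t = swap (velocity c t) by [].
have K'E : closure A' = @swap R @^-1` closure A by exact: closure_swap.
have cK' : compact (closure A').
  rewrite K'E (_ : _ @^-1` _ = @swap R @` closure A).
    by apply: continuous_compact => //; apply: continuous_subspaceT; exact: swap_continuous.
  by apply/seteqP; split => [z Kz|_ [z Kz <-]]; [exists (swap z) => //; rewrite swapK|rewrite /= swapK].
have C1' : C1_curve c'.
  have [d1 d2 cv] := cC1; split; [exact: d2|exact: d1|].
  rewrite (_ : velocity c' = @swap R \o velocity c); last exact/funext.
  by move=> t; apply: continuous_comp; [exact: cv|exact: swap_continuous].
have bdl a' b' : a' < t0 < b' -> exists2 r, 0 < r & forall z, closure A' z -> ~ A' z ->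
    ball (c' t0) r z -> exists2 t, a' < t < b' & z = c' t.
  move=> /bd_local[r r0 Hr]; exists r => // z; rewrite K'E => Kz nAz bz.
  have [|t tt zt] := Hr _ Kz nAz; first by rewrite -ball_swap swapK.
  by exists t => //; rewrite /c'/= -zt swapK.
have bda t : a < t < b -> closure A' (c' t) /\ ~ A' (c' t).
  by rewrite K'E /A' /c' /= swapK; exact: bd_arc.
have nrm t : a < t < b -> outward_unit_normal A' c' t (nu' t).
  move=> /normal[n1 n2 [e e0 nin] [e' e0' nout]]; split.
  - by rewrite /dotp addrC.
  - by rewrite vE /dotp addrC.
  - by exists e => // s /nin.
  - by exists e' => // s /nout; rewrite K'E.
have sE t : speed c' t = speed c t by rewrite /speed vE /dotp addrC.
have [a' [b' [r [sigma [ha hb r0 Hn HD]]]]] :=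
  local_divergence2 (open_swap oA) (bounded_swap bA) cK' C1' abt0 bdl bda nrm v1.
(* The exchange reverses the orientation of the plane, hence the sign of the rotated velocity. *)
exists a', b', r, (- sigma); split => //.
- move=> t /Hn; rewrite sE vE => -[h1 h2].
  congr pair; rewrite /= ?scaleNr -?scalerN; first exact: h2.
  by rewrite opprK; exact: h1.
- move=> P Q DP DQ CP CQ V.
  rewrite -(@integral_swap _ A (closure A) (fun z => (DP z).1 + (DQ z).2))//; last first.
  + by apply: continuousD_within; [exact: continuous_fst_within CP.1.2|exact: continuous_snd_within CQ.1.2].
  + exact: subset_closure.
  have -> : \int[leb2 R]_(z in A') ((DP (swap z)).1 + (DQ (swap z)).2) =
      \int[leb2 R]_(z in A') ((swap (DQ (swap z))).1 + (swap (DP (swap z))).2).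
    by apply: eq_Rintegral => z _; rewrite addrC.
  rewrite (HD _ _ _ _ (C1_upto_swap CQ) (C1_upto_swap CP)).
    by apply: eq_Rintegral => t _; rewrite vE /c'/= swapK; ring.
  move=> z; rewrite K'E => Kz nb; have [|p1 p2 p3 p4] := V _ Kz; first by rewrite -ball_swap swapK.
  by rewrite /= p1 p2 p3 p4.
Qed.

(** A degenerate case of [graph_divergence]: the graph is a vertical line through p, and the field
    vanishes on the whole edge of the box. *)
Lemma interior_divergence p : A p -> exists2 r, 0 < r &
    forall P Q DP DQ, C1_upto A P DP -> C1_upto A Q DQ ->
      (forall z, closure A z -> ~ ball p r z ->
        [/\ P z = 0, Q z = 0, DP z = 0 & DQ z = 0]) ->
      \int[leb2 R]_(z in A) ((DP z).1 + (DQ z).2) = 0.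
Proof.
move=> Ap; have /nbhs_ballP[e /= e0 He] : nbhs p A by exact: open_nbhs_nbhs.
pose r := e / 2; have r0 : 0 < r by rewrite divr_gt0.
have rr : - r < r by rewrite (lt_trans _ r0)// oppr_lt0.
have yy : p.2 - r < p.2 + r by rewrite ltrD2l.
have AK : A `<=` closure A by exact: subset_closure.
have inA s y : - r <= s <= r -> p.2 - r <= y <= p.2 + r -> A (p.1 + s, y).
  move=> sr yr; apply: He; split; rewrite /ball/=.
    by rewrite opprD addrA subrr sub0r normrN (@le_lt_trans _ _ r) ?ler_norml// /r; lra.
  by rewrite distrC (@le_lt_trans _ _ r) ?ler_distl// /r; lra.
have oo (x y z : R) : x < y < z -> x <= y <= z by case/andP => /ltW -> /ltW ->.
exists r => // P Q DP DQ CP CQ V.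
have V1 s y : - r <= s <= r -> p.2 - r <= y <= p.2 + r -> `|s| = r -> P (p.1 + s, y) = 0 /\ Q (p.1 + s, y) = 0.
  move=> sr yr sE; have [|-> -> //] := V _ (AK _ (inA _ _ sr yr)).
  by case=> /= + _; rewrite /ball/= opprD addrA subrr sub0r normrN sE ltxx.
have V2 s y : - r <= s <= r -> p.2 - r <= y <= p.2 + r -> `|p.2 - y| = r -> Q (p.1 + s, y) = 0.
  move=> sr yr yE; have [|_ -> //] := V _ (AK _ (inA _ _ sr yr)).
  by case=> _ /=; rewrite /ball/= yE ltxx.
have rE : `|r| = r by rewrite gtr0_norm.
rewrite (@graph_divergence R A (closure A) P Q DP DQ (fun=> p.1) (fun=> 0) (- r) r (p.2 - r) (p.2 + r))//.
- apply: Rintegral_eq0 => y; rewrite /= in_itv/= => /oo yr.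
  have [|||-> ->] := V1 r y => //; first by rewrite lexx ltW.
  have [|||-> ->] := V1 (- r) y => //; first by rewrite lexx ltW.
    by rewrite normrN.
  by rewrite mulr0 !subr0.
- by apply: continuous_subspaceT => y; exact: cvg_cst.
- by move=> s y sr yr; apply: AK; exact: inA.
- by move=> s y /oo sr /oo yr; exact: inA.
- move=> z Az nz; have [|_ _ -> ->] := V _ (AK _ Az); last by rewrite addr0.
  by case; rewrite /ball/= distrC => b1; rewrite distrC => b2; apply: nz; rewrite -!ltr_distl.
- move=> s /oo sr; split; apply: V2 => //; rewrite ?lexx ?(ltW yy)//; first by rewrite subKr.
  by rewrite opprD addrA subrr sub0r normrN.
Qed.

End Local.

(* The library does not equip R * R with a pointed topological structure. *)
Lemma compact_cover_plane (R : realType) (K : set (R * R)) :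
  compact K -> cover_compact K.
Proof.
pose T : ptopologicalType :=
  HB.pack (R * R)%type (Topological.on (R * R)%type) (Pointed.on (R * R)%type).
by move=> cK; have : @cover_compact T K by rewrite -(@compact_cover T).
Qed.

(** * Vector fields with prescribed gradients, and their cut-offs *)

Section Fields.
Variable R : realType.
Implicit Types (A : set (R * R)) (b : R * R -> R) (Db : R * R -> R * R).

(** The gradients of the two components travel with the field, so that cutting off is an explicit
    operation, valid up to the boundary by the product rule. *)
Record vfield := VField { vP : R * R -> R; vQ : R * R -> R;
  vDP : R * R -> R * R; vDQ : R * R -> R * R }.

Definition C1_field A (F : vfield) := C1_upto A (vP F) (vDP F) /\ C1_upto A (vQ F) (vDQ F).

Definition divF (F : vfield) (z : R * R) : R := (vDP F z).1 + (vDQ F z).2.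

Definition vanish (F : vfield) (z : R * R) : Prop :=
  [/\ vP F z = 0, vQ F z = 0, vDP F z = 0 & vDQ F z = 0].

Definition cutF b Db (F : vfield) : vfield := VField
  (fun z => b z * vP F z) (fun z => b z * vQ F z)
  (fun z => (b z * (vDP F z).1 + vP F z * (Db z).1, b z * (vDP F z).2 + vP F z * (Db z).2))
  (fun z => (b z * (vDQ F z).1 + vQ F z * (Db z).1, b z * (vDQ F z).2 + vQ F z * (Db z).2)).

Lemma cutF_C1 A b Db F : C1_upto A b Db -> C1_field A F -> C1_field A (cutF b Db F).
Proof. by move=> Cb [CP CQ]; split; exact: C1_upto_mul. Qed.

Lemma cutF_vanish b Db F z : vanish F z -> vanish (cutF b Db F) z.
Proof.
by case=> h1 h2 h3 h4; split; rewrite /= ?h1 ?h2 ?h3 ?h4 ?mulr0 ?mul0r ?addr0.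
Qed.

Lemma cutF_vanish0 b Db F z : b z = 0 -> Db z = 0 -> vanish (cutF b Db F) z.
Proof. by move=> h1 h2; split; rewrite /= ?h1 ?h2 ?mulr0 ?mul0r ?addr0. Qed.

Definition cob b z : R := 1 - b z.
Definition coDb Db z : R * R := 0 - Db z.

Lemma cob_C1 A b Db : C1_upto A b Db -> C1_upto A (cob b) (coDb Db).
Proof. by move=> Cb; exact: (C1_upto_sub (C1_upto_cst A 1) Cb). Qed.

Lemma divF_cut b Db F z :
  divF (cutF b Db F) z = b z * divF F z + (vP F z * (Db z).1 + vQ F z * (Db z).2).
Proof. by rewrite /divF /=; ring. Qed.

Lemma divF_continuous A F : C1_field A F -> {within closure A, continuous (divF F)}.
Proof.
by move=> [[[_ cP] _] [[_ cQ] _]]; apply: continuousD_within;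
  [exact: continuous_fst_within|exact: continuous_snd_within].
Qed.

Lemma flux_scale (s sigma p q : R) (n v : R * R) : s *: n = sigma *: (v.2, - v.1) ->
  s * (p * n.1 + q * n.2) = sigma * (p * v.2 - q * v.1).
Proof.
case: n v => [n1 n2] [v1 v2] /= -[h1 h2].
have -> : s * (p * n1 + q * n2) = p * (s *: n1) + q * (s *: n2) by rewrite /GRing.scale/=; ring.
by rewrite h1 h2 /GRing.scale/=; ring.
Qed.

End Fields.

(** * The divergence theorem on piecewise C^1 domains *)

Section Global.
Variable R : realType.
Local Notation mu := (@lebesgue_measure R).
Variables (A : set (R * R)) (I : finType) (T : I -> R) (c nu : I -> R -> R * R).
Hypothesis dom : piecewise_C1_domain A T c nu.
Local Notation K := (closure A).

Lemma dom_open : open A. Proof. exact: pcd_open dom. Qed.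
Lemma dom_bounded : bounded_set A. Proof. exact: pcd_bounded dom. Qed.
Lemma dom_sub : A `<=` K. Proof. exact: subset_closure. Qed.

Lemma dom_compact : compact K.
Proof.
have [M M0 AM] := bounded_box dom_bounded.
apply: (@subclosed_compact _ K (crect (- M) M (- M) M)).
- exact: closed_closure.
- exact: crect_compact.
have cl : closed (crect (- M) M (- M) M).
  by apply: compact_closed; [exact: norm_hausdorff|exact: crect_compact].
rewrite [X in _ `<=` X]((closure_id _).1 cl); apply: closure_subset => z /AM[? ?].
by split; exact: subset_itv_oo_cc.
Qed.

Lemma arc_boundary i t : 0 <= t <= T i -> K (c i t) /\ ~ A (c i t).
Proof.
move=> tT; have : (K `\` A) (c i t).
  by rewrite (pcd_boundary dom); exists i => //; exists t.
by case.
Qed.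

Lemma boundary_arc z : K z -> ~ A z -> exists i t, 0 <= t <= T i /\ z = c i t.
Proof.
move=> Kz nA; have : (K `\` A) z by split.
by rewrite (pcd_boundary dom) => -[i _ [t tT <-]]; exists i, t.
Qed.

Lemma arc_continuous i : continuous (c i).
Proof.
have [d1 d2 _ _] := C1_curve_derive (pcd_C1 dom i).
have -> : c i = (fun t => ((c i t).1, (c i t).2)) by apply/funext => t; case: (c i t).
move=> t; apply: (@cvg_pair _ _ _ (nbhs t) (nbhs (c i t).1) (nbhs (c i t).2)).
  exact: (is_derive_continuous d1 (x:=t)).
exact: (is_derive_continuous d2 (x:=t)).
Qed.

(** The boundary with ]a, b[ removed from the arc i is a finite union of compact images, and it
    misses c i t0 because the arcs are simple and meet at end points only. *)
Lemma near_arc i t0 a b : 0 < t0 < T i -> a < t0 < b ->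
  exists2 r, 0 < r & forall j t, 0 <= t <= T j -> ball (c i t0) r (c j t) -> j = i /\ a < t < b.
Proof.
move=> t0T ab.
pose S j : set R := `[0, T j] `&` (if j == i then ~` `]a, b[ else setT).
have cS j : compact (S j).
  apply: compact_closedI; first exact: segment_compact.
  by case: ifP => _; [apply: open_closedC; exact: interval_open|exact: closedT].
have nS : \forall z \near c i t0, forall j, ~ (c j @` S j) z.
  apply: (@filter_forall _ I _ (nbhs (c i t0))) => j.
  apply: (@open_nbhs_nbhs _ _ (~` (c j @` S j))); split.
    apply: closed_openC; apply: compact_closed; first exact: norm_hausdorff.
    by apply: continuous_compact => //; apply: continuous_subspaceT; exact: arc_continuous.
  move=> [t [tT St] ct]; have {}tT : 0 <= t <= T j by move: tT; rewrite /= in_itv.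
  have t0T' : 0 <= t0 <= T i by case/andP: t0T => /ltW -> /ltW ->.
  have [ji|ji] := eqVneq j i.
    move: St; rewrite ji eqxx => St; apply: St; rewrite /= in_itv/=.
    by rewrite -ji in t0T' ct *; rewrite (pcd_simple dom tT t0T').
  have [_ [h|h]] := pcd_meet dom ji tT t0T' ct; by move: t0T; rewrite h ltxx ?andbF.
have /nbhs_ballP[r /= r0 Hr] := nS.
exists r => // j t tT /Hr H; have {}H := H j.
have nSt : ~ S j t by move=> St; apply: H; exists t.
have [ji|ji] := eqVneq j i; last first.
  by exfalso; apply: nSt; split; rewrite ?(negbTE ji)//= in_itv.
split => //; apply: contrapT => nab; apply: nSt; split; first by rewrite /= in_itv.
by rewrite ji eqxx => /=; rewrite in_itv.
Qed.

Definition flux_density (F : vfield R) (i : I) (t : R) : R :=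
  speed (c i) t * (vP F (c i t) * (nu i t).1 + vQ F (c i t) * (nu i t).2).

Lemma flux_density_cut b Db F i t :
  flux_density (cutF b Db F) i t = b (c i t) * flux_density F i t.
Proof. by rewrite /flux_density /=; ring. Qed.

Definition bflux (F : vfield R) (i : I) : R := \int[mu]_(t in `]0, T i[) flux_density F i t.

Definition DT (F : vfield R) : Prop :=
  \int[leb2 R]_(z in A) divF F z = \sum_i bflux F i.

Lemma arc_chart i t0 : 0 < t0 < T i -> exists a' b' r sigma,
  [/\ a' < t0 < b', 0 < r,
    (forall t, a' < t < b' ->
      speed (c i) t *: nu i t = sigma *: ((velocity (c i) t).2, - (velocity (c i) t).1)) &
    forall F, C1_field A F -> (forall z, K z -> ~ ball (c i t0) r z -> vanish F z) -> DT F].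
Proof.
move=> t0T; have t0T' : 0 <= t0 <= T i by case/andP: t0T => /ltW -> /ltW ->.
have loc a' b' : a' < t0 < b' -> exists2 r, 0 < r & forall z, K z -> ~ A z ->
    ball (c i t0) r z -> exists2 t, a' < t < b' & z = c i t.
  move=> /(near_arc t0T)[r r0 Hr]; exists r => // z Kz nA bz.
  have [j [t [tT zE]]] := boundary_arc Kz nA.
  move: bz; rewrite zE => /(Hr _ _ tT)[ji tab]; subst j.
  by exists t.
have bd t : 0 < t < T i -> K (c i t) /\ ~ A (c i t).
  by move=> tT; apply: arc_boundary; case/andP: tT => /ltW -> /ltW ->.
have v0 := pcd_regular dom t0T'.
have [a' [b' [r [sigma [ha hb r0 Hn HD]]]]] := local_divergence dom_open dom_bounded
  dom_compact (pcd_C1 dom i) t0T loc bd (pcd_normal dom (i := i)) v0.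
have /andP[ha1 ha2] := ha; have /andP[hb1 hb2] := hb.
have ab : a' < t0 < b' by rewrite ha2 hb1.
have [r' r'0 Hr'] := near_arc t0T ab.
(* Within r the local theorem holds; within r' there is no boundary except the piece ]a', b'[ of arc
   i, so the sum of all boundary fluxes reduces to the integral over that piece. *)
exists a', b', (Num.min r r'), sigma; split => //; first by rewrite lt_min r0 r'0.
move=> F [CP CQ] V.
have far z : K z -> ~ ball (c i t0) r z \/ ~ ball (c i t0) r' z -> vanish F z.
  move=> Kz nb; apply: V => // b; case: nb; apply; apply: le_ball b.
    by rewrite ge_min lexx.
  by rewrite ge_min lexx orbT.
rewrite /DT (HD _ _ _ _ CP CQ); last by move=> z Kz nb; apply: far => //; left.
rewrite (bigD1 i)//= big1 ?addr0; last first.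
  move=> j ji; apply: Rintegral_eq0 => t; rewrite /= in_itv/= => /andP[t1 t2].
  have tT : 0 <= t <= T j by rewrite !ltW.
  have [|p q _ _] := far (c j t) (arc_boundary tT).1.
    by right => /(Hr' _ _ tT)[/eqP]; rewrite (negbTE ji).
  by rewrite /flux_density p q !mul0r addr0 mulr0.
rewrite /bflux [LHS]Rintegral_mkcond [RHS]Rintegral_mkcond; apply: eq_Rintegral => t _.
rewrite !patchE; case: ifPn => tab; case: ifPn => tT.
- move: tab; rewrite inE/= in_itv/= => tab.
  by rewrite /flux_density (flux_scale _ _ (Hn t tab)).
- exfalso; move/negP: tT; apply; move: tab; rewrite !inE/= !in_itv/= => /andP[h1 h2].
  by rewrite (lt_trans ha1 h1) (lt_trans h2 hb2).
- move: tT; rewrite inE/= in_itv/= => /andP[t1 t2].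
  have tT : 0 <= t <= T i by rewrite !ltW.
  have [|p q _ _] := far (c i t) (arc_boundary tT).1.
    right => /(Hr' _ _ tT)[_ tab']; move/negP: tab; apply; by rewrite inE/= in_itv.
  by rewrite /flux_density p q !mul0r addr0 mulr0.
- by [].
Qed.


Lemma arc_field_continuous i (f : R * R -> R) : {within K, continuous f} ->
  {within `[0, T i], continuous (fun t => f (c i t))}.
Proof.
move=> cf; apply: (within_continuous_comp (K := K)) => //.
  by apply: continuous_subspaceT; exact: arc_continuous.
by move=> t; rewrite /= in_itv/= => /(arc_boundary (i:=i))[].
Qed.

Lemma speed_continuous i : continuous (speed (c i)).
Proof.
have [_ _ c1 c2] := C1_curve_derive (pcd_C1 dom i).
move=> t; apply: (@continuous_comp _ _ _ (fun t => dotp (velocity (c i) t) (velocity (c i) t)) Num.sqrt).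
  by apply: cvgD; apply: cvgM; [exact: c1|exact: c1|exact: c2|exact: c2].
exact: sqrt_continuous.
Qed.

(** The function [nu] is not assumed continuous, but in a chart the product of speed and normal is a
    constant multiple of the rotated velocity, which is. *)
Lemma flux_density_continuous F i : C1_field A F ->
  {in `]0, T i[%classic, continuous (flux_density F i)}.
Proof.
move=> [[_ cP] [_ cQ]] t0; rewrite inE/= in_itv/= => t0T.
have [a' [b' [r [sigma [/andP[ha hb] r0 Hn _]]]]] := arc_chart t0T.
have [_ _ c1 c2] := C1_curve_derive (pcd_C1 dom i).
have ci (f : R * R -> R) : {within K, continuous f} -> {for t0, continuous (fun t => f (c i t))}.
  move=> /arc_field_continuous => /(_ i) cf.
  have : {in `]0, T i[%classic, continuous (fun t => f (c i t))}.
    rewrite -continuous_open_subspace; last exact: interval_open.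
    by apply: continuous_subspaceW cf; exact: subset_itv_oo_cc.
  by apply; rewrite inE/= in_itv.
have E : \forall t \near t0, sigma * (vP F (c i t) * (velocity (c i) t).2 - vQ F (c i t) * (velocity (c i) t).1) = flux_density F i t.
  near=> t; rewrite /flux_density (flux_scale _ _ (Hn t _))//.
  by apply/andP; split; near: t; [exact: lt_nbhsr|exact: lt_nbhsl].
have C : {for t0, continuous (fun t => sigma * (vP F (c i t) * (velocity (c i) t).2 - vQ F (c i t) * (velocity (c i) t).1))}.
  apply: cvgM; first exact: cvg_cst.
  by apply: cvgB; apply: cvgM; [exact: ci|exact: c2|exact: ci|exact: c1].
rewrite /continuous_at -(nbhs_singleton E).
exact: cvg_trans (near_eq_cvg E) C.
Unshelve. all: by end_near.
Qed.

(** Continuity is known on the open arc only, where the normal is prescribed; integrability up to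
    the ends comes from boundedness, a unit vector having components at most 1. *)
Lemma flux_integrable F i : C1_field A F ->
  mu.-integrable `]0, T i[ (EFin \o flux_density F i).
Proof.
move=> CF; have [[_ cP] [_ cQ]] := CF.
have T0 := pcd_len dom i.
have bd (f : R -> R) : {within `[0, T i], continuous f} ->
    exists2 M, 0 <= M & forall t, 0 < t < T i -> `|f t| <= M.
  move=> cf; have cnf : {within `[0, T i], continuous (fun t => `|f t|)}.
    by move=> z; apply: continuous_comp; [exact: cf|exact: norm_continuous].
  have [t0 _ H] := EVT_max (ltW T0) cnf.
  by exists `|f t0| => // t /andP[h1 h2]; apply: H; rewrite in_itv/= !ltW.
have [M1 M10 H1] := bd _ (@arc_field_continuous i _ cP).
have [M2 M20 H2] := bd _ (@arc_field_continuous i _ cQ).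
have [M3 M30 H3] := bd _ (continuous_subspaceT (@speed_continuous i)).
apply: measurable_bounded_integrable => //.
- have := @lebesgue_measure_itv R `]0, T i[; rewrite /= lte_fin ifT; last exact: T0.
  by move=> ->; rewrite -EFinD ltry.
- apply: open_continuous_measurable_fun; first exact: interval_open.
  exact: flux_density_continuous.
exists (M3 * (M1 + M2)); split; first exact: num_real.
move=> N MN t; rewrite /= in_itv/= => tT; apply: le_trans (ltW MN).
have [n1 _ _ _] := pcd_normal dom tT.
have nu1 : `|(nu i t).1| <= 1 /\ `|(nu i t).2| <= 1.
  move: n1; rewrite /dotp -!expr2 -(real_normK (num_real (nu i t).1)) -(real_normK (num_real (nu i t).2)).
  by have := normr_ge0 (nu i t).1; have := normr_ge0 (nu i t).2; split; nra.
rewrite /flux_density normrM; apply: ler_pM => //; first exact: H3.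
apply: le_trans (ler_normD _ _) _; rewrite !normrM; apply: lerD.
  by rewrite -[M1]mulr1; apply: ler_pM => //; [exact: H1|exact: nu1.1].
by rewrite -[M2]mulr1; apply: ler_pM => //; [exact: H2|exact: nu1.2].
Qed.

Lemma divF_integrable F : C1_field A F -> (leb2 R).-integrable A (EFin \o divF F).
Proof.
move=> CF; apply: (@continuous_integrable2 _ _ K) => //.
- exact: dom_open. - exact: dom_sub. - exact: dom_compact. - exact: divF_continuous.
Qed.

Lemma integral_split b Db F : C1_upto A b Db -> C1_field A F ->
  \int[leb2 R]_(z in A) divF F z =
  \int[leb2 R]_(z in A) divF (cutF b Db F) z + \int[leb2 R]_(z in A) divF (cutF (cob b) (coDb Db) F) z.
Proof.
move=> Cb CF; rewrite -RintegralD; first last.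
- by apply: divF_integrable; apply: cutF_C1 => //; exact: cob_C1.
- by apply: divF_integrable; exact: cutF_C1.
- exact: open_measurable2 dom_open.
by apply: eq_Rintegral => z _; rewrite !divF_cut /cob /coDb /=; ring.
Qed.

Lemma bflux_split b Db F i : C1_upto A b Db -> C1_field A F ->
  bflux F i = bflux (cutF b Db F) i + bflux (cutF (cob b) (coDb Db) F) i.
Proof.
move=> Cb CF; rewrite /bflux -RintegralD//; first last.
- by apply: flux_integrable; apply: cutF_C1 => //; exact: cob_C1.
- by apply: flux_integrable; exact: cutF_C1.
by apply: eq_Rintegral => t _; rewrite /flux_density /cutF /cob /=; ring.
Qed.

Lemma DT_split b Db F : C1_upto A b Db -> C1_field A F ->
  DT (cutF b Db F) -> DT (cutF (cob b) (coDb Db) F) -> DT F.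
Proof.
move=> Cb CF h1 h2; rewrite /DT (integral_split Cb CF) h1 h2 -big_split/=.
by apply: eq_bigr => i _; rewrite -bflux_split.
Qed.

Lemma DT_vanish F : (forall z, K z -> vanish F z) -> DT F.
Proof.
move=> V; rewrite /DT Rintegral_eq0; last first.
  by move=> z /dom_sub/V[_ _ h3 h4]; rewrite /divF h3 h4 addr0.
rewrite big1// => i _; apply: Rintegral_eq0 => t; rewrite /= in_itv/= => /andP[h1 h2].
have /arc_boundary[Kc _] : 0 <= t <= T i by rewrite !ltW.
by have [p q _ _] := V _ Kc; rewrite /flux_density p q !mul0r addr0 mulr0.
Qed.

Definition good (p : R * R) (r : R) : Prop :=
  forall F, C1_field A F -> (forall z, K z -> ~ ball p r z -> vanish F z) -> DT F.

Lemma DT_cover (L : seq (R * R * R)) F : C1_field A F ->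
  (forall u, u \in L -> 0 < u.2 /\
     (good u.1 u.2 \/ forall z, K z -> ball u.1 (u.2 / 2) z -> vanish F z)) ->
  (forall z, K z -> vanish F z \/ exists2 u, u \in L & ball u.1 (u.2 / 2) z) -> DT F.
Proof.
elim: L F => [|[p r] L IH] F CF HL HF.
  by apply: DT_vanish => z /HF[|[]].
have [r0 [gd|V]] := HL _ (mem_head _ _); last first.
  apply: IH => // [u uL|z Kz]; first by apply: HL; rewrite inE uL orbT.
  have [|[u]] := HF z Kz; first by left.
  by rewrite inE => /predU1P[->|uL] bz; [left; exact: V|right; exists u].
have Cb := bump_C1 A p r.
apply: (DT_split Cb CF).
  apply: gd; first exact: cutF_C1.
  by move=> z _ /(bump_eq0 r0)[h1 h2]; exact: cutF_vanish0.
have Vb z : ball p (r / 2) z -> vanish (cutF (cob (bump p r)) (coDb (dbump p r)) F) z.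
  by move=> /(bump_eq1 r0)[h1 h2]; apply: cutF_vanish0; rewrite /cob /coDb ?h1 ?h2 ?subrr ?subr0.
apply: IH.
- by apply: cutF_C1 => //; exact: cob_C1.
- move=> u uL; have [|u0 [g|V]] := HL u; first by rewrite inE uL orbT.
    by split => //; left.
  by split => //; right => z Kz bz; apply: cutF_vanish; exact: V.
- move=> z Kz; have [V|[u]] := HF z Kz; first by left; exact: cutF_vanish.
  by rewrite inE => /predU1P[->|uL] bz; [left; exact: Vb|right; exists u].
Qed.

Definition corner (z : R * R) : Prop := exists i, z = c i 0 \/ z = c i (T i).

Lemma interior_good p : A p -> exists2 r, 0 < r & good p r.
Proof.
move=> Ap; have [r r0 Hr] := interior_divergence dom_open dom_bounded dom_compact Ap.
have /nbhs_ballP[e /= e0 He] : nbhs p A by apply: open_nbhs_nbhs; split => //; exact: dom_open.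
exists (Num.min r e); first by rewrite lt_min r0 e0.
move=> F [CP CQ] V; rewrite /DT -[LHS]/(\int[leb2 R]_(z in A) ((vDP F z).1 + (vDQ F z).2)).
rewrite (Hr _ _ _ _ CP CQ); last first.
  by move=> z Kz nb; apply: V => // b; apply: nb; apply: le_ball b; rewrite ge_min lexx.
rewrite big1// => i _; apply: Rintegral_eq0 => t; rewrite /= in_itv/= => /andP[h1 h2].
have /arc_boundary[Kc nA] : 0 <= t <= T i by rewrite !ltW.
have [|p' q' _ _] := V _ Kc; last by rewrite /flux_density p' q' !mul0r addr0 mulr0.
by move=> b; apply: nA; apply: He; apply: le_ball b; rewrite ge_min lexx orbT.
Qed.

Lemma boundary_good p : K p -> ~ corner p -> exists2 r, 0 < r & good p r.
Proof.
move=> Kp nc; have [Ap|nA] := pselect (A p); first exact: interior_good.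
have [i [t [tT pE]]] := boundary_arc Kp nA.
have tT' : 0 < t < T i.
  case/andP: tT; rewrite !le_eqVlt => /predU1P[t0|->] /predU1P[t1|->] //; exfalso; apply: nc; exists i.
  - by left; rewrite pE t0.
  - by left; rewrite pE t0.
  - by right; rewrite pE t1.
have [a' [b' [r [s [_ r0 _ H]]]]] := arc_chart tT'.
by exists r => //; rewrite pE.
Qed.

Lemma DT_off_corners F : C1_field A F ->
  (forall q, corner q -> exists2 r, 0 < r & forall z, K z -> ball q r z -> vanish F z) -> DT F.
Proof.
move=> CF HF.
pose D : set (R * R * R) := [set u | 0 < u.2 /\
  (good u.1 u.2 \/ forall z, K z -> ball u.1 (u.2 / 2) z -> vanish F z)].
have cov : K `<=` cover D (fun u => (ball u.1 (u.2 / 2))°).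
  move=> p Kp; have [cp|ncp] := pselect (corner p).
    (* The radius is doubled because covers are formed with balls of half the recorded radius. *)
    have [r r0 V] := HF p cp; exists (p, r + r) => /=; first split => //=.
    - by rewrite addr_gt0.
    - by right => z Kz; rewrite (_ : (r + r) / 2 = r); [exact: V|lra].
    - by apply: nbhsx_ballx; rewrite divr_gt0// addr_gt0.
  have [r r0 g] := boundary_good Kp ncp; exists (p, r) => /=; first by split => //; left.
  by apply: nbhsx_ballx; rewrite divr_gt0.
have [|L LD covL] := compact_cover_plane dom_compact _ cov; first by move=> u _; exact: open_interior.
apply: (@DT_cover (finmap.enum_fset L)) => //.
- by move=> u uL; have := LD u uL; rewrite inE.
- move=> z Kz; right; have [u uL /interior_subset bz] := covL z Kz.
  by exists u.
Qed.

Lemma small_support_integral p r (h : R * R -> R) C : {within K, continuous h} -> 0 < r ->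
  0 <= C -> (forall z, A z -> `|h z| <= C) -> (forall z, A z -> ~ ball p r z -> h z = 0) ->
  `|\int[leb2 R]_(z in A) h z| <= C * (4 * r ^+ 2).
Proof.
move=> ch r0 C0 hC h0.
pose B : set (R * R) := orect (p.1 - r) (p.1 + r) (p.2 - r) (p.2 + r).
have nB z : ~ B z -> ~ ball p r z.
  move=> nB; apply: contra_not nB => -[]; rewrite /ball/= distrC => b1; rewrite distrC => b2.
  by split; rewrite /= in_itv/= -ltr_distl.
have mA : measurable A by exact: open_measurable2 dom_open.
have mB : measurable B by exact: orect_measurable.
have mAB : measurable (A `&` B) by exact: measurableI.
have Ih : (leb2 R).-integrable A (EFin \o h).
  by apply: (@continuous_integrable2 _ _ K) => //; [exact: dom_open|exact: dom_sub|exact: dom_compact].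
have IhB : (leb2 R).-integrable (A `&` B) (EFin \o h) by apply: integrableS Ih => //; exact: subIsetl.
have -> : \int[leb2 R]_(z in A) h z = \int[leb2 R]_(z in A `&` B) h z.
  rewrite Rintegral_mkcondr; apply: eq_Rintegral => z; rewrite inE => Az.
  by rewrite patchE; case: ifPn => //; rewrite notin_setE => /nB; exact: h0.
have bAB : bounded_set (A `&` B).
  have [N [Nr HN]] := dom_bounded; exists N; split => // x /HN H z [Az _]; exact: H.
have fAB : (leb2 R (A `&` B) < +oo)%E by exact: bounded_measure2.
apply: (@le_trans _ _ (\int[leb2 R]_(z in A `&` B) `|h z|)).
  exact: (@le_normr_Rintegral _ _ _ (leb2 R)).
apply: (@le_trans _ _ (\int[leb2 R]_(z in A `&` B) C)).
  apply: le_Rintegral => //.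
  - by have := integrable_norm IhB.
  - apply: measurable_bounded_integrable => //.
    by exists `|C|; split; [exact: num_real|move=> N CN z _; exact: ltW].
  - by move=> z [/hC].
rewrite Rintegral_cst//; apply: ler_wpM2l => //.
rewrite -lee_fin fineK ?ge0_fin_numE//.
apply: (@le_trans _ _ (leb2 R B)); first by apply: le_measure; rewrite ?inE//; exact: subIsetr.
rewrite /B /orect product_measure1E//.
have L (a : R) : lebesgue_measure (`]a - r, a + r[%classic : set R) = (2 * r)%:E.
  have := @lebesgue_measure_itv R `]a - r, a + r[; rewrite /= lte_fin ifT; last by lra.
  by move=> ->; rewrite -EFinD; congr (_%:E); ring.
have := L p.1; have := L p.2; rewrite /= => -> ->; rewrite -EFinM lee_fin; lra.
Qed.

Lemma corner_arc p i t : corner p -> 0 < t < T i -> c i t != p.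
Proof.
move=> [j pj] t0T; apply/eqP => cp.
have tT : 0 <= t <= T i by case/andP: t0T => /ltW -> /ltW ->.
have [s [sT sE pE]] : exists s, [/\ 0 <= s <= T j, s = 0 \/ s = T j & p = c j s].
  have T0 := ltW (pcd_len dom j).
  by case: pj => ->; [exists 0|exists (T j)]; split => //; rewrite ?lexx ?T0//; [left|right].
rewrite pE in cp; have [ij|ij] := eqVneq i j; last first.
  by have [[h|h] _] := pcd_meet dom ij tT sT cp; move: t0T; rewrite h ltxx ?andbF.
move: sT sE cp; rewrite -ij => sT sE /(pcd_simple dom tT sT) ts.
by case: sE => h; move: t0T; rewrite ts h ltxx ?andbF.
Qed.

(** Dominated convergence: no interior point of an arc is a corner, so the cut density is eventually
    0 at each of them, and it is dominated by the uncut one. *)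
Lemma corner_flux_cvg p i F : C1_field A F -> corner p ->
  bflux (cutF (bump p n.+1%:R^-1) (dbump p n.+1%:R^-1) F) i @[n --> \oo] --> (0 : R).
Proof.
move=> CF cp.
have IF := flux_integrable i CF.
have mT : measurable (`]0, T i[%classic : set R) by [].
have Fn n : C1_field A (cutF (bump p n.+1%:R^-1) (dbump p n.+1%:R^-1) F).
  by apply: cutF_C1 => //; exact: bump_C1.
have H := @dominated_cvg _ _ _ mu _ mT
  (fun n t => (flux_density (cutF (bump p n.+1%:R^-1) (dbump p n.+1%:R^-1) F) i t)%:E)
  (fun=> 0%E) (fun t => `|flux_density F i t|%:E).
rewrite (_ : (fun n => _) = fine \o (fun n => \int[mu]_(t in `]0%R, T i[)
   (flux_density (cutF (bump p n.+1%:R^-1) (dbump p n.+1%:R^-1) F) i t)%:E)%E)//.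
apply: fine_cvg; rewrite -[X in _ --> X](@integral0 _ _ _ mu `]0, T i[%classic); apply: H => //.
- by move=> n; have /integrableP[] := flux_integrable i (Fn n).
- move=> t; rewrite /= in_itv/= => tT.
  have e0 : 0 < `|p - c i t| by rewrite normr_gt0 subr_eq0 eq_sym; exact: corner_arc.
  apply: cvg_near_cst; near=> n.
  have nb : ~ ball p n.+1%:R^-1 (c i t).
    rewrite -ball_normE /= => /lt_trans H'.
    have : n.+1%:R^-1 < `|p - c i t| by near: n; exact: (near_infty_natSinv_lt (PosNum e0)).
    by move=> /H'; rewrite ltxx.
  have [|h1 h2] := bump_eq0 _ nb; first by rewrite invr_gt0.
  by rewrite /flux_density /= h1 !mul0r addr0 mulr0.
- by have := integrable_norm IF.
- move=> n t _; rewrite lee_fin flux_density_cut normrM.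
  by rewrite ger0_norm ?bump_ge0// ler_piMl// bump_le1.
Unshelve. all: by end_near. Qed.

(* The gradient of the cut-off is O(1/r) on a set of measure O(r^2). *)
Lemma corner_integral_cvg p F : C1_field A F ->
  \int[leb2 R]_(z in A) divF (cutF (bump p n.+1%:R^-1) (dbump p n.+1%:R^-1) F) z
    @[n --> \oo] --> (0 : R).
Proof.
move=> CF; have [[_ cP] [_ cQ]] := CF.
pose r n : R := n.+1%:R^-1.
have r0 n : 0 < r n by rewrite invr_gt0.
have r1 n : r n <= 1 by rewrite invf_le1// ler1n.
have [M1 M10 H1] := within_bounded dom_compact cP.
have [M2 M20 H2] := within_bounded dom_compact cQ.
have [M3 M30 H3] := within_bounded dom_compact (divF_continuous CF).
pose k := 4 * M3 + 128 * (M1 + M2).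
have cr : (k * r n : R) @[n --> \oo] --> (0 : R).
  by rewrite -[X in _ --> X](mulr0 k); apply: cvgMr; exact: cvg_harmonic.
have bnd n : `|\int[leb2 R]_(z in A) divF (cutF (bump p (r n)) (dbump p (r n)) F) z| <= k * r n.
  have Fn : C1_field A (cutF (bump p (r n)) (dbump p (r n)) F).
    by apply: cutF_C1 => //; exact: bump_C1.
  apply: (@le_trans _ _ ((M3 + (M1 + M2) * (32 / r n)) * (4 * r n ^+ 2))).
    apply: (@small_support_integral p) => //.
    - exact: divF_continuous.
    - by rewrite addr_ge0// mulr_ge0// ?addr_ge0// divr_ge0// ltW.
    - move=> z /dom_sub Kz; have [d1 d2] := dbump_le p z (r0 n).
      rewrite divF_cut; apply: (le_trans (ler_normD _ _)); apply: lerD.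
        rewrite normrM -[M3]mul1r; apply: ler_pM => //; last exact: H3.
        by rewrite ger0_norm ?bump_ge0// bump_le1.
      apply: (le_trans (ler_normD _ _)); rewrite [X in X + _]normrM [X in _ + X]normrM mulrDl.
      by apply: lerD; apply: ler_pM => //; [exact: H1|exact: H2].
    - move=> z _ /(bump_eq0 (r0 n))[h1 h2].
      by have [_ _ q1 q2] := cutF_vanish0 F h1 h2; rewrite /divF q1 q2 addr0.
  have -> : (M3 + (M1 + M2) * (32 / r n)) * (4 * r n ^+ 2) =
      4 * M3 * r n * r n + 128 * (M1 + M2) * r n.
    by field; rewrite gt_eqF.
  by rewrite /k [leRHS]mulrDl lerD2r ler_piMr//; apply: mulr_ge0; [exact: mulr_ge0|exact: ltW].
apply: (@squeeze_cvgr _ _ _ _ (fun n => - (k * r n)) (fun n => k * r n)) => //.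
  by near=> n; have := bnd n; rewrite ler_norml.
by rewrite -oppr0; exact: cvgN.
Unshelve. all: by end_near. Qed.

(** The list l holds the corners near which the field need not vanish. Removing a shrinking
    neighbourhood of one of them gives a field covered by induction. *)
Lemma DT_corners (l : seq (R * R)) F : C1_field A F ->
  (forall q, corner q -> q \notin l ->
     exists2 r, 0 < r & forall z, K z -> ball q r z -> vanish F z) -> DT F.
Proof.
elim: l F => [|p l IH] F CF HF; first by apply: DT_off_corners => // q cq; exact: HF.
have [cp|ncp] := pselect (corner p); last first.
  apply: IH => // q cq ql; apply: HF => //; rewrite inE negb_or ql andbT.
  by apply/eqP => qp; apply: ncp; rewrite -qp.
pose r n : R := n.+1%:R^-1.
have r0 n : 0 < r n by rewrite invr_gt0.
pose b n := bump p (r n); pose Db n := dbump p (r n).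
have Cb n : C1_upto A (b n) (Db n) by exact: bump_C1.
have DTn n : DT (cutF (cob (b n)) (coDb (Db n)) F).
  apply: IH; first by apply: cutF_C1 => //; exact: cob_C1.
  move=> q cq ql; have [->|qp] := eqVneq q p.
    exists (r n / 2); first by rewrite divr_gt0.
    move=> z Kz /(bump_eq1 (r0 n))[h1 h2].
    by apply: cutF_vanish0; rewrite /cob /coDb /b /Db ?h1 ?h2 ?subrr ?subr0.
  have [|e e0 V] := HF q cq; first by rewrite inE negb_or qp.
  by exists e => // z Kz bz; apply: cutF_vanish; exact: V.
pose u n := \int[leb2 R]_(z in A) divF (cutF (b n) (Db n) F) z.
pose v n i := bflux (cutF (b n) (Db n) F) i.
(* The defect of the theorem does not depend on n, while its expression through the removed piece
   tends to 0. *)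
pose E := \int[leb2 R]_(z in A) divF F z - \sum_i bflux F i.
have EE n : E = u n - \sum_i v n i.
  rewrite /E (integral_split (Cb n) CF) (DTn n).
  under [X in _ - X = _]eq_bigr do rewrite (bflux_split _ (Cb n) CF).
  by rewrite big_split/= -/(u n) -/(v n); ring.
have cv : (\sum_i v n i) @[n --> \oo] --> (\sum_(i : I) 0 : R).
  apply: cvg_big; last by move=> i _; exact: corner_flux_cvg.
  exact: add_continuous.
have : (u n - \sum_i v n i) @[n --> \oo] --> (0 - \sum_(i : I) 0 : R).
  by apply: cvgB => //; exact: corner_integral_cvg.
rewrite big1// subr0 (_ : (fun n => _) = (fun=> E)); last by apply/funext => n; rewrite -EE.
move=> cE; have : E = 0 by apply: (cvg_unique (@Rhausdorff R) _ cE); exact: cvg_cst.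
by rewrite /E /DT => /eqP; rewrite subr_eq0 => /eqP.
Qed.

Theorem divergence_theorem F : C1_field A F ->
  \int[leb2 R]_(z in A) divF F z = \sum_i bflux F i.
Proof.
move=> CF; apply: (@DT_corners (flatten [seq [:: c i 0; c i (T i)] | i <- enum I])) => //.
move=> q [i qi]; move=> /negP; case; apply/flattenP; exists [:: c i 0; c i (T i)].
  by apply/mapP; exists i => //; rewrite mem_enum.
by rewrite !inE; case: qi => ->; rewrite eqxx ?orbT.
Qed.

End Global.

(** * Green's formula on the porous medium *)

Section Green.
Variable R : realType.
Local Notation mu := (@lebesgue_measure R).
Variable G : geometry R.
Local Notation arc := Defs.arc.
Local Notation A := (Omp G).
Local Notation sg u := (Num.sqrt (detg G (u, 0))).

Lemma div_C1 (B : set (R * R)) D D1 D2 z : C1_upto B (fun z => (D z).1) D1 ->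
  C1_upto B (fun z => (D z).2) D2 -> B z -> div D z = (D1 z).1 + (D2 z).2.
Proof.
by move=> [[H1 _] _] [[H2 _] _] Bz; rewrite /div -(H1 z Bz).2 -(H2 z Bz).2.
Qed.

(** The divergence theorem for chi D: chi vanishes on the well and D has no normal component on
    Gamma_out, so only Gamma_f remains. The minus sign comes from [nf] being the inward normal of
    Omega_p, and the weight is the speed of the arc, which [arclength_f] identifies with the metric
    density. *)
Lemma green (D D1 D2 : R * R -> R * R) chi Dchi :
  C1_upto A (fun z => (D z).1) D1 -> C1_upto A (fun z => (D z).2) D2 ->
  C1_upto A chi Dchi -> (forall z, A z -> div D z = 0) ->
  (forall i t, is_well G i -> 0 <= t <= arc_len G (Some i) -> chi (arc G (Some i) t) = 0) ->
  (forall i t, ~~ is_well G i -> 0 < t < arc_len G (Some i) ->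
    dotp (D (arc G (Some i) t)) (nu G (Some i) t) = 0) ->
  \int[leb2 R]_(z in A) dotp (D z) (Dchi z) =
  - \int[mu]_(u in `]0, L G[) (sg u * (dotp (D (gam G u)) (nf G u) * chi (gam G u))).
Proof.
move=> C1 C2 Cx dv well out.
pose F := VField (fun z => chi z * (D z).1) (fun z => chi z * (D z).2)
  (fun z => (chi z * (D1 z).1 + (D z).1 * (Dchi z).1, chi z * (D1 z).2 + (D z).1 * (Dchi z).2))
  (fun z => (chi z * (D2 z).1 + (D z).2 * (Dchi z).1, chi z * (D2 z).2 + (D z).2 * (Dchi z).2)).
have CF : C1_field A F by split; exact: C1_upto_mul.
have := divergence_theorem (Omp_domain G) CF.
rewrite (bigD1 None)//= big1 ?addr0; last first.
  case=> [i|]// _; apply: Rintegral_eq0 => t; rewrite /= in_itv/= => tT.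
  have tT' : 0 <= t <= arc_len G (Some i) by case/andP: tT => /ltW -> /ltW ->.
  rewrite /flux_density /=; case: (boolP (is_well G i)) => wi.
    by rewrite well// !mul0r addr0 mulr0.
  have := out i t wi tT; rewrite /dotp => o.
  by rewrite -!mulrA -mulrDr o !mulr0.
move=> E; transitivity (\int[leb2 R]_(z in A) divF F z).
  apply: eq_Rintegral => z; rewrite inE => Az; rewrite /divF /=.
  have := dv z Az; rewrite (div_C1 C1 C2 Az) => h.
  rewrite [RHS](_ : _ = chi z * ((D1 z).1 + (D2 z).2) + dotp (D z) (Dchi z)).
    by rewrite h mulr0 add0r.
  by rewrite /dotp; ring.
rewrite E -[LHS]opprK; congr (- _); rewrite -mulN1r /bflux -RintegralZl//; last first.
  exact: (flux_integrable (Omp_domain G) None CF).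
apply: eq_Rintegral => u; rewrite inE/= in_itv/= => uL.
have uL' : 0 <= u <= arc_len G None by case/andP: uL => /ltW -> /ltW ->.
rewrite /flux_density /= /speed (arclength_f uL') /nf /gam /dotp /detg /=.
by ring.
Qed.

(** Positivity gives a lower bound on |Omega| that does not depend on h. The domain is nonempty
    because its closure contains the arc Gamma_f. *)
Lemma Omp_measure : exists2 m : R, 0 < m & leb2 R A = m%:E.
Proof.
have oA := pcd_open (Omp_domain G).
have bA := pcd_bounded (Omp_domain G).
have [p Ap] : A !=set0.
  have : (closure A `\` A) (arc G None 0).
    rewrite (pcd_boundary (Omp_domain G)); exists None => //; exists 0 => //=.
    by rewrite in_itv/= lexx ltW// (pcd_len (Omp_domain G)).
  case=> cA _; apply/set0P/eqP => A0; move: cA; rewrite A0 closure0; exact.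
have fA : leb2 R A \is a fin_num.
  by rewrite ge0_fin_numE// bounded_measure2//; exact: open_measurable2.
exists (fine (leb2 R A)); last by rewrite fineK.
have /nbhs_ballP[e /= e0 He] : nbhs p A by apply: open_nbhs_nbhs; split.
rewrite fine_gt0// -ge0_fin_numE// fA andbT.
pose B := orect (p.1 - e) (p.1 + e) (p.2 - e) (p.2 + e).
apply: (@lt_le_trans _ _ (leb2 R B)); last first.
  apply: le_measure; rewrite ?inE//; [exact: orect_measurable|exact: open_measurable2|].
  move=> z [z1 z2]; apply: He; split; rewrite /ball/= distrC ltr_distl; by move: z1 z2; rewrite /= !in_itv/=.
rewrite /B /orect product_measure1E//.
have L (a : R) : lebesgue_measure (`]a - e, a + e[%classic : set R) = (2 * e)%:E.
  have := @lebesgue_measure_itv R `]a - e, a + e[; rewrite /= lte_fin ifT; last by lra.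
  by move=> ->; rewrite -EFinD; congr (_%:E); ring.
have := L p.1; have := L p.2; rewrite /= => -> ->.
by rewrite -EFinM lte_fin mulr_gt0// mulr_gt0.
Qed.

End Green.

(** * The constitutive law *)

Section Constitutive.
Variable R : realType.
Implicit Types v w : R * R.

Definition enorm v : R := Num.sqrt (v.1 ^+ 2 + v.2 ^+ 2).

Lemma enorm_ge0 v : 0 <= enorm v. Proof. exact: sqrtr_ge0. Qed.

Lemma enorm_sqr v : enorm v ^+ 2 = v.1 ^+ 2 + v.2 ^+ 2.
Proof. by rewrite sqr_sqrtr// addr_ge0// sqr_ge0. Qed.

Lemma le_enorm v : `|v.1| <= enorm v /\ `|v.2| <= enorm v.
Proof.
by split; rewrite -sqrtr_sqr ler_wsqrtr// ?lerDl ?lerDr ?sqr_ge0.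
Qed.

Lemma enormZ (c : R) v : 0 <= c -> enorm (c *: v) = c * enorm v.
Proof.
move=> c0; rewrite /enorm /= -[in RHS](ger0_norm c0) -sqrtr_sqr -sqrtrM ?sqr_ge0//.
by congr Num.sqrt; rewrite /GRing.scale/=; ring.
Qed.

Lemma cauchy_schwarz v w : dotp v w <= enorm v * enorm w.
Proof.
apply: le_trans (ler_norm _) _; rewrite /enorm -sqrtr_sqr -sqrtrM; last first.
  by rewrite addr_ge0// sqr_ge0.
rewrite ler_wsqrtr// /dotp; case: v w => [a b] [c d] /=.
by have := sqr_ge0 (a * d - b * c); nra.
Qed.

Lemma enormD v w : enorm (v + w) <= enorm v + enorm w.
Proof.
rewrite -(ler_pXn2r (n := 2))// ?nnegrE ?addr_ge0 ?enorm_ge0//.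
rewrite sqrrD !enorm_sqr; have := cauchy_schwarz v w; rewrite /dotp /=; nra.
Qed.

Lemma enormN v : enorm (- v) = enorm v.
Proof. by rewrite /enorm /= !sqrrN. Qed.

Lemma enorm_dist v w : `|enorm v - enorm w| <= enorm (v - w).
Proof.
rewrite ler_norml; apply/andP; split.
  rewrite lerNl opprB lerBlDr; have := enormD (w - v) v.
  by rewrite subrK -(enormN (w - v)) opprB.
by rewrite lerBlDr; have := enormD (v - w) w; rewrite subrK.
Qed.

Lemma young_quadratic (a x t : R) : 0 < a -> x * t <= a * t ^+ 2 + x ^+ 2 / (4 * a).
Proof.
move=> a0; rewrite -subr_ge0.
have -> : a * t ^+ 2 + x ^+ 2 / (4 * a) - x * t = (2 * a * t - x) ^+ 2 / (4 * a).
  by field; rewrite gt_eqF.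
by rewrite divr_ge0 ?sqr_ge0// mulr_ge0// ltW.
Qed.

Lemma young_cubic (x t : R) : 0 <= x -> 0 <= t -> x * t ^+ 2 <= t ^+ 3 / 2 + 4 * x ^+ 3.
Proof.
move=> x0 t0; have [xt|xt] := leP (2 * x) t.
  have h : 0 <= t ^+ 2 * (t - 2 * x) by rewrite mulr_ge0 ?sqr_ge0// subr_ge0.
  have x3 : 0 <= x ^+ 3 by rewrite exprn_ge0.
  by move: h; rewrite !exprS !expr0 mulr1 in x3 *; nra.
have t2 : t ^+ 2 <= (2 * x) ^+ 2 by rewrite ler_pXn2r ?nnegrE ?mulr_ge0// ltW.
have t3 : 0 <= t ^+ 3 by rewrite exprn_ge0.
have : x * t ^+ 2 <= x * (2 * x) ^+ 2 by exact: ler_wpM2l.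
by rewrite (_ : x * (2 * x) ^+ 2 = 4 * x ^+ 3); [lra|ring].
Qed.

Variables alpha beta : R.
Hypotheses (alpha_gt0 : 0 < alpha) (beta_ge0 : 0 <= beta).
Local Notation f := (fbeta alpha beta).

Definition flx v : R * R := f (enorm v) *: v.

Lemma fbeta_den s : 0 <= s -> alpha <= Num.sqrt (alpha ^+ 2 + 4 * beta * s).
Proof.
move=> s0; rewrite -[leLHS](ger0_norm (ltW alpha_gt0)) -sqrtr_sqr ler_wsqrtr//.
by rewrite lerDl !mulr_ge0.
Qed.

Lemma fbeta_ge0 s : 0 <= f s.
Proof. by rewrite divr_ge0// addr_ge0// ?sqrtr_ge0 ?ltW. Qed.

(** This is Forchheimer's law: the quadratic equation beta n^2 + alpha n = |v| for the norm n of the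
    flux has the root with beta n = (sqrt (alpha^2 + 4 beta |v|) - alpha) / 2, and [fbeta] encodes
    it without dividing by beta. *)
Lemma flx_inv v : v = (alpha + beta * enorm (flx v)) *: flx v.
Proof.
rewrite enormZ ?fbeta_ge0// scalerA -[LHS]scale1r; congr (_ *: _).
have m0 := enorm_ge0 v; set m := enorm v in m0 *.
have r0 := fbeta_den m0; have r2 : Num.sqrt (alpha ^+ 2 + 4 * beta * m) ^+ 2 = alpha ^+ 2 + 4 * beta * m.
  by rewrite sqr_sqrtr// addr_ge0 ?sqr_ge0// !mulr_ge0.
rewrite /fbeta; set r := Num.sqrt _ in r0 r2 *.
have ar : alpha + r != 0 by rewrite gt_eqF// addr_gt0// (lt_le_trans alpha_gt0).
have -> : beta * (2 / (alpha + r) * m) = (r - alpha) / 2.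
  have -> : beta * (2 / (alpha + r) * m) = (4 * beta * m) / 2 / (alpha + r) by field.
  by rewrite (_ : 4 * beta * m = (r - alpha) * (alpha + r)); [field|rewrite -[RHS]/(_ * _); nra].
by field.
Qed.

(** Let d be the distance of the two fluxes. Each component of v - w is at most (alpha + 2 beta B +
    beta d) d, whereas the monotone product is at least alpha d^2 + beta d^3 / 2. Young's inequality
    absorbs the part linear in d by the square and the part quadratic in d by the cube; what remains
    is of order h^2 and h^3. Only the flux of w is bounded. *)
Lemma flux_monotone B K : 0 <= B -> 0 <= K -> exists2 C, 0 <= C & forall v w h, 0 <= h ->
  enorm (flx w) <= B ->
  K * h * (`|v.1 - w.1| + `|v.2 - w.2|) <=
  dotp (flx v - flx w) (v - w) + C * (h ^+ 2 + h ^+ 3).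
Proof.
move=> B0 K0; pose c := alpha + 2 * beta * B.
exists ((2 * K * c) ^+ 2 / (4 * alpha) + beta * (4 * (2 * K) ^+ 3)).
  by rewrite addr_ge0// ?divr_ge0 ?sqr_ge0 ?mulr_ge0// ?exprn_ge0 ?mulr_ge0// ltW.
move=> v w h h0 wB.
have n0 := enorm_ge0 (flx v); have k0 := enorm_ge0 (flx w).
have d0 := enorm_ge0 (flx v - flx w).
have dn := enorm_dist (flx v) (flx w).
have n2 := enorm_sqr (flx v); have k2 := enorm_sqr (flx w).
have d2 := enorm_sqr (flx v - flx w).
have [e1 e2] := le_enorm (flx v - flx w); have [u1 u2] := le_enorm (flx w).
have nk := enormD (flx v) (- flx w); rewrite enormN in nk.
have vE := flx_inv v; have wE := flx_inv w.
move: vE wE n0 k0 d0 dn n2 k2 d2 e1 e2 u1 u2 nk wB.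
move: (enorm (flx v)) (enorm (flx w)) (enorm (flx v - flx w)) => n k d.
case: (flx v) (flx w) => [V1 V2] [U1 U2] /= -> -> n0 k0 d0 dn n2 k2 d2 e1 e2 u1 u2 nk kB.
rewrite /dotp /= /GRing.scale/=.
(* The coefficient at V is compared with the one at U through n <= k + d, which removes the unknown
   norm n. *)
have comp x y : `|x - y| <= d -> `|y| <= k ->
    `|(alpha + beta * n) * x - (alpha + beta * k) * y| <= (c + beta * d) * d.
  move=> xy yk.
  have -> : (alpha + beta * n) * x - (alpha + beta * k) * y =
    (alpha + beta * n) * (x - y) + beta * ((n - k) * y) by ring.
  apply: le_trans (ler_normD _ _) _; rewrite !normrM (ger0_norm beta_ge0).
  rewrite [`|alpha + _|]ger0_norm; last by rewrite addr_ge0 ?mulr_ge0// ltW.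
  have nkd : n <= k + d by have := ler_norm (n - k); lra.
  have : (alpha + beta * n) * `|x - y| <= (alpha + beta * (k + d)) * d.
    apply: ler_pM => //; first by rewrite addr_ge0 ?mulr_ge0// ltW.
    by rewrite lerD2l ler_wpM2l.
  have : beta * (`|n - k| * `|y|) <= beta * (d * k) by rewrite ler_wpM2l// ler_pM.
  have : beta * d * k <= beta * d * B by rewrite ler_wpM2l// mulr_ge0.
  by rewrite /c; nra.
have c1 := comp _ _ e1 u1; have c2 := comp _ _ e2 u2.
(* The beta part of the product is (n + k) (d^2 + (n - k)^2) / 2 exactly, and n + k >= d by the
   triangle inequality. *)
have mon : alpha * d ^+ 2 + beta * (d ^+ 3 / 2) <=
    (V1 - U1) * ((alpha + beta * n) * V1 - (alpha + beta * k) * U1) +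
    (V2 - U2) * ((alpha + beta * n) * V2 - (alpha + beta * k) * U2).
  have -> : (V1 - U1) * ((alpha + beta * n) * V1 - (alpha + beta * k) * U1) +
      (V2 - U2) * ((alpha + beta * n) * V2 - (alpha + beta * k) * U2) =
     alpha * d ^+ 2 + beta * ((n + k) * d ^+ 2 / 2 + (n + k) * (n - k) ^+ 2 / 2).
    rewrite d2.
    have -> : (n + k) * (n - k) ^+ 2 / 2 = (n * n ^+ 2 + k * k ^+ 2 - n * k ^+ 2 - k * n ^+ 2) / 2 by field.
    by rewrite n2 k2; field.
  rewrite lerD2l ler_wpM2l//.
  have : 0 <= (n + k) * (n - k) ^+ 2 / 2 by rewrite divr_ge0// mulr_ge0 ?sqr_ge0// addr_ge0.
  have : d * d ^+ 2 <= (n + k) * d ^+ 2 by rewrite ler_wpM2r ?sqr_ge0.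
  by rewrite exprS; lra.
have h1 : K * h * ((c + beta * d) * d + (c + beta * d) * d) =
  (2 * K * c * h) * d + beta * ((2 * K * h) * d ^+ 2) by ring.
have h2 := young_quadratic (2 * K * c * h) d alpha_gt0.
have h3 : beta * ((2 * K * h) * d ^+ 2) <= beta * (d ^+ 3 / 2 + 4 * (2 * K * h) ^+ 3).
  by rewrite ler_wpM2l// young_cubic// !mulr_ge0.
have h4 : K * h * (`|(alpha + beta * n) * V1 - (alpha + beta * k) * U1| +
   `|(alpha + beta * n) * V2 - (alpha + beta * k) * U2|) <=
   K * h * ((c + beta * d) * d + (c + beta * d) * d).
  by rewrite ler_wpM2l ?mulr_ge0// lerD.
apply: (le_trans h4); rewrite h1.
have -> : ((2 * K * c) ^+ 2 / (4 * alpha) + beta * (4 * (2 * K) ^+ 3)) * (h ^+ 2 + h ^+ 3) =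
  (2 * K * c * h) ^+ 2 / (4 * alpha) + beta * (4 * (2 * K * h) ^+ 3)
  + ((2 * K * c) ^+ 2 / (4 * alpha) * h ^+ 3 + beta * (4 * (2 * K) ^+ 3) * h ^+ 2).
  by field; rewrite gt_eqF.
have : 0 <= (2 * K * c) ^+ 2 / (4 * alpha) * h ^+ 3 + beta * (4 * (2 * K) ^+ 3) * h ^+ 2.
  apply: addr_ge0; apply: mulr_ge0; rewrite ?exprn_ge0//.
    by rewrite divr_ge0 ?sqr_ge0// mulr_ge0// ltW.
  by rewrite mulr_ge0// mulr_ge0// exprn_ge0// mulr_ge0.
by move: h2 h3 mon; rewrite !mulrDr; lra.
Qed.

End Constitutive.

(** * Differentiability of the flux law *)

Section FluxSmooth.
Variable R : realType.

(* Serves at the origin, where the factor phi, a function of the Euclidean norm,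
   fails to be differentiable. *)
Lemma diff_mul_origin (l : {linear (R * R)%type -> R}) (phi : R * R -> R) :
  continuous l -> (forall z, `|l z| <= `|z|) -> {for 0, continuous phi} ->
  differentiable (fun z => l z * phi z) (0 : R * R) /\
  forall w, 'd (fun z => l z * phi z) (0 : R * R) w = phi 0 * l w.
Proof.
move=> cl ll cphi.
have cont : continuous (phi 0 \*: l) by move=> z; apply: (@cvgMr _ _ _ _ _ (phi 0)); exact: cl.
have E : (fun z => l z * phi z) \o shift (0 : R * R) =
    cst (l 0 * phi 0) + (phi 0 \*: l) +o_ (0 : R * R) id.
  apply/eqaddoP => _/posnumP[e].
  have ce : \forall z \near (0 : R * R), `|phi 0 - phi z| < e%:num.
    by have /cvgrPdist_lt/(_ e%:num)  := cphi; apply.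
  near=> z; rewrite /= !fctE /= addr0 linear0 mul0r add0r.
  rewrite (_ : l z * phi z - phi 0 * l z = l z * (phi z - phi 0)); last by ring.
  rewrite normrM mulrC ler_pM//; rewrite distrC; apply: ltW; near: z; exact: ce.
have D : 'd (fun z => l z * phi z) (0 : R * R) = phi 0 \*: l :> (R * R -> R).
  by apply: diff_unique.
split; last by move=> w; rewrite D.
by apply/diff_locallyP; rewrite D.
Unshelve. all: by end_near. Qed.

Lemma grad_origin (l : {linear (R * R)%type -> R}) (phi : R * R -> R) :
  continuous l -> (forall z, `|l z| <= `|z|) -> {for 0, continuous phi} ->
  grad (fun z => l z * phi z) (0 : R * R) = (phi 0 * l (e1 R), phi 0 * l (e2 R)).
Proof.
move=> cl ll cphi; have [d e] := diff_mul_origin cl ll cphi.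
by rewrite /grad !deriveE// !e.
Qed.

Definition qform (z : R * R) : R := z.1 ^+ 2 + z.2 ^+ 2.

Lemma qform_diff z : differentiable qform z /\ forall w, 'd qform z w = 2 * dotp z w.
Proof.
have id1 (t : R) : is_derive t 1 (fun t : R => t ^+ 2) (2 * t).
  have := @is_deriveX R R id 2 t 1 1 (is_derive_id t 1).
  by rewrite /= /GRing.scale /= expr1 mulr1 mulr_natl.
have c1 : continuous (fun t : R => 2 * t) by move=> t; apply: cvgMr; exact: cvg_id.
have u0 (t : R) : is_derive t 1 (fun t : R => (1 : R)) 0 by exact: is_derive_cst.
have c0 : continuous (fun t : R => (0 : R)) by move=> t; exact: cvg_cst.
have := C1_upto_add (tensor_C1 setT id1 u0 c1 c0) (tensor_C1 setT u0 id1 c0 c1).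
case=> -[H _] _; have [d g] := H z I.
have E : qform = (fun z : R * R => z.1 ^+ 2 * 1 + 1 * z.2 ^+ 2).
  by apply/funext => y; rewrite /qform mulr1 mul1r.
rewrite E; split => // w; rewrite diff_grad// g /dotp /=; ring.
Qed.

Lemma qform_continuous : continuous qform.
Proof. by move=> z; apply: differentiable_continuous; exact: (qform_diff z).1. Qed.

Lemma enorm_continuous : continuous (@enorm R).
Proof.
move=> z; apply: (@continuous_comp _ _ _ qform Num.sqrt); first exact: qform_continuous.
exact: sqrt_continuous.
Qed.

Lemma normr_enorm (z : R * R) : `|z| <= enorm z.
Proof. by rewrite prod_normE ge_max; have [-> ->] := le_enorm z. Qed.

Lemma enorm_gt0 (z : R * R) : z != 0 -> 0 < enorm z.
Proof. by move=> z0; apply: lt_le_trans (normr_enorm z); rewrite normr_gt0. Qed.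

Variables alpha beta : R.
Hypotheses (alpha_gt0 : 0 < alpha) (beta_ge0 : 0 <= beta).

Definition discr (z : R * R) : R := Num.sqrt (alpha ^+ 2 + 4 * beta * enorm z).
Definition phi (z : R * R) : R := fbeta alpha beta (enorm z).
(* The derivative of fbeta divided by the norm; at z = 0 division by zero gives 0. *)
Definition phi_slope (z : R * R) : R :=
  - (4 * beta) / ((alpha + discr z) ^+ 2 * discr z * enorm z).

Lemma discr_ge z : alpha <= discr z.
Proof. exact: fbeta_den (enorm_ge0 z). Qed.

Lemma discr_gt0 z : 0 < discr z.
Proof. exact: lt_le_trans (discr_ge z). Qed.

Lemma discr_continuous : continuous discr.
Proof.
move=> z; apply: (@continuous_comp _ _ _ (fun z => alpha ^+ 2 + 4 * beta * enorm z) Num.sqrt).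
  by apply: cvgD; [exact: cvg_cst|apply: cvgMr; exact: enorm_continuous].
exact: sqrt_continuous.
Qed.

Lemma phi_continuous : continuous phi.
Proof.
move=> z; rewrite /continuous_at /phi /fbeta; apply: cvgM; first exact: cvg_cst.
apply: cvgV; first by rewrite gt_eqF// addr_gt0// discr_gt0.
by apply: cvgD; [exact: cvg_cst|exact: discr_continuous].
Qed.

Lemma phi_derive (t : R) : 0 < t ->
  is_derive t 1 (fun t => fbeta alpha beta (Num.sqrt t))
   (- (2 * beta) / ((alpha + Num.sqrt (alpha ^+ 2 + 4 * beta * Num.sqrt t)) ^+ 2
      * Num.sqrt (alpha ^+ 2 + 4 * beta * Num.sqrt t) * Num.sqrt t)).
Proof.
move=> t0; pose p (s : R) : R := alpha ^+ 2 + 4 * beta * s.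
have s0 : 0 < Num.sqrt t by rewrite sqrtr_gt0.
have p0 : 0 < p (Num.sqrt t).
  by rewrite /p ltr_wpDr ?exprn_gt0// mulr_ge0 ?mulr_ge0// ltW.
have r0 : 0 < Num.sqrt (p (Num.sqrt t)) by rewrite sqrtr_gt0.
have dp (s : R) : is_derive s 1 p (4 * beta).
  have := @is_deriveD R R R (cst (alpha ^+ 2)) (fun s => (4 * beta) *: s) s 1 0 _ (is_derive_cst _ _ _) (is_deriveZ (4 * beta) (is_derive_id s 1)).
  by rewrite add0r /GRing.scale/= mulr1; apply.
have d1 := is_derive1_comp (dp (Num.sqrt t)) (is_derive1_sqrt t0).
have d2 := @is_derive1_comp R Num.sqrt (p \o Num.sqrt) t _ _ (is_derive1_sqrt p0) d1.
have d3 := @is_deriveD R R R (cst alpha) _ t 1 0 _ (is_derive_cst _ _ _) d2.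
have ne : alpha + Num.sqrt (p (Num.sqrt t)) != 0 by rewrite gt_eqF// addr_gt0.
have d4 := is_deriveZ 2 (@is_deriveV R (cst alpha + (Num.sqrt \o (p \o Num.sqrt))) t _ 1 ne d3).
apply: (is_derive_eq d4).
rewrite add0r /GRing.scale/= !fctE /= -/(p _); field.
by rewrite ne !gt_eqF.
Qed.

Lemma phi_diff z : z != 0 -> differentiable phi z /\
  forall w, 'd phi z w = phi_slope z * dotp z w.
Proof.
move=> z0; have q0 : 0 < qform z.
  by have := enorm_gt0 z0; rewrite sqrtr_gt0.
have [dq dqE] := qform_diff z; have dG := phi_derive q0.
have diffG : differentiable (fun t => fbeta alpha beta (Num.sqrt t)) (qform z).
  by apply/derivable1_diffP; exact: ex_derive.
split; first exact: (differentiable_comp dq diffG).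
move=> w; rewrite -[phi]/((fun t => fbeta alpha beta (Num.sqrt t)) \o qform) (diff_comp dq diffG).
transitivity ('d (fun t => fbeta alpha beta (Num.sqrt t)) (qform z) ('d qform z w)); first by [].
rewrite dqE diff1E// derive1E derive_val /phi_slope /discr /GRing.scale/=.
have m0 := enorm_gt0 z0; have := discr_gt0 z; have := discr_ge z.
rewrite /discr -/(enorm z); move: (enorm z) m0 => m m0; move: (Num.sqrt _) => r ar r0.
have a0 : alpha + r != 0 by rewrite gt_eqF// addr_gt0.
by field; rewrite a0 !gt_eqF.
Qed.

Section Component.
Variable l : {linear (R * R)%type -> R}.
Hypotheses (cl : continuous l) (ll : forall z, `|l z| <= `|z|).

Definition Dcomp (z : R * R) : R * R :=
  (phi z * l (e1 R) + l z * (phi_slope z * z.1), phi z * l (e2 R) + l z * (phi_slope z * z.2)).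

Lemma comp_diff z : differentiable (fun z => l z * phi z) z /\
  grad (fun z => l z * phi z) z = Dcomp z.
Proof.
have [->|z0] := eqVneq z 0.
  split; first exact: (diff_mul_origin cl ll (@phi_continuous _)).1.
  rewrite (grad_origin cl ll (@phi_continuous _)) /Dcomp.
  by rewrite linear0 !mul0r !addr0.
have [dphi dE] := phi_diff z0.
have dl : differentiable l z by exact: linear_differentiable.
split; first exact: (differentiableM dl dphi).
have D w : 'D_w (fun z => l z * phi z) z = l z * (phi_slope z * dotp z w) + phi z * l w.
  have E1 : 'D_w phi z = phi_slope z * dotp z w by rewrite (deriveE w dphi) dE.
  have E2 : 'D_w l z = l w by rewrite (deriveE w dl) (diff_lin z cl).
  have := @deriveM _ _ l phi z w (diff_derivable dl) (diff_derivable dphi).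
  by rewrite E1 E2.
rewrite /grad /Dcomp !D /dotp /e1 /e2 /= !mulr1 !mulr0 addr0 add0r.
by congr pair; rewrite addrC.
Qed.

(** Multiplying by the norm cancels the only singular factor; the rest is largest when the
    discriminant root has its least value alpha, giving 4 beta / (4 alpha^3). *)
Lemma phi_slope_bound z : `|phi_slope z| * enorm z <= beta / alpha ^+ 3.
Proof.
have [->|z0] := eqVneq z 0.
  rewrite (_ : enorm 0 = 0) ?mulr0; last by rewrite /enorm /= expr0n addr0 sqrtr0.
  by rewrite divr_ge0// exprn_ge0// ltW.
have m0 := enorm_gt0 z0; have := discr_gt0 z; have := discr_ge z; rewrite /phi_slope.
move: (enorm z) m0 (discr z) => m m0 r ar r0.
have d0 : 0 < (alpha + r) ^+ 2 * r * m.
  by rewrite mulr_gt0// mulr_gt0// exprn_gt0// addr_gt0.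
rewrite normrM normrN (ger0_norm (mulr_ge0 _ _))// gtr0_norm ?invr_gt0//.
have -> : 4 * beta / ((alpha + r) ^+ 2 * r * m) * m = 4 * beta / ((alpha + r) ^+ 2 * r).
  have a0 : alpha + r != 0 by rewrite gt_eqF// addr_gt0.
  by field; rewrite a0 !gt_eqF.
rewrite (_ : beta / alpha ^+ 3 = 4 * beta / ((alpha + alpha) ^+ 2 * alpha)); last first.
  by rewrite (_ : alpha + alpha = 2 * alpha); [field; rewrite gt_eqF|ring].
have b0 : 0 < (alpha + alpha) ^+ 2 * alpha by rewrite mulr_gt0// exprn_gt0// addr_gt0.
rewrite ler_wpM2l ?mulr_ge0// lef_pV2 ?posrE ?mulr_gt0 ?exprn_gt0 ?addr_gt0//.
apply: ler_pM; [by rewrite exprn_ge0// addr_ge0// ltW|exact: ltW| |exact: ar].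
by rewrite ler_pXn2r ?nnegrE ?addr_ge0 ?(ltW alpha_gt0) ?(ltW r0)// lerD2l.
Qed.

(** At the origin the two factors l and k vanish to first order while the slope blows up only like
    1/|z|, so the product is O(|z|). *)
Lemma mul_phi_slope_continuous (k : R * R -> R) : continuous k -> (forall z, `|k z| <= `|z|) ->
  continuous (fun z => l z * (phi_slope z * k z)).
Proof.
move=> ck kl z; have [->|z0] := eqVneq z 0.
  have l0 : l 0 * (phi_slope 0 * k 0) = 0 by rewrite linear0 mul0r.
  rewrite /continuous_at l0; apply/cvgr0Pnorm_le => e e0.
  have c0 : 0 <= beta / alpha ^+ 3 by rewrite divr_ge0// exprn_ge0// ltW.
  have ce : \forall z \near (0 : R * R), `|z| < e / (beta / alpha ^+ 3 + 1).
    have : 0 < e / (beta / alpha ^+ 3 + 1) by rewrite divr_gt0// ltr_wpDl.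
    by move=> H; exact: nbhs0_lt.
  near=> y; have yn : `|y| < e / (beta / alpha ^+ 3 + 1) by near: y; exact: ce.
  rewrite (normrM (l y)) (normrM (phi_slope y)); apply: (@le_trans _ _ (`|y| * (`|phi_slope y| * enorm y))).
    apply: ler_pM => //; rewrite ?mulr_ge0//; apply: ler_pM => //.
    exact: le_trans (kl y) (normr_enorm y).
  apply: (@le_trans _ _ (`|y| * (beta / alpha ^+ 3))).
    by apply: ler_wpM2l => //; exact: phi_slope_bound.
  move: yn; rewrite ltr_pdivlMr ?ltr_wpDl// => yn; apply: le_trans (ltW yn).
  by rewrite ler_wpM2l// lerDl.
rewrite /continuous_at; apply: cvgM; first exact: cl.
apply: cvgM; last exact: ck.
rewrite /phi_slope; apply: cvgM; first exact: cvg_cst.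
have d0 : 0 < alpha + discr z by rewrite addr_gt0// discr_gt0.
apply: cvgV.
  by rewrite gt_eqF// !mulr_gt0 ?exprn_gt0 ?discr_gt0 ?enorm_gt0.
have cd := @discr_continuous z.
have cs : (alpha + discr y) @[y --> z] --> alpha + discr z.
  by apply: cvgD => //; exact: cvg_cst.
by apply: cvgM; [apply: cvgM => //; exact: cvgM|exact: enorm_continuous].
Unshelve. all: by end_near. Qed.

Lemma Dcomp_continuous : continuous Dcomp.
Proof.
have c1 : continuous (fst : R * R -> R) by move=> y; exact: cvg_fst.
have c2 : continuous (snd : R * R -> R) by move=> y; exact: cvg_snd.
have b1 (y : R * R) : `|y.1| <= `|y| by rewrite prod_normE le_max lexx.
have b2 (y : R * R) : `|y.2| <= `|y| by rewrite prod_normE le_max lexx orbT.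
have M1 := mul_phi_slope_continuous c1 b1; have M2 := mul_phi_slope_continuous c2 b2.
move=> z; apply: (@cvg_pair _ _ _ (nbhs z) (nbhs (Dcomp z).1) (nbhs (Dcomp z).2)).
- by apply: cvgD; [apply: cvgM; [exact: phi_continuous|exact: cvg_cst]|exact: M1].
- by apply: cvgD; [apply: cvgM; [exact: phi_continuous|exact: cvg_cst]|exact: M2].
Qed.

End Component.

Lemma flx_C1 A u v Du Dv : C1_upto A u Du -> C1_upto A v Dv ->
  exists D1 D2, C1_upto A (fun z => (flx alpha beta (u z, v z)).1) D1 /\
    C1_upto A (fun z => (flx alpha beta (u z, v z)).2) D2.
Proof.
move=> Cu Cv.
have c1 : continuous (fst : R * R -> R) by move=> y; exact: cvg_fst.
have c2 : continuous (snd : R * R -> R) by move=> y; exact: cvg_snd.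
have b1 (y : R * R) : `|y.1| <= `|y| by rewrite prod_normE le_max lexx.
have b2 (y : R * R) : `|y.2| <= `|y| by rewrite prod_normE le_max lexx orbT.
have H1 := C1_upto_comp Cu Cv (comp_diff c1 b1) (Dcomp_continuous c1 b1).
have H2 := C1_upto_comp Cu Cv (comp_diff c2 b2) (Dcomp_continuous c2 b2).
do 2 eexists; split; [move: H1|move: H2]; congr C1_upto;
  by apply/funext => z; rewrite /flx /phi /= mulrC.
Qed.

End FluxSmooth.

(** * Calculus on rectangles *)

Section Interval.
Variable R : realType.
Local Notation mu := (@lebesgue_measure R).
Implicit Types (a b c d : R) (k F f : R -> R).

Lemma closure_orect a b c d : a < b -> c < d -> closure (orect a b c d) = crect a b c d.
Proof.
move=> ab cd; apply/seteqP; split => [z|[x y] [/= xab ycd]].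
  have cl : closed (crect a b c d).
    by apply: compact_closed; [exact: norm_hausdorff|exact: crect_compact].
  by rewrite [X in _ -> X z]((closure_id _).1 cl); apply: closure_subset; exact: orect_crect.
have cub a' b' x' (e : R) : a' < b' -> 0 < e -> x' \in `[a', b'] ->
    exists2 x0, x0 \in `]a', b'[ & ball x' e x0.
  move=> ab' e0; rewrite in_itv/= => /andP[h1 h2].
  (* The point is moved towards the midpoint by the fraction t: t > 0 brings it inside, and t (b' -
     a') <= e / 2 keeps it within e. *)
  pose t := Num.min (1 / 2) (e / (2 * (b' - a'))).
  have ba : 0 < b' - a' by rewrite subr_gt0.
  have t0 : 0 < t by rewrite lt_min divr_gt0//= divr_gt0// mulr_gt0.
  have t1 : t <= 1 / 2 by rewrite ge_min lexx.
  have t2 : t * (b' - a') <= e / 2.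
    rewrite -ler_pdivlMr//; apply: le_trans (_ : e / (2 * (b' - a')) <= _).
      by rewrite ge_min lexx orbT.
    by rewrite invfM mulrA.
  have p1 : 0 <= x' - a' by rewrite subr_ge0.
  have p2 : 0 <= b' - x' by rewrite subr_ge0.
  have q1 : 0 <= (x' - a') * (1 / 2 - t) by rewrite mulr_ge0// subr_ge0.
  have q2 : 0 <= (b' - x') * (1 / 2 - t) by rewrite mulr_ge0// subr_ge0.
  have q3 : 0 < t * (b' - a') by rewrite mulr_gt0.
  have q4 : 0 <= (x' - a') * t by rewrite mulr_ge0// ltW.
  have q5 : 0 <= (b' - x') * t by rewrite mulr_ge0// ltW.
  exists (x' + t * ((a' + b') / 2 - x')).
    by rewrite in_itv/=; apply/andP; split; nra.
  rewrite /ball/= opprD addrA subrr add0r normrN ltr_norml; apply/andP; split; nra.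
move=> B /nbhs_ballP[e /= e0 eB].
have [x0 x0ab bx] := cub a b x e ab e0 xab.
have [y0 y0cd by_] := cub c d y e cd e0 ycd.
by exists (x0, y0); split; [split|apply: eB; split].
Qed.

Lemma oo_integrable a b f : {within `[a, b], continuous f} ->
  mu.-integrable `]a, b[ (EFin \o f).
Proof.
move=> cf; have If : mu.-integrable `[a, b] (EFin \o f).
  by apply: continuous_compact_integrable => //; exact: segment_compact.
by apply: integrableS If => //; exact: subset_itv_oo_cc.
Qed.

Lemma mean_value_bound a b F f (m : R) : {within `[a, b], continuous F} ->
  (forall x, a < x < b -> is_derive x 1 F (f x)) -> (forall x, a < x < b -> `|f x| <= m) ->
  forall x y, a <= x <= b -> a <= y <= b -> `|F x - F y| <= m * (b - a).
Proof.
move=> cF dF fm.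
have H x y : a <= x <= b -> a <= y <= b -> x < y -> `|F y - F x| <= m * (b - a).
  move=> /andP[ax xb] /andP[ay yb] xy.
  have cF' : {within `[x, y], continuous F}.
    apply: continuous_subspaceW cF => z.
    by rewrite /= !in_itv/= => /andP[h1 h2]; rewrite (le_trans ax h1) (le_trans h2 yb).
  have [|z] := @MVT R F f x y xy _ cF'.
    move=> z; rewrite in_itv/= => /andP[h1 h2]; apply: dF.
    by rewrite (le_lt_trans ax h1) (lt_le_trans h2 yb).
  rewrite in_itv/= => /andP[h1 h2] ->; rewrite normrM (gtr0_norm (_ : 0 < y - x)) ?subr_gt0//.
  have zab : a < z < b by rewrite (le_lt_trans ax h1) (lt_le_trans h2 yb).
  by apply: ler_pM => //; [rewrite subr_ge0 ltW|exact: fm|exact: lerB].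
move=> x y xab yab; have [xy|xy|->] := ltgtP x y.
- by rewrite distrC; exact: H.
- exact: H.
- have m0 : a < b -> 0 <= m.
    by move=> ab; apply: le_trans (normr_ge0 (f ((a + b) / 2))) (fm _ _); apply/andP; split; lra.
  rewrite subrr normr0; move: yab => /andP[h1 h2]; have := le_trans h1 h2.
  rewrite le_eqVlt => /predU1P[->|ab]; first by rewrite subrr mulr0.
  by rewrite mulr_ge0 ?m0// subr_ge0 ltW.
Qed.

Lemma primitive a b k : a < b -> {within `[a, b], continuous k} ->
  exists2 K : R -> R, {within `[a, b], continuous K} &
    forall x, a < x < b -> is_derive x 1 K (k x).
Proof.
move=> ab ck.
have Ik : mu.-integrable `[a, b] (EFin \o k).
  by apply: continuous_compact_integrable => //; exact: segment_compact.
exists (fun x => \int[mu]_(t in `[a, x]) k t).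
  exact: (parameterized_integral_continuous (ltW ab) Ik).
move=> x /andP[ax xb].
have ckx : {for x, continuous k}.
  have : {in `]a, b[%classic, continuous k}.
    rewrite -continuous_open_subspace; last exact: interval_open.
    by apply: continuous_subspaceW ck; exact: subset_itv_oo_cc.
  by apply; rewrite inE/= in_itv/= ax xb.
have [d1 d2] := continuous_FTC1_closed xb Ik ax ckx.
by apply: DeriveDef; [exact: d1|rewrite -derive1E; exact: d2].
Qed.

Lemma le_cst_integral a b f m : a < b -> {within `[a, b], continuous f} ->
  (forall x, a < x < b -> `|f x| <= m) -> `|\int[mu]_(x in `]a, b[) f x| <= m * (b - a).
Proof.
move=> ab cf fm; have [F cF dF] := primitive ab cf.
rewrite (FTC_oo ab cF cf dF).
by apply: (mean_value_bound cF dF fm); rewrite ?lexx ?ltW.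
Qed.

End Interval.

Section Rect.
Variable R : realType.
Local Notation mu := (@lebesgue_measure R).
Variables (a b c d : R).
Hypotheses (ab : a < b) (cd : c < d).
Local Notation A := (orect a b c d).
Local Notation K := (crect a b c d).
Implicit Types (u P Q : R * R -> R) (Du DP DQ : R * R -> R * R).

Lemma rect_C1 u Du : C1_upto A u Du ->
  [/\ {within K, continuous u}, {within K, continuous (fun z => (Du z).1)},
   {within K, continuous (fun z => (Du z).2)},
   forall x y, a < x < b -> c < y < d -> is_derive x 1 (fun s => u (s, y)) (Du (x, y)).1 &
   forall x y, a < x < b -> c < y < d -> is_derive y 1 (fun s => u (x, s)) (Du (x, y)).2].
Proof.
move=> [[du cD] cu]; rewrite closure_orect// in cD cu; split.
- exact: cu.
- exact: continuous_fst_within.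
- exact: continuous_snd_within.
- move=> x y xab ycd; have [dz gz] : differentiable u (x, y) /\ grad u (x, y) = Du (x, y).
    by apply: du; split; rewrite /= in_itv.
  have := @chain_rule R u id (cst y) x 1 0 dz (is_derive_id _ _) (is_derive_cst _ _ _).
  by rewrite /= gz /dotp /= mulr1 mulr0 addr0.
- move=> x y xab ycd; have [dz gz] : differentiable u (x, y) /\ grad u (x, y) = Du (x, y).
    by apply: du; split; rewrite /= in_itv.
  have := @chain_rule R u (cst x) id y 0 1 dz (is_derive_cst _ _ _) (is_derive_id _ _).
  by rewrite /= gz /dotp /= mulr1 mulr0 add0r.
Qed.

Lemma fst_within (k : R -> R) : {within `[a, b], continuous k} ->
  {within K, continuous (fun z => k z.1)}.
Proof.
move=> ck; apply: (within_continuous_comp (K := `[a, b])) ck _.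
  by apply: continuous_subspaceT => z; exact: cvg_fst.
by move=> z [].
Qed.

Lemma snd_continuous_within : {within K, continuous (fun z : R * R => z.2)}.
Proof. by apply: continuous_subspaceT => z; exact: cvg_snd. Qed.

Lemma rect_cst_integral (m : R) : \int[leb2 R]_(z in A) m = m * ((b - a) * (d - c)).
Proof.
have mu_oo (a' b' e : R) : a' < b' -> \int[mu]_(x in `]a', b'[) cst e x = e * (b' - a').
  move=> ab'; rewrite Rintegral_cst//.
  have := @lebesgue_measure_itv R `]a', b'[; rewrite /= lte_fin ifT; last exact: ab'.
  by move=> ->; rewrite -EFinD.
rewrite (Fubini_rect_xy (f := cst m)); last by move=> z; exact: cvg_cst.
transitivity (\int[mu]_(x in `]a, b[) cst (m * (d - c)) x).
  by apply: eq_Rintegral => x _; exact: mu_oo.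
by rewrite mu_oo//; ring.
Qed.

Lemma le_rect_integral (f g : R * R -> R) : {within K, continuous f} -> {within K, continuous g} ->
  (forall z, A z -> f z <= g z) ->
  \int[leb2 R]_(z in A) f z <= \int[leb2 R]_(z in A) g z.
Proof.
move=> cf cg fg; apply: le_Rintegral => //; [|exact: rect_integrable|exact: rect_integrable].
exact: orect_measurable.
Qed.

Lemma rectD (f g : R * R -> R) : {within K, continuous f} -> {within K, continuous g} ->
  \int[leb2 R]_(z in A) (f z + g z) = \int[leb2 R]_(z in A) f z + \int[leb2 R]_(z in A) g z.
Proof.
by move=> cf cg; apply: RintegralD => //; [exact: orect_measurable|exact: rect_integrable|exact: rect_integrable].
Qed.

Lemma rectZ (r : R) (f : R * R -> R) : {within K, continuous f} ->
  \int[leb2 R]_(z in A) (r * f z) = r * \int[leb2 R]_(z in A) f z.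
Proof.
by move=> cf; apply: RintegralZl => //; [exact: orect_measurable|exact: rect_integrable].
Qed.

Lemma within_norm (f : R * R -> R) : {within K, continuous f} -> {within K, continuous (fun z => `|f z|)}.
Proof.
by move=> cf z; apply: continuous_comp; [exact: cf|exact: norm_continuous].
Qed.

Lemma le_norm_rect (f : R * R -> R) : {within K, continuous f} ->
  `|\int[leb2 R]_(z in A) f z| <= \int[leb2 R]_(z in A) `|f z|.
Proof.
by move=> cf; apply: (@le_normr_Rintegral _ _ _ (leb2 R)); [exact: orect_measurable|exact: rect_integrable].
Qed.

(* Integration of the y-derivative of (y - c) w trades the trace on y = d for an
   integral over the rectangle, without any absolute value. *)
Lemma top_integral (k : R -> R) w Dw : C1_upto A w Dw -> {within `[a, b], continuous k} ->
  \int[leb2 R]_(z in A) (k z.1 * (w z + (z.2 - c) * (Dw z).2)) =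
  (d - c) * \int[mu]_(x in `]a, b[) (k x * w (x, d)).
Proof.
move=> Cw ck; have [cw c1 c2 d1 d2] := rect_C1 Cw.
have cf : {within K, continuous (fun z => k z.1 * (w z + (z.2 - c) * (Dw z).2))}.
  apply: continuousM_within; first exact: fst_within.
  apply: continuousD_within => //; apply: continuousM_within => //.
  by apply: continuousB_within; [exact: snd_continuous_within|exact: continuous_cst_within].
rewrite Fubini_rect_xy//.
have cwt : {within `[a, b], continuous (fun x => k x * w (x, d))}.
  by apply: continuousM_within => //; apply: (slice1_continuous _ cw); rewrite lexx ltW.
rewrite -RintegralZl//; last first.
  exact: oo_integrable.
apply: eq_Rintegral => x; rewrite inE/= in_itv/= => xab.
have xab' : a <= x <= b by case/andP: xab => /ltW -> /ltW ->.
transitivity (k x * ((d - c) * w (x, d)) - k x * ((c - c) * w (x, c))); last first.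
  by rewrite subrr mul0r mulr0 subr0; ring.
apply: (@FTC_oo _ c d (fun y => k x * ((y - c) * w (x, y)))); first exact: cd.
- apply: continuousM_within; first exact: continuous_cst_within.
  apply: continuousM_within; last exact: (slice2_continuous xab' cw).
  by apply: continuous_subspaceT => y; apply: cvgB; [exact: cvg_id|exact: cvg_cst].
- exact: (slice2_continuous xab' cf).
move=> y ycd; have dw := d2 x y xab ycd.
have dy : is_derive y 1 (fun y : R => y - c) 1.
  have := @is_deriveB R R R id (cst c) y 1 1 0 (is_derive_id _ _) (is_derive_cst _ _ _).
  by rewrite subr0.
have dm := @is_deriveM _ _ (fun y : R => y - c) (fun y => w (x, y)) y 1 _ _ dy dw.
apply: (is_derive_eq (is_deriveZ (k x) dm)).
by rewrite /GRing.scale/=; ring.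
Qed.

(** Integration by parts in x with the primitive of k that vanishes at b; as w vanishes at a, no
    boundary term is left. This is a Poincare inequality in L^1. *)
Lemma left_zero_integral (k : R -> R) w Dw m : C1_upto A w Dw -> {within `[a, b], continuous k} ->
  (forall y, c <= y <= d -> w (a, y) = 0) -> (forall x, a < x < b -> `|k x| <= m) ->
  `|\int[leb2 R]_(z in A) (k z.1 * w z)| <= m * (b - a) * \int[leb2 R]_(z in A) `|(Dw z).1|.
Proof.
move=> Cw ck w0 km; have [cw c1 c2 d1 d2] := rect_C1 Cw.
have [P cP dP] := primitive ab ck.
pose P0 x := P x - P b.
have cP0 : {within `[a, b], continuous P0}.
  by apply: continuousB_within => //; exact: continuous_cst_within.
have cP0' := fst_within cP0.
have E : \int[leb2 R]_(z in A) (k z.1 * w z) = - \int[leb2 R]_(z in A) (P0 z.1 * (Dw z).1).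
  apply/eqP; rewrite -subr_eq0 opprK -rectD; first last.
  - by apply: continuousM_within => //; exact: fst_within.
  - by apply: continuousM_within => //; exact: fst_within.
  apply/eqP; rewrite Fubini_rect_yx; last first.
    by apply: continuousD_within; apply: continuousM_within => //; exact: fst_within.
  apply: Rintegral_eq0 => y; rewrite /= in_itv/= => ycd.
  have ycd' : c <= y <= d by case/andP: ycd => /ltW -> /ltW ->.
  transitivity (P0 b * w (b, y) - P0 a * w (a, y)); last first.
    by rewrite w0// /P0 subrr mul0r mulr0 subrr.
  apply: (@FTC_oo _ a b (fun x => P0 x * w (x, y))); first exact: ab.
  - by apply: continuousM_within => //; exact: (slice1_continuous ycd' cw).
  - apply: (slice1_continuous ycd' (f := fun z => k z.1 * w z + P0 z.1 * (Dw z).1)).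
    by apply: continuousD_within; apply: continuousM_within => //; exact: fst_within.
  move=> x xab; have dw := d1 x y xab ycd.
  have dp : is_derive x 1 P0 (k x).
    have := @is_deriveB R R R P (cst (P b)) x 1 _ 0 (dP x xab) (is_derive_cst _ _ _).
    by rewrite subr0.
  have dm := @is_deriveM _ _ P0 (fun x => w (x, y)) x 1 _ _ dp dw.
  by apply: (is_derive_eq dm); rewrite /GRing.scale/=; ring.
have P0m x : a <= x <= b -> `|P0 x| <= m * (b - a).
  by move=> xab; apply: (mean_value_bound cP dP km) => //; rewrite lexx ltW.
rewrite E normrN -rectZ; last exact: within_norm.
apply: le_trans (le_norm_rect _) _; first exact: continuousM_within.
apply: le_rect_integral.
- by apply: within_norm; exact: continuousM_within.
- by apply: continuousM_within; [exact: continuous_cst_within|exact: within_norm].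
move=> z [/= z1 _]; rewrite normrM ler_wpM2r// P0m//.
by move: z1; rewrite in_itv/= => /andP[/ltW -> /ltW ->].
Qed.

End Rect.

(** * The fracture *)

Section Fracture.
Variable R : realType.
Local Notation mu := (@lebesgue_measure R).
Variable G : geometry R.
Variables alpha beta : R.
Hypotheses (alpha_gt0 : 0 < alpha) (beta_ge0 : 0 <= beta).
Implicit Types (D : R * R -> R * R) (z : R * R).

Definition sqrtg (u : R) : R := Num.sqrt (detg G (u, 0)).

Lemma detg_ge1 z : 1 <= detg G z.
Proof. by rewrite lerDl sqr_ge0. Qed.

Lemma sqrtg_ge1 u : 1 <= sqrtg u.
Proof. by rewrite -sqrtr1 ler_wsqrtr// detg_ge1. Qed.

Lemma sqrtg_gt0 u : 0 < sqrtg u.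
Proof. exact: lt_le_trans ltr01 (sqrtg_ge1 u). Qed.

Lemma sqrtg_sqr z : sqrtg z.1 ^+ 2 = detg G z.
Proof. by rewrite sqr_sqrtr// (le_trans ler01)// detg_ge1. Qed.

Lemma sqrtg_C1 : exists2 sqrtg' : R -> R, (forall u : R, is_derive u 1 sqrtg (sqrtg' u)) & continuous sqrtg'.
Proof.
pose p : R -> R := derive1 (profile G); pose p' : R -> R := derive1 p.
have dp (u : R) : is_derive u 1 p (p' u).
  by apply: DeriveDef; [exact: (@profile_smooth R G 1%N u)|rewrite /p' derive1E].
have dp' (u : R) : is_derive u 1 p' (derive1 p' u).
  by apply: DeriveDef; [exact: (@profile_smooth R G 2%N u)|rewrite derive1E].
have cp := is_derive_continuous dp; have cp' := is_derive_continuous dp'.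
have s0 u : 0 < 1 + p u ^+ 2 by rewrite ltr_pwDl// sqr_ge0.
have ds (u : R) : is_derive u 1 sqrtg ((2 * sqrtg u)^-1 * (2 * p u * p' u)).
  have d2 := @is_deriveD R R R (cst 1) (p ^+ 2) u 1 0 _ (is_derive_cst _ _ _) (is_deriveX 2 (dp u)).
  have d1 := @is_derive1_comp R Num.sqrt (cst 1 + p ^+ 2) u _ _ (is_derive1_sqrt (s0 u)) d2.
  by apply: (is_derive_eq d1); rewrite add0r /sqrtg /detg /GRing.scale/= -/p expr1 mulr_natl.
have cs := is_derive_continuous ds.
exists (fun u => (2 * sqrtg u)^-1 * (2 * p u * p' u)) => // u; apply: cvgM.
  apply: cvgV; first by rewrite mulf_neq0// gt_eqF// sqrtg_gt0.
  by apply: cvgMr; exact: cs.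
by apply: cvgM; [apply: cvgMr; exact: cp|exact: cp'].
Qed.

Lemma sqrtg_continuous : continuous sqrtg.
Proof. by have [s ds _] := sqrtg_C1; exact: is_derive_continuous ds. Qed.

Lemma L_gt0 : 0 < L G. Proof. exact: pcd_len (Omp_domain G) None. Qed.

Lemma sqrtg_bound : exists2 M : R, 1 <= M & forall u, 0 <= u <= L G -> sqrtg u <= M.
Proof.
have [u0 _ H] := EVT_max (ltW L_gt0) (continuous_subspaceT sqrtg_continuous).
by exists (sqrtg u0); [exact: sqrtg_ge1|move=> u uL; apply: H; rewrite in_itv].
Qed.

Lemma C1_upto_fst A (f f' : R -> R) : (forall x : R, is_derive x 1 f (f' x)) -> continuous f' ->
  C1_upto A (fun z => f z.1) (fun z => (f' z.1, 0)).
Proof.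
move=> df cf'; have u0 (t : R) : is_derive t 1 (cst (1 : R)) (cst 0 t) by exact: is_derive_cst.
have := tensor_C1 A df u0 cf' (@cst_continuous _ _ _).
by congr C1_upto; apply/funext => z; rewrite /= ?mulr1 ?mulr0.
Qed.

(** The components of the gradient in a g-orthonormal frame: their Euclidean norm is the g-norm, so
    the constitutive law can be studied in the plane. *)
Definition Xg D z : R * R := ((D z).1 / sqrtg z.1, (D z).2).
Local Notation flx := (flx alpha beta).

Lemma flux_components D z : Num.sqrt (detg G z) * (fluxg G alpha beta D z).1 = (flx (Xg D z)).1 /\
  (fluxg G alpha beta D z).2 = (flx (Xg D z)).2.
Proof.
have -> : Num.sqrt (detg G z) = sqrtg z.1 by [].
have s0 := sqrtg_gt0 z.1.
have E : normg G z (gradg G D z) = enorm (Xg D z).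
  rewrite /normg /enorm /ipg /gradg /Xg /= -sqrtg_sqr; congr Num.sqrt.
  by field; rewrite gt_eqF.
rewrite /fluxg E /flx /gradg /Xg /= /GRing.scale/= -sqrtg_sqr; split=> //.
by field; rewrite gt_eqF.
Qed.

Lemma Xg_C1 A W D : classical_upto A W D -> exists E1 E2,
  C1_upto A (fun z => (Xg D z).1) E1 /\ C1_upto A (fun z => (Xg D z).2) E2.
Proof.
move=> cW; have [D1 C1] := classical_C1_1 cW; have [D2 C2] := classical_C1_2 cW.
have [s ds cs] := sqrtg_C1.
have dV (x : R) : is_derive x 1 (fun x => (sqrtg x)^-1) (- (sqrtg x) ^- 2 * s x).
  by apply: is_deriveV; rewrite gt_eqF// sqrtg_gt0.
have cV : continuous (fun x => - (sqrtg x) ^- 2 * s x).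
  move=> x; apply: cvgM; last exact: cs.
  apply: cvgN; apply: cvgV; first by rewrite expf_neq0// gt_eqF// sqrtg_gt0.
  by apply: cvgM; exact: sqrtg_continuous.
have := C1_upto_mul C1 (C1_upto_fst A dV cV); move=> C1'.
by eexists; eexists; split; [exact: C1'|exact: C2].
Qed.

(** After multiplication by the metric density, the Riemannian divergence is the plain divergence of
    a field written with [flx], to which the rectangle theorem applies. *)
Lemma flux_C1 A W D : classical_upto A W D -> exists D1 D2,
  [/\ C1_upto A (fun z => (flx (Xg D z)).1) D1,
   C1_upto A (fun z => sqrtg z.1 * (flx (Xg D z)).2) D2 &
   forall z, A z -> (D1 z).1 + (D2 z).2 = sqrtg z.1 * divg G (fluxg G alpha beta D) z].
Proof.
move=> cW; have [E1 [E2 [C1 C2]]] := Xg_C1 cW.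
have [F1 [F2 [H1 H2]]] := flx_C1 alpha_gt0 beta_ge0 C1 C2.
have [s ds cs] := sqrtg_C1.
have Cs := C1_upto_mul (C1_upto_fst A ds cs) H2.
exists F1; eexists; split; [exact: H1|exact: Cs|move=> z Az].
have -> : sqrtg z.1 * divg G (fluxg G alpha beta D) z =
    div (fun z => ((flx (Xg D z)).1, sqrtg z.1 * (flx (Xg D z)).2)) z.
  have s0 : Num.sqrt (detg G z) != 0 by rewrite gt_eqF// (sqrtg_gt0 z.1).
  rewrite /divg -[sqrtg z.1]/(Num.sqrt (detg G z)) [LHS]mulrC divfK; last exact: s0.
  congr (div _ z).
  apply/funext => w; have [<- <-] := flux_components D w.
  by case: (fluxg _ _ _ _ _).
symmetry; exact: (@div_C1 _ A (fun z => ((flx (Xg D z)).1, sqrtg z.1 * (flx (Xg D z)).2)) _ _ _ H1 Cs Az).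
Qed.

Variables (kp Q : R).

(* The reduced equation expresses q through quantities that are continuous up to
   the boundary. *)
Lemma source_continuous h Wp DWp Wf DWf q : 0 < h ->
  reduced_problem G kp Q alpha beta h Wp DWp Wf DWf q ->
  exists2 k : R -> R, {within `[0, L G], continuous k} & forall u, 0 < u < L G -> k u = q u.
Proof.
move=> h0 rp; have [D1 [D2 [C1 C2 dv]]] := flux_C1 (rp_Wf rp).
have [_ c1 _ _ _] := rect_C1 L_gt0 h0 C1; have [_ _ c2 _ _] := rect_C1 L_gt0 h0 C2.
have h2 : 0 <= h / 2 <= h by apply/andP; split; lra.
(* The equation holds only inside the fracture; it is read off at mid-height. *)
exists (fun u => - h * (((D1 (u, h / 2)).1 + (D2 (u, h / 2)).2) * (sqrtg u)^-1 + Q / vol G h)).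
  apply: continuousM_within; first exact: continuous_cst_within.
  apply: continuousD_within; last exact: continuous_cst_within.
  apply: continuousM_within; first by apply: continuousD_within;
    [exact: (slice1_continuous h2 c1)|exact: (slice1_continuous h2 c2)].
  apply: continuous_subspaceT => u; apply: cvgV; first by rewrite gt_eqF// sqrtg_gt0.
  exact: sqrtg_continuous.
move=> u uL; have Az : Omf G h (u, h / 2).
  by split; rewrite /= in_itv//=; apply/andP; split; lra.
rewrite (dv _ Az); have := rp_eqf rp Az; rewrite /= => /eqP; rewrite eqr_oppLR => /eqP ->.
have s0 : sqrtg u != 0 by rewrite gt_eqF// sqrtg_gt0.
have hh : h != 0 by rewrite gt_eqF.
move: (Q / vol G h) => v.
by field; rewrite s0 hh.
Qed.

End Fracture.

(** * Energy identities in the two subdomains *)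

Section Energy.
Variable R : realType.
Local Notation mu := (@lebesgue_measure R).
Variable G : geometry R.
Variables kp Q alpha beta : R.
Hypotheses (kp_gt0 : 0 < kp) (Q_gt0 : 0 < Q) (alpha_gt0 : 0 < alpha) (beta_ge0 : 0 <= beta).
Local Notation arc := Defs.arc.
Local Notation A := (Omp G).
Local Notation flx := (flx alpha beta).
Local Notation sqrtg := (sqrtg G).
Local Notation Xg := (Xg G).

Lemma div_fluxp B W D z : classical_upto B W D -> B z -> div (fluxp kp D) z = kp * div D z.
Proof.
move=> cW Bz; have [D1 C1] := classical_C1_1 cW; have [D2 C2] := classical_C1_2 cW.
rewrite (div_C1 C1 C2 Bz).
rewrite (@div_C1 _ B (fluxp kp D) _ _ _ (C1_upto_scale kp C1) (C1_upto_scale kp C2) Bz).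
by rewrite mulrDr.
Qed.

(** The relation s = r * s' makes D - r D' divergence free. Taking r = 1 compares the two problems
    at the same h; taking r to be a ratio of volumes compares reduced solutions at different
    thicknesses. *)
Lemma green_difference (W W' : R * R -> R) D D' (r s s' : R) chi Dchi :
  classical_upto A W D -> classical_upto A W' D' ->
  (forall z, A z -> - div (fluxp kp D) z = s) -> (forall z, A z -> - div (fluxp kp D') z = s') ->
  s = r * s' ->
  (forall i t, ~~ is_well G i -> 0 < t < arc_len G (Some i) ->
    dotp (fluxp kp D (arc G (Some i) t)) (nu G (Some i) t) = 0) ->
  (forall i t, ~~ is_well G i -> 0 < t < arc_len G (Some i) ->
    dotp (fluxp kp D' (arc G (Some i) t)) (nu G (Some i) t) = 0) ->
  C1_upto A chi Dchi ->
  (forall i t, is_well G i -> 0 <= t <= arc_len G (Some i) -> chi (arc G (Some i) t) = 0) ->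
  kp * \int[leb2 R]_(z in A) dotp (D z - r *: D' z) (Dchi z) =
  - \int[mu]_(u in `]0, L G[) (sqrtg u * ((dotp (fluxp kp D (gam G u)) (nf G u)
       - r * dotp (fluxp kp D' (gam G u)) (nf G u)) * chi (gam G u))).
Proof.
move=> cW cW' dv dv' sr out out' Cx well.
have [D1 C1] := classical_C1_1 cW; have [D2 C2] := classical_C1_2 cW.
have [D1' C1'] := classical_C1_1 cW'; have [D2' C2'] := classical_C1_2 cW'.
have H1 := C1_upto_sub C1 (C1_upto_scale r C1'); have H2 := C1_upto_sub C2 (C1_upto_scale r C2').
have F1 := C1_upto_scale kp H1; have F2 := C1_upto_scale kp H2.
pose E z : R * R := kp *: (D z - r *: D' z).
have dotE z n : dotp (E z) n = dotp (fluxp kp D z) n - r * dotp (fluxp kp D' z) n.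
  by rewrite /E /fluxp /dotp /= /GRing.scale/=; ring.
have := @green R G E _ _ chi Dchi F1 F2 Cx.
have IE : \int[leb2 R]_(z in A) dotp (E z) (Dchi z) = kp * \int[leb2 R]_(z in A) dotp (D z - r *: D' z) (Dchi z).
  rewrite -RintegralZl//.
  - by apply: eq_Rintegral => z _; rewrite /E /dotp /= /GRing.scale/=; ring.
  - exact: open_measurable2 (pcd_open (Omp_domain G)).
  apply: (@continuous_integrable2 _ _ (closure A)) => //.
  - exact: pcd_open (Omp_domain G).
  - exact: subset_closure.
  - exact: dom_compact (Omp_domain G).
  have [[_ cx] _] := Cx.
  by apply: continuousD_within; apply: continuousM_within;
    [exact: H1.2|exact: continuous_fst_within|exact: H2.2|exact: continuous_snd_within].
have dE z : A z -> div E z = 0.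
  move=> Az; rewrite (@div_C1 _ A E _ _ _ F1 F2 Az).
  have := dv z Az; have := dv' z Az.
  rewrite (div_fluxp cW Az) (div_fluxp cW' Az) (div_C1 C1 C2 Az) (div_C1 C1' C2' Az) => e' e.
  transitivity (kp * ((D1 z).1 + (D2 z).2) - r * (kp * ((D1' z).1 + (D2' z).2))).
    by rewrite -[LHS]/(kp * ((D1 z).1 - r * (D1' z).1) + kp * ((D2 z).2 - r * (D2' z).2)); ring.
  by rewrite -[X in X - _]opprK e -[X in _ - r * X]opprK e' sr mulrN opprK addrC subrr.
move=> H; rewrite -IE H//.
  congr (- _); apply: eq_Rintegral => u _; by rewrite dotE.
by move=> i t wi tT; rewrite dotE out// out'// mulr0 subr0.
Qed.

Lemma right_edge_flux D y : ipg G (L G, y) (fluxg G alpha beta D (L G, y)) (n_fout G) = 0 ->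
  (flx (Xg D (L G, y))).1 = 0.
Proof.
have [<- _] := flux_components G alpha beta D (L G, y).
have d0 : detg G (L G, y) != 0 by rewrite gt_eqF// (lt_le_trans ltr01)// detg_ge1.
have s0 : Num.sqrt (detg G (L G, 0)) != 0 by rewrite gt_eqF// (sqrtg_gt0 G (L G)).
move: (fluxg _ _ _ _ _) => [a b]; rewrite /ipg /n_fout /= mulr0 addr0 => /eqP.
by rewrite !mulf_eq0 invr_eq0 (negbTE d0) (negbTE s0) orbF /= => /eqP ->; rewrite mulr0.
Qed.

Variable h : R.
Hypothesis h_gt0 : 0 < h.
Variables (Wp Wf Wbp Wbf : R * R -> R) (DWp DWf DWbp DWbf : R * R -> R * R) (q : R -> R).
Hypothesis op : original_problem G kp Q alpha beta h Wp DWp Wf DWf.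
Hypothesis rp : reduced_problem G kp Q alpha beta h Wbp DWbp Wbf DWbf q.

Definition mon (z : R * R) : R :=
  dotp (flx (Xg DWf z) - flx (Xg DWbf z)) (Xg DWf z - Xg DWbf z).

Lemma reduced_lambda z : Omf G h z -> (DWbf z).2 = 0.
Proof.
case: z => x y [/=]; rewrite !in_itv/= => xL yh.
have [_ _ _ _ d2] := rect_C1 (L_gt0 G) h_gt0 (classical_C1 (rp_Wf rp)).
have [dv <-] := d2 x y xL yh.
rewrite (@near_eq_derive _ _ _ _ (cst (Wbf (x, h / 2)))) ?derive_cst ?oner_eq0//.
have /andP[xL1 xL2] := xL; have /andP[y0 yh'] := yh.
near=> t; apply: (rp_indep rp); apply/andP; split; apply: ltW => //.
- by near: t; exact: lt_nbhsr.
- by near: t; exact: lt_nbhsl.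
- by rewrite divr_gt0.
- by lra.
Unshelve. all: by end_near. Qed.

(** The independence of lambda is differentiated inside the fracture; the edges follow because
    [DWbf] is the continuous extension. *)
Lemma reduced_lambda_closed z : crect 0 (L G) 0 h z -> (DWbf z).2 = 0.
Proof.
have [_ _ c2 _ _] := rect_C1 (L_gt0 G) h_gt0 (classical_C1 (rp_Wf rp)).
move=> Kz; have cl : closure (orect 0 (L G) 0 h) z by rewrite closure_orect// L_gt0.
apply/eqP; apply: contraT => nz.
have c0 : 0 < `|(DWbf z).2| by rewrite normr_gt0.
have /subspace_continuousP/(_ z Kz)/cvgrPdist_lt/(_ _ c0) := c2.
rewrite near_withinE => /cl[w [Aw /(_ (orect_crect Aw)) lt]].
have : `|(DWbf z).2 - (DWbf w).2| < `|(DWbf z).2| := lt.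
by rewrite (reduced_lambda Aw) subr0 ltxx.
Qed.

(** The difference of the fracture equations is tested with w. It vanishes on the well, neither flux
    crosses u = L, and neither crosses lambda = 0; at the top the reduced flux has no lambda
    component, so only the flux of the original problem survives. It is returned as a function T
    continuous on the closed interval, which k also is in the applications. *)
Lemma fracture_energy (k : R -> R) : (forall u, 0 < u < L G -> k u = q u) ->
  exists2 T : R -> R, {within `[0, L G], continuous T} &
  (forall u, 0 < u < L G -> T u = sqrtg u * dotp (fluxp kp DWp (gam G u)) (nf G u)) /\
  \int[leb2 R]_(z in Omf G h) (sqrtg z.1 * mon z + sqrtg z.1 * (k z.1 / h) * (Wf z - Wbf z)) =
  \int[mu]_(u in `]0, L G[) (T u * (Wf (u, h) - Wbf (u, h))).
Proof.
move=> kq.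
have [D1 [D2 [C1 C2 dv]]] := flux_C1 G alpha_gt0 beta_ge0 (op_Wf op).
have [E1 [E2 [B1 B2 dvb]]] := flux_C1 G alpha_gt0 beta_ge0 (rp_Wf rp).
have Cw := C1_upto_sub (classical_C1 (op_Wf op)) (classical_C1 (rp_Wf rp)).
have P1 := C1_upto_mul (C1_upto_sub C1 B1) Cw; have P2 := C1_upto_mul (C1_upto_sub C2 B2) Cw.
have [m1 m2 _ m4 _] := rect_C1 (L_gt0 G) h_gt0 P1.
have [n1 _ n3 _ n5] := rect_C1 (L_gt0 G) h_gt0 P2.
have [t1 _ _ _ _] := rect_C1 (L_gt0 G) h_gt0 C2.
have E := rect_divergence (L_gt0 G) h_gt0 m1 m2 n1 n3 m4 n5.
exists (fun u => sqrtg u * (flx (Xg DWf (u, h))).2).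
  by apply: (slice1_continuous _ t1); rewrite lexx ltW.
split.
  move=> u uL; have [_ <-] := flux_components G alpha beta DWf (u, h).
  by rewrite (op_flux op uL) /ipg /nf_top /=; ring.
transitivity (\int[leb2 R]_(z in orect 0 (L G) 0 h)
   (((flx (Xg DWf z)).1 - (flx (Xg DWbf z)).1) * ((DWf z - DWbf z).1) +
        (Wf z - Wbf z) * ((D1 z - E1 z).1) +
    ((sqrtg z.1 * (flx (Xg DWf z)).2 - sqrtg z.1 * (flx (Xg DWbf z)).2) * ((DWf z - DWbf z).2) +
        (Wf z - Wbf z) * ((D2 z - E2 z).2)))).
  apply: eq_Rintegral => z; rewrite inE => Az.
  have zL : 0 < z.1 < L G by move: Az => -[]; rewrite /= in_itv.
  have := dv z Az; have := dvb z Az.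
  have := op_eqf op Az => /(congr1 -%R); rewrite opprK => ->.
  have := rp_eqf rp Az => /(congr1 -%R); rewrite opprK => -> e2 e1.
  have s0 : sqrtg z.1 != 0 by rewrite gt_eqF// sqrtg_gt0.
  transitivity (sqrtg z.1 * mon z + (Wf z - Wbf z) * (((D1 z).1 + (D2 z).2) - ((E1 z).1 + (E2 z).2))).
    rewrite e1 e2 kq//; ring.
  rewrite /mon; move: (flx (Xg DWf z)) (flx (Xg DWbf z)) => F1 F2.
  rewrite /dotp /Xg /=.
  by field.
have bottom u : 0 < u < L G -> (flx (Xg DWf (u, 0))).2 = 0.
  move=> uL; have [_ <-] := flux_components G alpha beta DWf (u, 0).
  by have := op_sym op uL; rewrite /ipg /n_sym /= mulr0 add0r mulrN1 => /eqP; rewrite oppr_eq0 => /eqP.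
have lam0 u l : 0 <= u <= L G -> 0 <= l <= h -> (flx (Xg DWbf (u, l))).2 = 0.
  move=> uL lh; rewrite /flx /Xg /= reduced_lambda_closed; last first.
    by split; rewrite /= in_itv.
  exact: mulr0.
rewrite E Rintegral_eq0 ?add0r; last first.
  move=> y yin; have yh : 0 < y < h by move: yin; rewrite /= in_itv.
  have yh' : 0 <= y <= h by case/andP: yh => /ltW -> /ltW ->.
  rewrite (op_wellf op)// (rp_wellf rp)// (right_edge_flux (op_fout op yh)) (right_edge_flux (rp_fout rp yh)).
  by rewrite !subrr mul0r mulr0 subrr.
apply: eq_Rintegral => u uin; have uL : 0 < u < L G by move: uin; rewrite inE/= in_itv.
have uL' : 0 <= u <= L G by case/andP: uL => /ltW -> /ltW ->.
have hh : 0 <= h <= h by rewrite lexx (ltW h_gt0).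
have h00 : (0 : R) <= 0 <= h by apply/andP; split; [exact: lexx|exact: ltW].
rewrite (bottom u uL) (lam0 u 0 uL' h00) (lam0 u h uL' hh).
rewrite -[sqrtg (u, h).1]/(sqrtg u) -[sqrtg (u, 0).1]/(sqrtg u) !mulr0 !subr0 mul0r subr0.
by [].
Qed.

End Energy.

(** * Bounds on reduced solutions, uniform in the thickness *)

Section Bounds.
Variable R : realType.
Local Notation mu := (@lebesgue_measure R).
Variable G : geometry R.
Variables kp Q alpha beta : R.
Hypotheses (kp_gt0 : 0 < kp) (Q_gt0 : 0 < Q) (alpha_gt0 : 0 < alpha) (beta_ge0 : 0 <= beta).
Local Notation A := (Omp G).
Local Notation flx := (flx alpha beta).
Local Notation sqrtg := (sqrtg G).
Local Notation Xg := (Xg G).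

Lemma XgE D z : (D z).1 = sqrtg z.1 * (Xg D z).1.
Proof. by rewrite /Xg [RHS]mulrC divfK// gt_eqF// sqrtg_gt0. Qed.

Lemma vol_ge h : fine (leb2 R A) <= vol G h.
Proof. by rewrite lerDl; apply: Rintegral_ge0 => z _; exact: sqrtr_ge0. Qed.

Lemma Omp_measure_gt0 : 0 < fine (leb2 R A).
Proof. by have [m m0 ->] := Omp_measure G. Qed.

(** Since |Omega| >= |Omega_p|, the source of the reduced equation is bounded independently of h.
    Integrating from the closed end u = L bounds the flux; inverting the law and integrating from
    the well u = 0 bounds the trace. *)
Lemma reduced_bounds C0 : 0 <= C0 -> exists B K1, [/\ 0 <= B, 0 <= K1 &
  forall h Wp DWp Wf DWf q, 0 < h -> reduced_problem G kp Q alpha beta h Wp DWp Wf DWf q ->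
    (forall u, 0 < u < L G -> `|q u / h| <= C0) ->
    (forall z, Omf G h z -> enorm (flx (Xg DWf z)) <= B) /\
    (forall u, 0 <= u <= L G -> `|Wf (u, h)| <= K1)].
Proof.
move=> C00; have [M M1 HM] := sqrtg_bound G; have m0 := Omp_measure_gt0.
have M0 : 0 <= M by exact: le_trans M1.
have L0 := L_gt0 G.
pose m := fine (leb2 R A); pose B := M * (Q / m + C0) * L G.
have Qm : 0 <= Q / m + C0 by apply: addr_ge0 => //; apply: divr_ge0; exact: ltW.
have L0' := ltW L0.
have B0 : 0 <= B by apply: mulr_ge0 => //; exact: mulr_ge0.
have ab0 : 0 <= alpha + beta * B by apply: addr_ge0; [exact: ltW|exact: mulr_ge0].
exists B, (M * ((alpha + beta * B) * B) * L G); split => //.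
  by apply: mulr_ge0 => //; apply: mulr_ge0 => //; exact: mulr_ge0.
move=> h Wp DWp Wf DWf q h0 rp qC.
have [D1 [D2 [C1 C2 dv]]] := flux_C1 G alpha_gt0 beta_ge0 (rp_Wf rp).
have [f1 _ _ f4 _] := rect_C1 L0 h0 C1; have [_ _ _ _ g5] := rect_C1 L0 h0 C2.
have lam0 z : Omf G h z -> (flx (Xg DWf z)).2 = 0.
  by move=> Az; rewrite /flx /Xg /= (reduced_lambda h0 rp Az); exact: mulr0.
(* The flux has no lambda component at all, so the equation is an ODE in u at each height. *)
have D20 x y : 0 < x < L G -> 0 < y < h -> (D2 (x, y)).2 = 0.
  move=> xL yh; have [_ <-] := g5 x y xL yh.
  rewrite (@near_eq_derive _ _ _ _ (cst 0)) ?derive_cst//.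
  have /andP[y0 yh'] := yh.
  near=> t; rewrite lam0 ?mulr0//; split; rewrite /= in_itv//=; apply/andP; split.
  - by near: t; exact: lt_nbhsr.
  - by near: t; exact: lt_nbhsl.
have D1b x y : 0 < x < L G -> 0 < y < h -> `|(D1 (x, y)).1| <= M * (Q / m + C0).
  move=> xL yh; have Az : Omf G h (x, y) by split; rewrite /= in_itv.
  have := dv _ Az; rewrite (D20 _ _ xL yh) addr0 => ->.
  have := rp_eqf rp Az => /(congr1 -%R); rewrite opprK => -> /=.
  have xL' : 0 <= x <= L G by case/andP: xL => /ltW -> /ltW ->.
  rewrite normrM normrN; apply: ler_pM => //.
    by rewrite ger0_norm; [exact: HM|exact: ltW (sqrtg_gt0 G x)].
  apply: le_trans (ler_normD _ _) _; apply: lerD; last exact: qC.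
  have v0 : 0 < vol G h by apply: lt_le_trans m0 (vol_ge h).
  rewrite ger0_norm; last by apply: divr_ge0; exact: ltW.
  by apply: ler_wpM2l; [exact: ltW|rewrite lef_pV2 ?posrE//; exact: vol_ge].
have bnd z : Omf G h z -> enorm (flx (Xg DWf z)) <= B.
  case: z => x y Az; have := Az; rewrite /Omf /= => -[]; rewrite /= !in_itv/= => xL yh.
  have yh' : 0 <= y <= h by case/andP: yh => /ltW -> /ltW ->.
  rewrite /enorm lam0// expr0n addr0 sqrtr_sqr.
  have := mean_value_bound (slice1_continuous yh' f1) (fun x' xL' => f4 x' y xL' yh) (fun x' xL' => D1b x' y xL' yh).
  move=> /(_ x (L G)); rewrite (right_edge_flux (rp_fout rp yh)) !subr0; apply.
  - by case/andP: xL => /ltW -> /ltW ->.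
  - by rewrite lexx ltW.
split => // u uL.
(* Derivatives are controlled inside only, so the trace is evaluated at mid-height. *)
have yh : 0 < h / 2 < h by apply/andP; split; lra.
have yh' : 0 <= h / 2 <= h by case/andP: yh => /ltW -> /ltW ->.
rewrite (rp_indep rp (l' := h / 2) uL)//; last by rewrite lexx ltW.
have [w1 _ _ w4 _] := rect_C1 L0 h0 (classical_C1 (rp_Wf rp)).
have Db x : 0 < x < L G -> `|(DWf (x, h / 2)).1| <= M * ((alpha + beta * B) * B).
  move=> xL; have Az : Omf G h (x, h / 2) by split; rewrite /= in_itv.
  have xL' : 0 <= x <= L G by case/andP: xL => /ltW -> /ltW ->.
  rewrite XgE.
  rewrite normrM (gtr0_norm (sqrtg_gt0 G x)); apply: ler_pM => //; [exact: ltW (sqrtg_gt0 G x)|exact: HM|].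
  rewrite (flx_inv alpha_gt0 beta_ge0 (Xg DWf (x, h / 2))).
  have b1 := bnd _ Az; have e0 := enorm_ge0 (flx (Xg DWf (x, h / 2))).
  have [c1 _] := le_enorm (flx (Xg DWf (x, h / 2))).
  rewrite [X in `|X|]/= -[X in `|X|]/(_ * _) normrM; apply: ler_pM => //; last exact: le_trans b1.
  rewrite ger0_norm; last by apply: addr_ge0; [exact: ltW|exact: mulr_ge0].
  by rewrite lerD2l ler_wpM2l.
have := mean_value_bound (slice1_continuous yh' w1) (fun x' xL' => w4 x' _ xL' yh) Db.
move=> /(_ u 0 uL); rewrite (rp_wellf rp yh') !subr0; apply.
by rewrite lexx ltW.
Unshelve. all: by end_near. Qed.

End Bounds.

(** * Comparison of the two problems *)

Section Comparison.
Variable R : realType.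
Local Notation mu := (@lebesgue_measure R).
Variable G : geometry R.
Variables kp Q alpha beta : R.
Hypotheses (kp_gt0 : 0 < kp) (Q_gt0 : 0 < Q) (alpha_gt0 : 0 < alpha) (beta_ge0 : 0 <= beta).
Local Notation A := (Omp G).
Local Notation flx := (flx alpha beta).
Local Notation sqrtg := (sqrtg G).
Local Notation Xg := (Xg G).

Variable h : R.
Hypothesis h_gt0 : 0 < h.
Variables (Wp Wf Wbp Wbf : R * R -> R) (DWp DWf DWbp DWbf : R * R -> R * R) (q k : R -> R).
Hypothesis op : original_problem G kp Q alpha beta h Wp DWp Wf DWf.
Hypothesis rp : reduced_problem G kp Q alpha beta h Wbp DWbp Wbf DWbf q.
Hypothesis ck : {within `[0, L G], continuous k}.
Hypothesis kq : forall u, 0 < u < L G -> k u = q u.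
Local Notation v := (fun z => Wp z - Wbp z).
Local Notation Dv := (fun z => DWp z - DWbp z).
Local Notation w := (fun z => Wf z - Wbf z).
Local Notation Dw := (fun z => DWf z - DWbf z).
Local Notation mon := (mon G alpha beta DWf DWbf).
Local Notation K := (crect 0 (L G) 0 h).

Lemma v_C1 : C1_upto A v Dv.
Proof. exact: C1_upto_sub (classical_C1 (op_Wp op)) (classical_C1 (rp_Wp rp)). Qed.

Lemma w_C1 : C1_upto (orect 0 (L G) 0 h) w Dw.
Proof. exact: C1_upto_sub (classical_C1 (op_Wf op)) (classical_C1 (rp_Wf rp)). Qed.

Lemma v_well i t : is_well G i -> 0 <= t <= arc_len G (Some i) -> v (Defs.arc G (Some i) t) = 0.
Proof. by move=> wi tT /=; rewrite (op_wellp op wi tT) (rp_wellp rp wi tT) subrr. Qed.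

Lemma v_top u : 0 < u < L G -> v (gam G u) = w (u, h).
Proof.
by move=> /andP[/ltW u0 /ltW uL]; rewrite (op_match op) ?u0// (rp_match rp) ?u0.
Qed.

Lemma sqrtg_within : {within `[0, L G], continuous sqrtg}.
Proof. by apply: continuous_subspaceT; exact: sqrtg_continuous. Qed.

Lemma weighted_mon_continuous : {within K, continuous (fun z => sqrtg z.1 * mon z)}.
Proof.
have L0 := L_gt0 G.
have [E1 [E2 [X1 X2]]] := Xg_C1 G (op_Wf op); have [F1 [F2 [Y1 Y2]]] := Xg_C1 G (rp_Wf rp).
have [G1 [G2 [V1 V2]]] := flx_C1 alpha_gt0 beta_ge0 X1 X2.
have [H1 [H2 [U1 U2]]] := flx_C1 alpha_gt0 beta_ge0 Y1 Y2.
have c B F : C1_upto (Omf G h) B F -> {within K, continuous B}.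
  by move=> /(rect_C1 L0 h_gt0)[].
apply: continuousM_within; first exact: fst_within sqrtg_within.
apply: continuousD_within; apply: continuousM_within; apply: continuousB_within.
- exact: c V1. - exact: c U1. - exact: c X1. - exact: c Y1.
- exact: c V2. - exact: c U2. - exact: c X2. - exact: c Y2.
Qed.

Lemma w_continuous : {within K, continuous w}.
Proof. by have [] := rect_C1 (L_gt0 G) h_gt0 w_C1. Qed.

(** The energy identities of the two subdomains are added: as v and w agree on Gamma_f, the unknown
    flux of the original problem cancels and only the reduced flux q remains. *)
Lemma comparison_identity :
  kp * \int[leb2 R]_(z in A) dotp (Dv z) (Dv z) + \int[leb2 R]_(z in Omf G h) (sqrtg z.1 * mon z) =
  \int[mu]_(u in `]0, L G[) (sqrtg u * k u * w (u, h)) -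
  \int[leb2 R]_(z in Omf G h) (sqrtg z.1 * k z.1 / h * w z).
Proof.
have L0 := L_gt0 G.
have [T cT [TE E]] := fracture_energy alpha_gt0 beta_ge0 h_gt0 op rp kq.
have csk : {within `[0, L G], continuous (fun u => sqrtg u * k u)}.
  by apply: continuousM_within => //; exact: sqrtg_within.
have cskh : {within K, continuous (fun z => sqrtg z.1 * k z.1 / h * w z)}.
  apply: continuousM_within; last exact: w_continuous.
  apply: continuousM_within; last exact: continuous_cst_within.
  exact: (fst_within csk).
have cwh : {within `[0, L G], continuous (fun u => w (u, h))}.
  by apply: (slice1_continuous _ w_continuous); rewrite lexx ltW.
have {}E : \int[leb2 R]_(z in Omf G h) (sqrtg z.1 * mon z) +
   \int[leb2 R]_(z in Omf G h) (sqrtg z.1 * k z.1 / h * w z) = \int[mu]_(u in `]0, L G[) (T u * w (u, h)).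
  rewrite -E -rectD//; last exact: weighted_mon_continuous.
  by apply: eq_Rintegral => z _; rewrite mulrA.
have dvp z : A z -> - div (fluxp kp DWp) z = Q / vol G h by exact: op_eqp op z.
have dvb z : A z -> - div (fluxp kp DWbp) z = Q / vol G h by exact: rp_eqp rp z.
have := green_difference (op_Wp op) (rp_Wp rp) dvp dvb (esym (mul1r _)) (op_out op) (rp_out rp) v_C1 v_well.
under eq_Rintegral do rewrite scale1r.
move=> ->.
have -> : \int[mu]_(u in `]0, L G[) (sqrtg u * ((dotp (fluxp kp DWp (gam G u)) (nf G u) -
     1 * dotp (fluxp kp DWbp (gam G u)) (nf G u)) * (Wp (gam G u) - Wbp (gam G u)))) =
  \int[mu]_(u in `]0, L G[) (T u * w (u, h)) - \int[mu]_(u in `]0, L G[) (sqrtg u * k u * w (u, h)).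
  rewrite -RintegralB//.
  - apply: eq_Rintegral => u uin; have uL : 0 < u < L G by move: uin; rewrite inE/= in_itv.
    rewrite (v_top uL) (TE _ uL) (kq uL) -(rp_flux rp uL) /influx.
    by rewrite -[w (u, h)]/(Wf (u, h) - Wbf (u, h)); ring.
  - by apply: oo_integrable; exact: continuousM_within.
  - by apply: oo_integrable; exact: continuousM_within.
by rewrite -E; ring.
Qed.

(** The case K = 0, h = 0 of [flux_monotone], with the norm of the given flux as its bound. *)
Lemma mon_ge0 z : 0 <= mon z.
Proof.
have [C C0 /(_ (Xg DWf z) (Xg DWbf z) 0 (lexx _))] :=
  flux_monotone alpha_gt0 beta_ge0 (enorm_ge0 (flx (Xg DWbf z))) (lexx 0).
by rewrite lexx !mul0r expr0n/= expr0n/= addr0 mulr0 addr0; apply.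
Qed.

Local Notation J1 := (\int[leb2 R]_(z in Omf G h) `|(Dw z).1|).
Local Notation J2 := (\int[leb2 R]_(z in Omf G h) `|(Dw z).2|).
Local Notation E := (\int[leb2 R]_(z in Omf G h) (sqrtg z.1 * mon z)).
Local Notation I := (\int[leb2 R]_(z in A) dotp (Dv z) (Dv z)).

Lemma Dw_continuous : {within K, continuous (fun z => `|(Dw z).1|)} /\
  {within K, continuous (fun z => `|(Dw z).2|)}.
Proof.
by have [_ c1 c2 _ _] := rect_C1 (L_gt0 G) h_gt0 w_C1; split; exact: within_norm.
Qed.

Lemma J1_ge0 : 0 <= J1. Proof. exact: Rintegral_ge0. Qed.

Variables M B C0 : R.
Hypotheses (M_ge1 : 1 <= M) (sqrtgM : forall u, 0 <= u <= L G -> sqrtg u <= M).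
Hypothesis qC : forall u, 0 < u < L G -> `|q u / h| <= C0.
Hypothesis bnd : forall z, Omf G h z -> enorm (flx (Xg DWbf z)) <= B.

(** The parameter t is free: thin fractures use t = h, thick ones t = 1. The extra factor M in the
    hypothesis pays for passing from the orthonormal components to the coordinate derivatives. *)
Lemma energy_bound (K' C t : R) : 0 <= K' -> 0 <= t -> 0 <= C ->
  (forall v w h, 0 <= h -> enorm (flx w) <= B -> K' * M * h * (`|v.1 - w.1| + `|v.2 - w.2|) <=
     dotp (flx v - flx w) (v - w) + C * (h ^+ 2 + h ^+ 3)) ->
  K' * t * (J1 + J2) <= E + C * (t ^+ 2 + t ^+ 3) * (L G * h).
Proof.
move=> K0 t0 C_ge0 mono; have [c1 c2] := Dw_continuous.
have cm := weighted_mon_continuous.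
have cc : {within K, continuous (fun=> C * (t ^+ 2 + t ^+ 3))} by exact: continuous_cst_within.
rewrite -rectD// -rectZ; last exact: continuousD_within.
have -> : C * (t ^+ 2 + t ^+ 3) * (L G * h) = \int[leb2 R]_(z in orect 0 (L G) 0 h) (C * (t ^+ 2 + t ^+ 3)).
  by rewrite rect_cst_integral ?L_gt0// !subr0.
rewrite -rectD//; apply: le_rect_integral.
- by apply: continuousM_within; [exact: continuous_cst_within|exact: continuousD_within].
- exact: continuousD_within.
move=> z Az; have zL : 0 <= z.1 <= L G.
  by move: Az => -[]; rewrite /= in_itv/= => /andP[/ltW -> /ltW ->].
have M0 : 0 <= M by exact: le_trans M_ge1.
have m0 := mon_ge0 z; have s1 := sqrtg_ge1 G z.1.
have le1 : mon z <= sqrtg z.1 * mon z by rewrite ler_peMl.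
apply: (@le_trans _ _ (mon z + C * (t ^+ 2 + t ^+ 3))); last by rewrite lerD2r.
apply: le_trans (mono _ _ _ t0 (bnd Az)).
have -> : K' * M * t * (`|(Xg DWf z).1 - (Xg DWbf z).1| + `|(Xg DWf z).2 - (Xg DWbf z).2|) =
  K' * t * (M * `|(Xg DWf z).1 - (Xg DWbf z).1| + M * `|(Xg DWf z).2 - (Xg DWbf z).2|) by ring.
apply: ler_wpM2l; first exact: mulr_ge0.
apply: lerD.
  rewrite -[(DWf z - DWbf z).1]/((DWf z).1 - (DWbf z).1) (XgE G DWf) (XgE G DWbf) -mulrBr normrM.
  by rewrite (gtr0_norm (sqrtg_gt0 G z.1)) ler_wpM2r// sqrtgM.
by rewrite -[(DWf z - DWbf z).2]/((Xg DWf z).2 - (Xg DWbf z).2) ler_peMl.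
Qed.

Lemma k_bound u : 0 < u < L G -> `|sqrtg u * k u / h| <= M * C0.
Proof.
move=> uL; have uL' : 0 <= u <= L G by case/andP: uL => /ltW -> /ltW ->.
rewrite -mulrA normrM (gtr0_norm (sqrtg_gt0 G u)); apply: ler_pM => //.
- exact: ltW (sqrtg_gt0 G u).
- exact: sqrtgM.
- by rewrite kq// qC.
Qed.

Lemma skh_continuous : {within `[0, L G], continuous (fun u => sqrtg u * k u / h)}.
Proof.
apply: continuousM_within; last exact: continuous_cst_within.
by apply: continuousM_within => //; exact: sqrtg_within.
Qed.

(** The reduced model spreads the top flux evenly over the thickness, so by [top_integral] the
    interior source cancels the zeroth-order part of the trace term. The surviving factor lambda, at
    most h, is the gain that yields the rate. *)
Lemma lambda_identity :
  kp * I + E = \int[leb2 R]_(z in Omf G h) (sqrtg z.1 * k z.1 / h * (z.2 * (Dw z).2)).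
Proof.
have L0 := L_gt0 G; have ch := skh_continuous; have cw := w_continuous.
have [_ _ c2 _ _] := rect_C1 L0 h_gt0 w_C1.
rewrite comparison_identity; apply/eqP; rewrite subr_eq; apply/eqP.
have cwh : {within `[0, L G], continuous (fun u => w (u, h))}.
  by apply: (slice1_continuous _ cw); rewrite lexx ltW.
rewrite -rectD//; first last.
- by apply: continuousM_within => //; exact: fst_within ch.
- apply: continuousM_within; first exact: fst_within ch.
  by apply: continuousM_within => //; exact: snd_continuous_within.
transitivity (h * \int[mu]_(u in `]0, L G[) (sqrtg u * k u / h * w (u, h))).
  rewrite -RintegralZl//; last by apply: oo_integrable; exact: continuousM_within.
  apply: eq_Rintegral => u _; have hh : h != 0 by rewrite gt_eqF.
  by field.
have := top_integral L0 h_gt0 w_C1 ch; rewrite subr0 => <-.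
by apply: eq_Rintegral => z _; rewrite subr0 -mulrDr addrC.
Qed.

Lemma lambda_bound : kp * I + E <= M * C0 * h * J2.
Proof.
have L0 := L_gt0 G; have ch := skh_continuous; have [_ c2] := Dw_continuous.
have [_ _ c2' _ _] := rect_C1 L0 h_gt0 w_C1.
rewrite lambda_identity -rectZ//; apply: le_rect_integral.
- apply: continuousM_within; first exact: fst_within ch.
  by apply: continuousM_within => //; exact: snd_continuous_within.
- by apply: continuousM_within => //; exact: continuous_cst_within.
move=> z [z1 z2]; have zL : 0 < z.1 < L G by move: z1; rewrite /= in_itv.
have zh : 0 < z.2 < h by move: z2; rewrite /= in_itv.
apply: (le_trans (ler_norm _)); rewrite normrM [X in _ * X]normrM mulrA.
apply: ler_wpM2r => //; apply: ler_pM => //; first exact: k_bound.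
by case/andP: zh => zh1 zh2; rewrite gtr0_norm// ltW.
Qed.

(** [energy_bound] with t = h cancels E; the cost C (h^2 + h^3) L h is at most 2 C L h^3 because h
    <= 1. *)
Lemma small_thickness (C : R) : 0 <= C0 -> 0 <= C -> h <= 1 ->
  (forall v w h, 0 <= h -> enorm (flx w) <= B -> M * C0 * M * h * (`|v.1 - w.1| + `|v.2 - w.2|) <=
     dotp (flx v - flx w) (v - w) + C * (h ^+ 2 + h ^+ 3)) ->
  kp * I <= 2 * C * L G * h ^+ 3.
Proof.
move=> C00 C_ge0 h1 mono.
have M0 : 0 <= M by exact: le_trans M_ge1.
have MC : 0 <= M * C0 by exact: mulr_ge0.
have eb := energy_bound MC (ltW h_gt0) C_ge0 mono.
have lb := lambda_bound.
have j1 : 0 <= M * C0 * h * J1 by rewrite mulr_ge0 ?J1_ge0// mulr_ge0// ltW.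
have : kp * I <= C * (h ^+ 2 + h ^+ 3) * (L G * h) by move: eb lb j1; rewrite mulrDr; lra.
move=> le; apply: (le_trans le).
have h2 : h ^+ 3 <= h ^+ 2 by rewrite ler_wiXn2l// ltW.
have CLh : 0 <= C * L G * h by rewrite !mulr_ge0// ?ltW// L_gt0.
have := ler_wpM2l CLh h2; rewrite (_ : h ^+ 3 = h * h ^+ 2) ?exprS//; nra.
Qed.

End Comparison.

(** * Fractures of thickness at least 1 *)

Section Large.
Variable R : realType.
Local Notation mu := (@lebesgue_measure R).
Variable G : geometry R.
Variables kp Q alpha beta : R.
Hypotheses (kp_gt0 : 0 < kp) (Q_gt0 : 0 < Q) (alpha_gt0 : 0 < alpha) (beta_ge0 : 0 <= beta).
Local Notation A := (Omp G).
Local Notation flx := (flx alpha beta).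
Local Notation sqrtg := (sqrtg G).
Local Notation Xg := (Xg G).

Lemma Omp_integrable (f : R * R -> R) : {within closure A, continuous f} ->
  (leb2 R).-integrable A (EFin \o f).
Proof.
apply: continuous_integrable2.
- exact: pcd_open (Omp_domain G).
- exact: subset_closure.
- exact: dom_compact (Omp_domain G).
Qed.

Lemma dot_continuous (D D' : R * R -> R * R) :
  {within closure A, continuous D} -> {within closure A, continuous D'} ->
  {within closure A, continuous (fun z => dotp (D z) (D' z))}.
Proof.
move=> cD cD'; by apply: continuousD_within; apply: continuousM_within;
  [exact: continuous_fst_within|exact: continuous_fst_within|
   exact: continuous_snd_within|exact: continuous_snd_within].
Qed.

Lemma dot_young (D D' : R * R -> R * R) :
  {within closure A, continuous D} -> {within closure A, continuous D'} ->
  - (\int[leb2 R]_(z in A) dotp (D z) (D' z)) <=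
  2^-1 * (\int[leb2 R]_(z in A) dotp (D z) (D z) + \int[leb2 R]_(z in A) dotp (D' z) (D' z)).
Proof.
move=> cD cD'; have mA : measurable A by exact: open_measurable2 (pcd_open (Omp_domain G)).
have c1 := dot_continuous cD cD; have c2 := dot_continuous cD' cD'; have c3 := dot_continuous cD cD'.
have c4 := continuousD_within c1 c2.
rewrite -RintegralD//; [|exact: Omp_integrable|exact: Omp_integrable].
rewrite -mulN1r -RintegralZl; [|exact: mA|exact: Omp_integrable].
rewrite -[leRHS]RintegralZl; [|exact: mA|exact: Omp_integrable].
apply: le_Rintegral => //.
- by apply: Omp_integrable; apply: continuousM_within => //; exact: continuous_cst_within.
- by apply: Omp_integrable; apply: continuousM_within => //; exact: continuous_cst_within.
move=> z _; rewrite /dotp.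
have := sqr_ge0 ((D z).1 + (D' z).1); have := sqr_ge0 ((D z).2 + (D' z).2).
by rewrite !expr2; lra.
Qed.

(** The arithmetic of [large_thickness]. Here a and p are kp times the energies of v and psi, Z is
    their mixed term, and P, P1, N integrate w against q, r q1 and the interior source. Replacing P
    by P1 - Z costs half of a, which is absorbed on the left. *)
Lemma absorb_half (a E P N P1 Z p X Y D F : R) : a + E = P - N -> Z = - (P - P1) ->
  - Z <= 2^-1 * (p + a) -> P1 <= X -> - N <= Y -> X + Y <= E + F -> p <= D -> a <= D + 2 * F.
Proof. by move=> ? ?; lra. Qed.

Variable h : R.
Hypothesis h_gt0 : 0 < h.
Variables (Wp Wf Wbp Wbf : R * R -> R) (DWp DWf DWbp DWbf : R * R -> R * R) (q k : R -> R).
Hypothesis op : original_problem G kp Q alpha beta h Wp DWp Wf DWf.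
Hypothesis rp : reduced_problem G kp Q alpha beta h Wbp DWbp Wbf DWbf q.
Hypothesis ck : {within `[0, L G], continuous k}.
Hypothesis kq : forall u, 0 < u < L G -> k u = q u.
Variables M B C0 K1 : R.
Hypotheses (M_ge1 : 1 <= M) (sqrtgM : forall u, 0 <= u <= L G -> sqrtg u <= M).
Hypothesis qC : forall u, 0 < u < L G -> `|q u / h| <= C0.
Hypothesis bnd : forall z, Omf G h z -> enorm (flx (Xg DWbf z)) <= B.
Hypothesis Wb1 : forall u, 0 <= u <= L G -> `|Wbf (u, h)| <= K1.

Variable h1 : R.
Hypothesis h1_gt0 : 0 < h1.
Variables (W1p W1f : R * R -> R) (D1p D1f : R * R -> R * R) (q1 k1 : R -> R).
Hypothesis rp1 : reduced_problem G kp Q alpha beta h1 W1p D1p W1f D1f q1.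
Hypothesis ck1 : {within `[0, L G], continuous k1}.
Hypothesis kq1 : forall u, 0 < u < L G -> k1 u = q1 u.
Hypothesis qC1 : forall u, 0 < u < L G -> `|q1 u / h1| <= C0.
Hypothesis W1b : forall u, 0 <= u <= L G -> `|W1f (u, h1)| <= K1.

Local Notation r := (vol G h1 / vol G h).
Local Notation v := (fun z => Wp z - Wbp z).
Local Notation Dv := (fun z => DWp z - DWbp z).
Local Notation w := (fun z => Wf z - Wbf z).
Local Notation Dw := (fun z => DWf z - DWbf z).
Local Notation psi := (fun z => Wbp z - r * W1p z).
Local Notation Dpsi := (fun z => DWbp z - r *: D1p z).
Local Notation K := (crect 0 (L G) 0 h).
Local Notation J1 := (\int[leb2 R]_(z in Omf G h) `|(Dw z).1|).
Local Notation J2 := (\int[leb2 R]_(z in Omf G h) `|(Dw z).2|).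
Local Notation E := (\int[leb2 R]_(z in Omf G h) (sqrtg z.1 * mon G alpha beta DWf DWbf z)).
Local Notation I := (\int[leb2 R]_(z in A) dotp (Dv z) (Dv z)).

Lemma vol_gt0 t : 0 < vol G t.
Proof. by apply: lt_le_trans (vol_ge G t); exact: Omp_measure_gt0. Qed.

(* The constant source terms of the two equations cancel in psi. *)
Lemma psi_green chi Dchi : C1_upto A chi Dchi ->
  (forall i t, is_well G i -> 0 <= t <= arc_len G (Some i) -> chi (Defs.arc G (Some i) t) = 0) ->
  kp * \int[leb2 R]_(z in A) dotp (Dpsi z) (Dchi z) =
  - \int[mu]_(u in `]0, L G[) (sqrtg u * (k u - r * k1 u) * chi (gam G u)).
Proof.
move=> Cx well.
have dvb z : A z -> - div (fluxp kp DWbp) z = Q / vol G h by exact: rp_eqp rp z.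
have dv1 z : A z -> - div (fluxp kp D1p) z = Q / vol G h1 by exact: rp_eqp rp1 z.
have Er : Q / vol G h = r * (Q / vol G h1).
  have v0 : vol G h != 0 by rewrite gt_eqF// vol_gt0.
  have v1 : vol G h1 != 0 by rewrite gt_eqF// vol_gt0.
  by field; rewrite v0 v1.
rewrite (green_difference (rp_Wp rp) (rp_Wp rp1) dvb dv1 Er (rp_out rp) (rp_out rp1) Cx well).
congr (- _); apply: eq_Rintegral => u uin; have uL : 0 < u < L G by move: uin; rewrite inE/= in_itv.
by rewrite kq// kq1// -(rp_flux rp uL) -(rp_flux rp1 uL) mulrA.
Qed.

Lemma psi_C1 : C1_upto A psi Dpsi.
Proof. exact: C1_upto_sub (classical_C1 (rp_Wp rp)) (C1_upto_scale r (classical_C1 (rp_Wp rp1))). Qed.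

Lemma psi_well i t : is_well G i -> 0 <= t <= arc_len G (Some i) -> psi (Defs.arc G (Some i) t) = 0.
Proof. by move=> wi tT /=; rewrite (rp_wellp rp wi tT) (rp_wellp rp1 wi tT) mulr0 subrr. Qed.

Lemma kk_bound u : 0 < u < L G -> `|k u| <= C0 * h /\ `|k1 u| <= C0 * h1.
Proof.
move=> uL; split; rewrite ?kq// ?kq1//.
  by have := qC uL; rewrite normrM normfV (gtr0_norm h_gt0) ler_pdivrMr.
by have := qC1 uL; rewrite normrM normfV (gtr0_norm h1_gt0) ler_pdivrMr.
Qed.

Lemma r_ge0 : 0 <= r. Proof. by apply: divr_ge0; apply: ltW; exact: vol_gt0. Qed.

(** Testing psi with itself leaves an integral over Gamma_f in which the flux is linear in h and the
    traces are bounded by K1. *)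
Lemma psi_energy :
  kp * \int[leb2 R]_(z in A) dotp (Dpsi z) (Dpsi z) <=
  M * (C0 * h + r * (C0 * h1)) * (K1 + r * K1) * L G.
Proof.
have L0 := L_gt0 G; have r0 := r_ge0.
rewrite (psi_green psi_C1 psi_well).
have -> : \int[mu]_(u in `]0, L G[) (sqrtg u * (k u - r * k1 u) * (Wbp (gam G u) - r * W1p (gam G u))) =
    \int[mu]_(u in `]0, L G[) (sqrtg u * (k u - r * k1 u) * (Wbf (u, h) - r * W1f (u, h1))).
  apply: eq_Rintegral => u uin; have : 0 < u < L G by move: uin; rewrite inE/= in_itv.
  by case/andP=> /ltW u0 /ltW uL; rewrite (rp_match rp) ?u0// (rp_match rp1) ?u0.
have [wb _ _ _ _] := rect_C1 L0 h_gt0 (classical_C1 (rp_Wf rp)).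
have [w1 _ _ _ _] := rect_C1 L0 h1_gt0 (classical_C1 (rp_Wf rp1)).
have cf : {within `[0, L G], continuous (fun u => sqrtg u * (k u - r * k1 u) * (Wbf (u, h) - r * W1f (u, h1)))}.
  apply: continuousM_within.
    apply: continuousM_within; first exact: sqrtg_within.
    by apply: continuousB_within => //; apply: continuousM_within => //; exact: continuous_cst_within.
  apply: continuousB_within; first by apply: (slice1_continuous _ wb); rewrite lexx ltW.
  apply: continuousM_within; first exact: continuous_cst_within.
  by apply: (slice1_continuous _ w1); rewrite lexx ltW.
apply: (le_trans (ler_norm _)); rewrite normrN.
have := @le_cst_integral _ _ _ _ (M * (C0 * h + r * (C0 * h1)) * (K1 + r * K1)) L0 cf.
rewrite subr0; apply; move=> u uL; have [b1 b2] := kk_bound uL.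
have uL' : 0 <= u <= L G by case/andP: uL => /ltW -> /ltW ->.
rewrite normrM normrM (gtr0_norm (sqrtg_gt0 G u)).
have tri a b c d : `|a| <= c -> `|b| <= d -> `|a - r * b| <= c + r * d.
  move=> ac bd; apply: le_trans (ler_normB _ _) _; apply: lerD => //.
  by rewrite normrM (ger0_norm r0) ler_wpM2l.
apply: ler_pM => //; [by rewrite mulr_ge0// ltW// sqrtg_gt0| |].
  by apply: ler_pM => //; [exact: ltW (sqrtg_gt0 G u)|exact: sqrtgM|exact: tri].
by apply: tri; [exact: Wb1|exact: W1b].
Qed.

(** By [top_integral], h times the trace integral is an interior integral, bounded by L * J1 since w
    vanishes on the well, plus a lambda term bounded by h * J2; dividing by h >= 1 leaves a factor
    independent of h. *)
Lemma top_bound : 1 <= h -> 0 <= C0 ->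
  `|\int[mu]_(u in `]0, L G[) (sqrtg u * k1 u * w (u, h))| <= M * (C0 * h1) * ((L G + 1) * (J1 + J2)).
Proof.
move=> h_ge1 C00; have L0 := L_gt0 G.
have M0 : 0 <= M by exact: le_trans M_ge1.
have cs : {within `[0, L G], continuous (fun u => sqrtg u * k1 u)}.
  by apply: continuousM_within => //; exact: sqrtg_within.
have Cw := w_C1 op rp; have [cw c1 c2 _ _] := rect_C1 L0 h_gt0 Cw.
have sb u : 0 < u < L G -> `|sqrtg u * k1 u| <= M * (C0 * h1).
  move=> uL; have [_ b2] := kk_bound uL.
  have uL' : 0 <= u <= L G by case/andP: uL => /ltW -> /ltW ->.
  by rewrite normrM (gtr0_norm (sqrtg_gt0 G u)); apply: ler_pM => //; [exact: ltW (sqrtg_gt0 G u)|exact: sqrtgM].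
have m0 : 0 <= M * (C0 * h1) by apply: mulr_ge0 => //; apply: mulr_ge0 => //; exact: ltW.
have j1 : 0 <= J1 by exact: Rintegral_ge0.
have j2 : 0 <= J2 by exact: Rintegral_ge0.
have top := top_integral L0 h_gt0 Cw cs.
have w0 y : 0 <= y <= h -> w (0, y) = 0.
  by move=> yh /=; rewrite (op_wellf op yh) (rp_wellf rp yh) subrr.
have left := left_zero_integral L0 h_gt0 Cw cs w0 sb; rewrite subr0 in left.
have csz := fst_within cs (a := 0) (b := L G) (c := 0) (d := h).
have lam : `|\int[leb2 R]_(z in orect 0 (L G) 0 h) (sqrtg z.1 * k1 z.1 * (z.2 * (Dw z).2))| <=
   M * (C0 * h1) * h * J2.
  rewrite -rectZ; last exact: within_norm.
  apply: le_trans (le_norm_rect _) _.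
    by apply: continuousM_within => //; apply: continuousM_within => //; exact: snd_continuous_within.
  apply: le_rect_integral.
  - apply: within_norm; apply: continuousM_within => //.
    by apply: continuousM_within => //; exact: snd_continuous_within.
  - by apply: continuousM_within; [exact: continuous_cst_within|exact: within_norm].
  move=> z [z1 z2]; have zL : 0 < z.1 < L G by move: z1; rewrite /= in_itv.
  have /andP[zh1 zh2] : 0 < z.2 < h by move: z2; rewrite /= in_itv.
  rewrite normrM [X in _ * X]normrM mulrA; apply: ler_wpM2r => //; apply: ler_pM => //.
    exact: sb.
  by rewrite gtr0_norm// ltW.
have {}top : h * \int[mu]_(u in `]0, L G[) (sqrtg u * k1 u * w (u, h)) =
   \int[leb2 R]_(z in orect 0 (L G) 0 h) (sqrtg z.1 * k1 z.1 * w z) +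
   \int[leb2 R]_(z in orect 0 (L G) 0 h) (sqrtg z.1 * k1 z.1 * (z.2 * (Dw z).2)).
  rewrite -rectD; first last.
  - by apply: continuousM_within => //; apply: continuousM_within => //; exact: snd_continuous_within.
  - exact: continuousM_within.
  move: top; rewrite subr0 => <-; apply: eq_Rintegral => z _.
  by rewrite subr0 -mulrDr.
have le1 : h * `|\int[mu]_(u in `]0, L G[) (sqrtg u * k1 u * w (u, h))| <=
    M * (C0 * h1) * L G * J1 + M * (C0 * h1) * h * J2.
  by rewrite -{1}(gtr0_norm h_gt0) -normrM top; apply: le_trans (ler_normD _ _) _; exact: lerD.
rewrite -(ler_pM2l h_gt0); apply: (le_trans le1).
have mL : 0 <= M * (C0 * h1) * L G * J1 by rewrite !mulr_ge0// ltW.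
have mL2 : 0 <= M * (C0 * h1) * L G * h * J2 by rewrite !mulr_ge0// ltW.
have mJ : 0 <= M * (C0 * h1) * h * J1 by rewrite !mulr_ge0// ltW.
have := ler_wpM2l mL h_ge1; rewrite mulr1 => le2.
have -> : h * (M * (C0 * h1) * ((L G + 1) * (J1 + J2))) =
  M * (C0 * h1) * L G * J1 * h + M * (C0 * h1) * L G * h * J2 + M * (C0 * h1) * h * J1
   + M * (C0 * h1) * h * J2 by ring.
rewrite lerD2r -[leLHS]addr0 -addrA; apply: lerD; first exact: le2.
exact: addr_ge0.
Qed.

Lemma large_thickness C r0 : 1 <= h -> 0 <= C0 -> 0 <= K1 -> 0 <= C -> r <= r0 ->
  (forall v w h, 0 <= h -> enorm (flx w) <= B ->
     (M * C0 * L G + r0 * (M * (C0 * h1)) * (L G + 1)) * M * h * (`|v.1 - w.1| + `|v.2 - w.2|) <=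
     dotp (flx v - flx w) (v - w) + C * (h ^+ 2 + h ^+ 3)) ->
  kp * I <= (M * (C0 + r0 * (C0 * h1)) * (K1 + r0 * K1) * L G + 4 * C * L G) * h.
Proof.
move=> h_ge1 C00 K10 C_ge0 rr0 mono.
have L0 := L_gt0 G; have r_0 := r_ge0; have M0 : 0 <= M by exact: le_trans M_ge1.
have r00 : 0 <= r0 by exact: le_trans rr0.
have m0 : 0 <= M * (C0 * h1) by apply: mulr_ge0 => //; apply: mulr_ge0 => //; exact: ltW.
have K0 : 0 <= M * C0 * L G + r0 * (M * (C0 * h1)) * (L G + 1).
  apply: addr_ge0; first by apply: mulr_ge0; [exact: mulr_ge0|exact: ltW].
  by apply: mulr_ge0; [exact: mulr_ge0|rewrite addr_ge0// ltW].
have j1 : 0 <= J1 by exact: Rintegral_ge0.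
have j2 : 0 <= J2 by exact: Rintegral_ge0.
(* Here t = 1: the data paired with w, namely q1 and q / h, are both bounded independently of h. *)
have eb := energy_bound alpha_gt0 beta_ge0 h_gt0 op rp M_ge1 sqrtgM bnd K0 ler01 C_ge0 mono.
have tb := top_bound h_ge1 C00.
have pe := psi_energy.
have id := comparison_identity alpha_gt0 beta_ge0 h_gt0 op rp ck kq.
have gr := psi_green (v_C1 op rp) (v_well op rp).
have csk1 : {within `[0, L G], continuous (fun u => sqrtg u * k1 u)}.
  by apply: continuousM_within => //; exact: sqrtg_within.
have csk : {within `[0, L G], continuous (fun u => sqrtg u * k u)}.
  by apply: continuousM_within => //; exact: sqrtg_within.
have cwh : {within `[0, L G], continuous (fun u => w (u, h))}.
  by apply: (slice1_continuous _ (w_continuous h_gt0 op rp)); rewrite lexx ltW.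
have {}gr : kp * \int[leb2 R]_(z in A) dotp (Dpsi z) (Dv z) =
   - (\int[mu]_(u in `]0, L G[) (sqrtg u * k u * w (u, h)) -
      r * \int[mu]_(u in `]0, L G[) (sqrtg u * k1 u * w (u, h))).
  rewrite gr -RintegralZl//; last by apply: oo_integrable; exact: continuousM_within.
  rewrite -RintegralB//.
  - congr (- _); apply: eq_Rintegral => u uin; have uL : 0 < u < L G by move: uin; rewrite inE/= in_itv.
    have e := v_top op rp uL; rewrite /= in e; rewrite e; ring.
  - by apply: oo_integrable; exact: continuousM_within.
  - apply: oo_integrable; apply: continuousM_within; first exact: continuous_cst_within.
    exact: continuousM_within.
have [[_ cDv] _] := v_C1 op rp; have [[_ cDpsi] _] := psi_C1.
have dy := dot_young cDpsi cDv.
have w0 y : 0 <= y <= h -> w (0, y) = 0.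
  by move=> yh /=; rewrite (op_wellf op yh) (rp_wellf rp yh) subrr.
have left := left_zero_integral L0 h_gt0 (w_C1 op rp) (skh_continuous (h := h) ck) w0
  (k_bound kq sqrtgM qC).
rewrite subr0 in left.
(* The terms free of h are multiplied by h >= 1, and r is replaced by its bound r0, so that one
   constant serves all h. *)
have hr : M * (C0 * h + r * (C0 * h1)) * (K1 + r * K1) * L G <=
    M * (C0 + r0 * (C0 * h1)) * (K1 + r0 * K1) * L G * h.
  have c1 : 0 <= C0 * h1 by apply: mulr_ge0 => //; exact: ltW.
  have c2 : C0 * h + r * (C0 * h1) <= (C0 + r0 * (C0 * h1)) * h.
    rewrite [leRHS]mulrDl lerD2l; apply: (@le_trans _ _ (r0 * (C0 * h1))); first exact: ler_wpM2r.
    by rewrite ler_peMr// mulr_ge0.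
  have c3 : K1 + r * K1 <= K1 + r0 * K1 by rewrite lerD2l ler_wpM2r.
  have -> : M * (C0 + r0 * (C0 * h1)) * (K1 + r0 * K1) * L G * h =
    M * ((C0 + r0 * (C0 * h1)) * h) * (K1 + r0 * K1) * L G by ring.
  apply: ler_wpM2r; first exact: ltW.
  apply: ler_pM => //; [|by rewrite addr_ge0// mulr_ge0|exact: ler_wpM2l].
  apply: mulr_ge0 => //; apply: addr_ge0; apply: mulr_ge0 => //; exact: ltW.
have tb' : r * \int[mu]_(u in `]0, L G[) (sqrtg u * k1 u * w (u, h)) <=
    r0 * (M * (C0 * h1)) * (L G + 1) * (J1 + J2).
  apply: (@le_trans _ _ (r * (M * (C0 * h1) * ((L G + 1) * (J1 + J2))))).
    by apply: ler_wpM2l => //; apply: le_trans tb; exact: ler_norm.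
  rewrite [leRHS](_ : _ = r0 * (M * (C0 * h1) * ((L G + 1) * (J1 + J2)))); last by ring.
  apply: ler_wpM2r => //; apply: mulr_ge0 => //; apply: mulr_ge0; last exact: addr_ge0.
  by apply: addr_ge0 => //; exact: ltW.
have left' := le_trans (ler_norm _) (eq_ind_r (fun x => x <= _) left (normrN _)).
have Kj : M * C0 * L G * J1 <= M * C0 * L G * (J1 + J2).
  by apply: ler_wpM2l; [apply: mulr_ge0; [exact: mulr_ge0|exact: ltW]|rewrite lerDl].
have dy' := ler_wpM2l (ltW kp_gt0) dy; rewrite mulrN in dy'.
rewrite [leRHS](_ : _ = kp * (2^-1 * (\int[leb2 R]_(z in A) dotp (Dpsi z) (Dpsi z) + I))) in dy'; last by [].
rewrite mulrCA mulrDr in dy'.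
have eb' : r0 * (M * (C0 * h1)) * (L G + 1) * (J1 + J2) + M * C0 * L G * (J1 + J2) <= E + 2 * C * L G * h.
  by move: eb; rewrite mulr1 !expr1n mulrDl [leRHS](_ : _ = E + 2 * C * L G * h) 1?addrC//; ring.
rewrite [leRHS](_ : _ = M * (C0 + r0 * (C0 * h1)) * (K1 + r0 * K1) * L G * h + 2 * (2 * C * L G * h)); last by ring.
exact: (absorb_half id gr dy' tb' (le_trans left' Kj) eb' (le_trans pe hr)).
Qed.

End Large.

(** * Assembly of the estimate *)

Lemma sqnorm_gradE (R : realType) (G : geometry R) v Dv : C1_upto (Omp G) v Dv ->
  sqnorm_grad G v = (\int[leb2 R]_(z in Omp G) dotp (Dv z) (Dv z))%:E.
Proof.
move=> [[dv cv] _]; rewrite /sqnorm_grad.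
transitivity (\int[leb2 R]_(z in Omp G) (dotp (Dv z) (Dv z))%:E)%E.
  by apply: eq_integral => z; rewrite inE => Az; rewrite (dv z Az).2.
rewrite /Rintegral fineK//; apply: integrable_fin_num.
  exact: open_measurable2 (pcd_open (Omp_domain G)).
exact: Omp_integrable (dot_continuous cv cv).
Qed.

(** The exponent 8/3 lies between 1 and 3. *)
Lemma powR_lower (R : realType) (h : R) : 0 < h ->
  (h <= 1 -> h ^+ 3 <= h `^ (8 / 3)) /\ (1 <= h -> h <= h `^ (8 / 3)).
Proof.
move=> h0; split => h1.
  rewrite -powR_mulrn ?(ltW h0)//; apply: ger_powR; first by rewrite h0.
  by lra.
by rewrite -[leLHS](powRr1 (ltW h0)); apply: ler_powR => //; lra.
Qed.

Theorem theorem4p6 (R : realType) (G : geometry R) (kp Q alpha beta C0 : R)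
    (kp_gt0 : 0 < kp) (Q_gt0 : 0 < Q) (alpha_gt0 : 0 < alpha)
    (beta_ge0 : 0 <= beta) :
  exists C : R, forall (h : R)
      (Wp : R * R -> R) (DWp : R * R -> R * R)
      (Wf : R * R -> R) (DWf : R * R -> R * R)
      (Wbp : R * R -> R) (DWbp : R * R -> R * R)
      (Wbf : R * R -> R) (DWbf : R * R -> R * R) (qb : R -> R),
    0 < h ->
    original_problem G kp Q alpha beta h Wp DWp Wf DWf ->
    reduced_problem G kp Q alpha beta h Wbp DWbp Wbf DWbf qb ->
    (forall u : R, 0 < u < L G -> `| qb u / h | <= C0) ->
    (sqnorm_grad G (fun z => (Wp z - Wbp z)%R) <= (C * (h `^ (8 / 3)))%R%:E)%E.
Proof.
have L0 := L_gt0 G.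
(* If no reduced solution satisfies the bound for any h, every C works. Otherwise one is fixed
   before h is introduced, and C may depend on its data. *)
have [|C00] := pselect (~ exists h W D W' D' q, [/\ 0 < h,
  reduced_problem G kp Q alpha beta h W D W' D' q & forall u : R, 0 < u < L G -> `|q u / h| <= C0]).
  by move=> no; exists 0 => h Wp DWp Wf DWf Wbp DWbp Wbf DWbf q h0 _ rp qC;
    exfalso; apply: no; exists h, Wbp, DWbp, Wbf, DWbf, q.
have [h1 [W1p [D1p [W1f [D1f [q1 [h10 rp1 qC1]]]]]]] := contrapT C00.
have {}C00 : 0 <= C0.
  by apply: le_trans (normr_ge0 _) (qC1 (L G / 2) _); apply/andP; split; lra.
have [M M1 sqrtgM] := sqrtg_bound G.
have M0 : 0 <= M by exact: le_trans M1.
have [B [K1 [B0 K10 bounds]]] := reduced_bounds G kp Q_gt0 alpha_gt0 beta_ge0 C00.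
have [bnd1 W1b] := bounds _ _ _ _ _ _ h10 rp1 qC1.
have [k1 ck1 kq1] := source_continuous alpha_gt0 beta_ge0 h10 rp1.
(* An upper bound for |Omega(h1)| / |Omega(h)| valid for every h, since |Omega(h)| >= |Omega_p|. *)
pose r0 := vol G h1 / fine (leb2 R (Omp G)).
have m0 := Omp_measure_gt0 G.
have v1 := vol_gt0 G h1.
have r00 : 0 <= r0 by apply: divr_ge0; exact: ltW.
have Ks0 : 0 <= M * C0 * M by apply: mulr_ge0 => //; exact: mulr_ge0.
(* The monotonicity constants depend only on B and on the coupling constants of the two regimes, all
   of which are known before h. *)
have [Cs Cs0 Hs] := flux_monotone alpha_gt0 beta_ge0 B0 Ks0.
have Kl0 : 0 <= (M * C0 * L G + r0 * (M * (C0 * h1)) * (L G + 1)) * M.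
  have Lg0 := ltW L0; have h10' := ltW h10.
  apply: mulr_ge0 => //; apply: addr_ge0; apply: mulr_ge0 => //.
  - exact: mulr_ge0.
  - by apply: mulr_ge0 => //; apply: mulr_ge0 => //; exact: mulr_ge0.
  - exact: addr_ge0.
have [Cl Cl0 Hl] := flux_monotone alpha_gt0 beta_ge0 B0 Kl0.
pose Cs' := 2 * Cs * L G.
pose Cl' := M * (C0 + r0 * (C0 * h1)) * (K1 + r0 * K1) * L G + 4 * Cl * L G.
have Cs'0 : 0 <= Cs' by apply: mulr_ge0; [exact: mulr_ge0|exact: ltW].
have Cl'0 : 0 <= Cl'.
  have Lg0 := ltW L0; have h10' := ltW h10.
  apply: addr_ge0; apply: mulr_ge0 => //; last exact: mulr_ge0.
  apply: mulr_ge0; last by apply: addr_ge0 => //; exact: mulr_ge0.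
  by apply: mulr_ge0 => //; apply: addr_ge0 => //; apply: mulr_ge0 => //; exact: mulr_ge0.
exists ((Cs' + Cl') / kp) => h Wp DWp Wf DWf Wbp DWbp Wbf DWbf q h0 op rp qC.
have [bnd Wb] := bounds _ _ _ _ _ _ h0 rp qC.
have [k ck kq] := source_continuous alpha_gt0 beta_ge0 h0 rp.
rewrite (sqnorm_gradE (v_C1 op rp)) lee_fin mulrAC ler_pdivlMr// mulrC mulrDl.
have [p1 p2] := powR_lower h0; have pw : 0 <= h `^ (8 / 3) by exact: powR_ge0.
have [hle|/ltW hge] := leP h 1.
  have := small_thickness alpha_gt0 beta_ge0 h0 op rp ck kq M1 sqrtgM qC bnd C00 Cs0 hle Hs.
  move=> le; apply: (le_trans le); rewrite -/Cs'.
  rewrite -[leLHS]addr0; apply: lerD; [by apply: ler_wpM2l => //; exact: p1|exact: mulr_ge0].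
have rr : vol G h1 / vol G h <= r0.
  by apply: ler_wpM2l; [exact: ltW|rewrite lef_pV2 ?posrE ?vol_gt0// vol_ge].
have := large_thickness kp_gt0 alpha_gt0 beta_ge0 h0 op rp ck kq M1 sqrtgM qC bnd Wb h10 rp1 ck1 kq1 qC1 W1b hge C00 K10 Cl0 rr Hl.
move=> le; apply: (le_trans le); rewrite -/Cl'.
rewrite -[leLHS]add0r; apply: lerD; [exact: mulr_ge0|by apply: ler_wpM2l => //; exact: p2].
Qed.
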